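(* Let $b$ be a finite Blaschke product, $C_b=\pi(J^{1/2})\Gamma_b$, and $C_{b+}$ the restriction of $C_b$ to $H^2(\mathbb{T})$. (1) A bounded operator $T$ on $L^2(\mathbb{T})$ satisfies $T\pi(\varphi)=\pi(\varphi\circ b)T$ for all $\varphi\in L^\infty(\mathbb{T})$ if and only if $T=\pi(m)C_b$ for some $m\in L^\infty(\mathbb{T})$. (2) A bounded operator $T$ on $H^2(\mathbb{T})$ satisfies $T\tau(\varphi)=\tau(\varphi\circ b)T$ for all $\varphi\in H^\infty(\mathbb{T})$ if and only if $T=\tau(m)C_{b+}$ for some $m\in H^\infty(\mathbb{T})$. Furthermore, if $T=\pi(m)C_b$ with $m\in L^\infty(\mathbb{T})$ (respectively $T=\tau(m)C_{b+}$ with $m\in H^\infty(\mathbb{T})$), then $\|T\|=\|\mathcal{L}(|m|^2)\|_\infty^{1/2}$, and $T$ is an isometry if and only if $\mathcal{L}(|m|^2)=1$ a.e.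
   Context: $b=\prod_{j=1}^N b_{\alpha_j}$ is a finite Blaschke product with $N$ zeros in $\mathbb{D}$ ($b_w(z)=\frac{|w|}{w}\frac{w-z}{1-\overline{w}z}$, $b_0(z)=z$). $\pi(\varphi)$ is multiplication by $\varphi$ on $L^2(\mathbb{T})$ and $\tau(\varphi)=P\pi(\varphi)|_{H^2(\mathbb{T})}$ is the Toeplitz operator ($P$ the orthogonal projection onto $H^2(\mathbb{T})$). $\Gamma_b\xi=\xi\circ b$ (bounded on $L^2(\mathbb{T})$). $J_0(z)=\frac{zb'(z)}{Nb(z)}$, and $J$ is the outer function with $J(0)>0$ and $|J|=J_0$ on $\mathbb{T}$; $J^{1/2}$ is its outer square root (in $H^\infty$ with inverse in $H^\infty$). $C_b$ is an isometry reduced by $H^2(\mathbb{T})$. The transfer operator is $\mathcal{L}(\xi)(z)=\frac1N\sum_{b(w)=z}\xi(w)$. *)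

(* Defs.v *)
(* Functions on the unit circle T are represented
   as functions  F : R[i] -> R[i]  of which only the values on T matter; T is
   parametrised by  theta |-> cis theta  on  [0, 2 pi]  with Lebesgue measure
   (normalised measure = (1/2pi) dtheta). *)
From HB Require Import structures.
From mathcomp Require Import all_boot all_order all_algebra.
From mathcomp Require Import all_classical all_reals all_analysis.
From mathcomp Require Import complex.
From Stdlib Require Import ClassicalEpsilon.
Import Order.TTheory GRing.Theory Num.Theory.
Import numFieldNormedType.Exports.
Set Implicit Arguments. Unset Strict Implicit. Unset Printing Implicit Defensive.
Local Open Scope ring_scope.
Local Open Scope classical_set_scope.

Section Defs.
Variable R : realType.

Definition CC : numFieldType := R[i].

Definition cabs (z : R[i]) : R := Num.sqrt (complex.Re z ^+ 2 + complex.Im z ^+ 2).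

Definition cis (t : R) : R[i] := Complex (cos t) (sin t).

Definition mu := (@lebesgue_measure R).
Definition Dom : set R := `[0, pi *+ 2].

Definition cfun := R[i] -> R[i].

Definition cmeas (F : cfun) : Prop :=
  measurable_fun Dom (fun t => complex.Re (F (cis t))) /\
  measurable_fun Dom (fun t => complex.Im (F (cis t))).

Definition aeeq (F G : cfun) : Prop :=
  {ae mu, forall t, Dom t -> F (cis t) = G (cis t)}.

Definition L2 (F : cfun) : Prop :=
  cmeas F /\ (\int[mu]_(t in Dom) ((cabs (F (cis t))) ^+ 2)%:E < +oo)%E.

Definition l2norm (F : cfun) : R :=
  Num.sqrt ((pi *+ 2)^-1 * Rintegral mu Dom (fun t => (cabs (F (cis t))) ^+ 2)).

Definition Linf (F : cfun) : Prop :=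
  cmeas F /\ exists M : R, {ae mu, forall t, Dom t -> cabs (F (cis t)) <= M}.

Definition essnorm (g : R[i] -> R) : R :=
  inf [set M : R | 0 <= M /\ {ae mu, forall t, Dom t -> `|g (cis t)| <= M}].

Definition cint (g : R -> R[i]) : R[i] :=
  Complex ((pi *+ 2)^-1 * Rintegral mu Dom (fun t => complex.Re (g t)))
          ((pi *+ 2)^-1 * Rintegral mu Dom (fun t => complex.Im (g t))).

Definition ip (F G : cfun) : R[i] := cint (fun t => F (cis t) * conjc (G (cis t))).

Definition fcoef (F : cfun) (n : int) : R[i] :=
  cint (fun t => F (cis t) * cis (- (n%:~R * t))).

Definition H2 (F : cfun) : Prop := L2 F /\ forall n : int, n < 0 -> fcoef F n = 0.
Definition Hinf (F : cfun) : Prop := Linf F /\ forall n : int, n < 0 -> fcoef F n = 0.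

(* orthogonal projection P of L^2 onto H^2:  P F is an element G of H^2 with
   F - G orthogonal to H^2 (unique up to a.e. equality) *)
Definition Pproj (F : cfun) : cfun :=
  epsilon (inhabits (fun _ => 0))
    (fun G => H2 G /\ forall H, H2 H -> ip (fun z => F z - G z) H = 0).

Definition mulop (phi : cfun) (F : cfun) : cfun := fun z => phi z * F z.
Definition toep (phi : cfun) (F : cfun) : cfun := Pproj (mulop phi F).

Definition bfac (w : R[i]) (z : R[i]) : R[i] :=
  if w == 0 then z
  else (Complex (cabs w) 0 / w) * ((w - z) / (1 - conjc w * z)).

Definition blaschke (N : nat) (alpha : 'I_N -> R[i]) (z : R[i]) : R[i] :=
  \prod_(j < N) bfac (alpha j) z.

Definition Gam (b : R[i] -> R[i]) (F : cfun) : cfun := F \o b.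

Definition J0 (N : nat) (alpha : 'I_N -> R[i]) (z : R[i]) : R[i] :=
  z * (@derive1 CC _ (blaschke alpha : CC -> CC) (z : CC) : R[i]) / (N%:R * blaschke alpha z).

(* Jh is (the boundary function of) the outer square root J^{1/2} of the
   outer function J with J(0) > 0 and |J| = J_0 on T.  Characterisation:
   Jh in H^infty with 1/Jh in H^infty (so Jh is outer), |Jh|^2 = J_0 a.e. on T,
   and Jh(0) = (0-th Fourier coefficient) > 0. *)
Definition is_sqrtJ (N : nat) (alpha : 'I_N -> R[i]) (Jh : cfun) : Prop :=
  [/\ Hinf Jh, Hinf (fun z => (Jh z)^-1),
      {ae mu, forall t, Dom t -> Jh (cis t) * conjc (Jh (cis t)) = J0 alpha (cis t)}
    & 0 < fcoef Jh 0].

Definition transfer (N : nat) (alpha : 'I_N -> R[i]) (xi : R[i] -> R) (z : R[i]) : R :=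
  N%:R^-1 * (\sum_(w \in [set w : R[i] | cabs w = 1 /\ blaschke alpha w = z]) xi w)%R.

(* bounded (linear) operators on a closed subspace S (L^2 or H^2), acting on
   representatives and respecting a.e. equality *)
Definition bdd_op (S : cfun -> Prop) (T : cfun -> cfun) : Prop :=
  [/\ forall F, S F -> S (T F),
      forall F G, S F -> S G -> aeeq F G -> aeeq (T F) (T G),
      forall F G, S F -> S G -> aeeq (T (fun z => F z + G z)) (fun z => T F z + T G z),
      forall (c : R[i]) F, S F -> aeeq (T (fun z => c * F z)) (fun z => c * T F z)
    & exists K : R, forall F, S F -> l2norm (T F) <= K * l2norm F].

Definition op_eq (S : cfun -> Prop) (T1 T2 : cfun -> cfun) : Prop :=
  forall F, S F -> aeeq (T1 F) (T2 F).

Definition opnorm (S : cfun -> Prop) (T : cfun -> cfun) : R :=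
  sup [set l2norm (T F) | F in [set F | S F /\ l2norm F <= 1]].

Definition isometry_on (S : cfun -> Prop) (T : cfun -> cfun) : Prop :=
  forall F, S F -> l2norm (T F) = l2norm F.

Definition sqmod (m : cfun) : R[i] -> R := fun z => cabs (m z) ^+ 2.

End Defs.

(* Main.v *)
(* On the circle b (e^{it}) = e^{i psi t} for an increasing bijection psi of
   the line with psi' = N J_0 and psi (t + 2 pi) = psi t + 2 pi N. Cutting a
   period of length 2 pi N into N pieces and substituting s = psi t gives
     int (u o b) v J_0 = int u L(v)    for u, v >= 0,
   hence ||m C_b F||^2 = int |F|^2 L(|m|^2), as |J^{1/2}|^2 = J_0. Norms and
   isometries therefore reduce to a fact on weights g >= 0: if
   int |P|^2 g <= c int |P|^2 for every analytic polynomial P, then g <= c a.e.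
   (|P| = |z^-n P| on the circle, so P may be replaced by a trigonometric
   polynomial, and these approximate indicator functions). Only analytic
   polynomials are tested, so L^2 and H^2 are treated alike.
   An operator T intertwining phi and phi o b satisfies T P = (P o b) T1, that
   is T P = m C_b P with m = T1 / J^{1/2}. Boundedness of T bounds L(|m|^2), and
   |m|^2 <= N L(|m|^2) o b bounds m; T = m C_b then follows on L^2 by testing the
   bounded symbol e^{-|F|}, and on H^2 by density of polynomials. *)
Require Import Defs.
From HB Require Import structures.
From mathcomp Require Import all_boot all_order all_algebra.
From mathcomp Require Import all_classical all_reals all_analysis.
From mathcomp Require Import measurable_realfun.
From mathcomp Require Import complex zify ring lra.
From Stdlib Require Import ClassicalEpsilon.
Import Order.TTheory GRing.Theory Num.Theory.
Import numFieldNormedType.Exports.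
Set Implicit Arguments. Unset Strict Implicit. Unset Printing Implicit Defensive.
Local Open Scope ring_scope.
Local Open Scope classical_set_scope.

(** * The circle and its parametrisation *)

(** Elements of L^2 and H^2 are plain functions, significant only up to null sets of the circle.
    Bounds holding almost everywhere pass through composition with b because b pulls null sets back
    to null sets. Since psi and its inverse leave [0, 2 pi], measurability is first extended to the
    whole line by periodicity. The transfer operator sums over a bare set of points, so the N
    preimages must be exhibited and shown distinct; the inverse of psi provides them and makes L(v)
    measurable.

    Analyticity means only that negative Fourier coefficients vanish. For a Blaschke factor this
    comes from a recursion on coefficients; for products and compositions, from density of
    polynomials in H^2 and closedness of H^2 under L^2 limits. Invertibility of J^{1/2} in
    H^infinity enters twice: it puts T1 / J^{1/2} into H^2, and it recovers phi o b from J^{1/2}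
    (phi o b). All products occurring in (2) lie in H^2, so the projection in the Toeplitz operators
    acts there as the identity, up to null sets. *)

Section ComplexCircle.
Variable R : realType.
Implicit Types (z w : R[i]) (t s : R).
Local Notation Re := complex.Re.
Local Notation Im := complex.Im.

Lemma complexP z w : Re z = Re w -> Im z = Im w -> z = w.
Proof. by case: z w => [a b] [c d] /= -> ->. Qed.

Lemma CReD z w : Re (z + w) = Re z + Re w. Proof. by case: z w => [a b] [c d]. Qed.
Lemma CImD z w : Im (z + w) = Im z + Im w. Proof. by case: z w => [a b] [c d]. Qed.
Lemma CReN z : Re (- z) = - Re z. Proof. by case: z. Qed.
Lemma CImN z : Im (- z) = - Im z. Proof. by case: z. Qed.
Lemma CReM z w : Re (z * w) = Re z * Re w - Im z * Im w.
Proof. by case: z w => [a b] [c d]. Qed.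
Lemma CImM z w : Im (z * w) = Re z * Im w + Im z * Re w.
Proof. by case: z w => [a b] [c d]. Qed.
Lemma CRe_conj z : Re (conjc z) = Re z. Proof. by case: z. Qed.
Lemma CIm_conj z : Im (conjc z) = - Im z. Proof. by case: z. Qed.
Lemma CRe1 : Re (1 : R[i]) = 1. Proof. by []. Qed.
Lemma CIm1 : Im (1 : R[i]) = 0. Proof. by []. Qed.
Lemma CRe0 : Re (0 : R[i]) = 0. Proof. by []. Qed.
Lemma CIm0 : Im (0 : R[i]) = 0. Proof. by []. Qed.

Definition ReImE := (CReD, CImD, CReN, CImN, CReM, CImM, CRe_conj, CIm_conj, CRe1, CIm1, CRe0, CIm0).

Lemma CRe_sum I (r : seq I) (P : pred I) (F : I -> R[i]) :
  Re (\sum_(i <- r | P i) F i) = \sum_(i <- r | P i) Re (F i).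
Proof. by elim/big_rec2: _ => // i x y _ <-; rewrite CReD. Qed.

Lemma cabs_normc z : cabs z = Normc.normc z. Proof. by case: z. Qed.

Lemma cabs_ge0 z : 0 <= cabs z. Proof. exact: sqrtr_ge0. Qed.

Lemma cabsM z w : cabs (z * w) = cabs z * cabs w.
Proof. by rewrite !cabs_normc Normc.normcM. Qed.

Lemma cabsV z : cabs z^-1 = (cabs z)^-1.
Proof. by rewrite !cabs_normc Normc.normcV. Qed.

Lemma cabs0 : cabs (0 : R[i]) = 0. Proof. by rewrite cabs_normc Normc.normc0. Qed.
Lemma cabs1 : cabs (1 : R[i]) = 1. Proof. by rewrite cabs_normc Normc.normc1. Qed.

Lemma cabs_eq0 z : (cabs z == 0) = (z == 0).
Proof.
apply/eqP/eqP => [|->]; last exact: cabs0.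
by rewrite cabs_normc => /Normc.eq0_normc.
Qed.

Lemma sqr_cabs z : cabs z ^+ 2 = Re z ^+ 2 + Im z ^+ 2.
Proof. by rewrite sqr_sqrtr// addr_ge0// sqr_ge0. Qed.

Lemma cabsX z n : cabs (z ^+ n) = cabs z ^+ n.
Proof. by elim: n => [|n ih]; rewrite ?expr0 ?cabs1// !exprS cabsM ih. Qed.

Lemma cabsN z : cabs (- z) = cabs z.
Proof. by rewrite /cabs !ReImE !sqrrN. Qed.

Lemma cabs_conj z : cabs (conjc z) = cabs z.
Proof. by rewrite /cabs !ReImE !sqrrN. Qed.

Lemma cabs_real (x : R) : cabs (Complex x 0) = `|x|.
Proof. by rewrite /cabs /= expr0n addr0 sqrtr_sqr. Qed.

Lemma sqr_cabsD z w : cabs (z + w) ^+ 2 <= 2 * cabs z ^+ 2 + 2 * cabs w ^+ 2.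
Proof.
by rewrite !sqr_cabs !ReImE; have := sqr_ge0 (Re z - Re w);
  have := sqr_ge0 (Im z - Im w); nra.
Qed.

Lemma normRe_le_cabs z : `|Re z| <= cabs z.
Proof.
rewrite -[X in _ <= X]ger0_norm ?cabs_ge0// -ler_sqr ?nnegrE// !real_normK ?num_real//.
by rewrite sqr_cabs lerDl sqr_ge0.
Qed.

Lemma normIm_le_cabs z : `|Im z| <= cabs z.
Proof.
rewrite -[X in _ <= X]ger0_norm ?cabs_ge0// -ler_sqr ?nnegrE// !real_normK ?num_real//.
by rewrite sqr_cabs lerDr sqr_ge0.
Qed.

Lemma cabs_le_ReIm z : cabs z <= `|Re z| + `|Im z|.
Proof.
rewrite -ler_sqr ?nnegrE ?cabs_ge0 ?addr_ge0// sqr_cabs sqrrD !real_normK ?num_real//.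
by rewrite lerD2r lerDl mulrn_wge0// mulr_ge0.
Qed.

Lemma cabs_triangle z w : cabs (z + w) <= cabs z + cabs w.
Proof.
rewrite -ler_sqr ?nnegrE ?cabs_ge0 ?addr_ge0 ?cabs_ge0// sqrrD -mulr_natl.
have : Re z * Re w + Im z * Im w <= cabs z * cabs w.
  rewrite -(cabs_conj w) -cabsM (le_trans (ler_norm _))// (le_trans _ (normRe_le_cabs _))//.
  by rewrite !ReImE mulrN opprK.
by rewrite !sqr_cabs !ReImE; lra.
Qed.

Lemma mul_conjc z : z * conjc z = Complex (cabs z ^+ 2) 0.
Proof. by rewrite sqr_cabs; apply: complexP => /=; rewrite !ReImE; ring. Qed.

Lemma invc_unit z : cabs z = 1 -> z^-1 = conjc z.
Proof.
move=> z1; have z0 : z != 0 by rewrite -cabs_eq0 z1 oner_eq0.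
apply: (mulfI z0); rewrite divff// mul_conjc z1 expr1n.
by apply: complexP.
Qed.

Lemma Re_cis t : Re (cis t) = cos t. Proof. by []. Qed.
Lemma cabs_cis t : cabs (cis t) = 1.
Proof. by rewrite /cabs /= cos2Dsin2 sqrtr1. Qed.

Lemma cis_neq0 t : cis t != 0.
Proof. by rewrite -cabs_eq0 cabs_cis oner_eq0. Qed.

Lemma cis0 : cis (0 : R) = 1.
Proof. by apply: complexP; rewrite /= ?cos0 ?sin0. Qed.

Lemma cisD s t : cis (s + t) = cis s * cis t.
Proof. by apply: complexP; rewrite !ReImE /= ?cosD ?sinD//; ring. Qed.

Lemma cisN t : cis (- t) = conjc (cis t).
Proof. by apply: complexP; rewrite !ReImE /= ?cosN ?sinN. Qed.

Lemma cisV t : cis (- t) = (cis t)^-1.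
Proof. by rewrite cisN invc_unit// cabs_cis. Qed.

Lemma cisX t n : cis t ^+ n = cis (n%:R * t).
Proof.
elim: n => [|n ih]; first by rewrite mul0r cis0.
by rewrite exprS ih -cisD -natr1 mulrDl mul1r addrC.
Qed.

Lemma cis2pi : cis (pi *+ 2 : R) = 1.
Proof. by apply: complexP; rewrite /= ?cos2pi ?sin2pi. Qed.

Lemma cis_periodn t n : cis (t + n%:R * (pi *+ 2)) = cis t.
Proof. by rewrite cisD -cisX cis2pi expr1n mulr1. Qed.

Lemma cis_periodz t (n : int) : cis (t + n%:~R * (pi *+ 2)) = cis t.
Proof.
case: n => n; first exact: cis_periodn.
by rewrite NegzE mulrNz mulNr -[LHS](cis_periodn _ n.+1) subrK.
Qed.

Lemma cis_period t : cis (t + pi *+ 2) = cis t.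
Proof. by rewrite -[RHS](cis_periodn _ 1) mul1r. Qed.

Lemma cis_surj z : cabs z = 1 -> exists2 t, 0 <= t < pi *+ 2 & cis t = z.
Proof.
move=> z1; have : Re z ^+ 2 + Im z ^+ 2 = 1 by rewrite -sqr_cabs z1 expr1n.
move=> h; have x1 : -1 <= Re z <= 1 by have := sqr_ge0 (Im z); nra.
have sa : sin (acos (Re z)) = `|Im z|.
  by rewrite sin_acos// -sqrtr_sqr; congr Num.sqrt; lra.
have ca : cos (acos (Re z)) = Re z by rewrite acosK// in_itv.
have a0 := acos_ge0 x1; have api := acos_lepi x1.
have pi0 := @pi_gt0 R.
have [y0|y0] := leP 0 (Im z).
  exists (acos (Re z)); first by rewrite a0 /=; lra.
  by apply: complexP; rewrite /= ?ca// sa ger0_norm.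
have a_gt0 : 0 < acos (Re z).
  rewrite lt_neqAle a0 andbT; apply/eqP => aE.
  by move: sa; rewrite -aE sin0 ltr0_norm//; lra.
exists (- acos (Re z) + pi *+ 2); first by lra.
rewrite cis_period; apply: complexP; rewrite /= ?cosN ?ca//.
by rewrite sinN sa ltr0_norm// opprK.
Qed.

Lemma cos1_eq0 t : 0 <= t < pi *+ 2 -> cos t = 1 -> t = 0.
Proof.
move=> /andP[t0 t2] ct; have pi0 := @pi_gt0 R.
have [tpi|tpi] := leP t pi.
  by apply: cos_inj; rewrite ?in_itv /= ?t0 ?lexx ?pi_ge0// cos0.
have : pi *+ 2 - t = 0.
  apply: cos_inj; rewrite ?in_itv /= ?lexx ?pi_ge0//; first by lra.
  by rewrite cos0 -cosN opprB -[LHS]cosD2pi subrK.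
by lra.
Qed.

Lemma cis_inj t s : cis t = cis s -> exists n : int, t = s + n%:~R * (pi *+ 2).
Proof.
move=> ts; have p2 : 0 < (pi : R) *+ 2 by have := @pi_gt0 R; lra.
pose n := Num.floor ((t - s) / (pi *+ 2)); exists n.
have /andP[n1 n2] := floor_itv ((t - s) / (pi *+ 2)).
suff : t - s - n%:~R * (pi *+ 2) = 0 by lra.
apply: cos1_eq0.
  apply/andP; split; first by move: n1; rewrite ler_pdivlMr// -/n; lra.
  by move: n2; rewrite ltr_pdivrMr// -/n intrD mulrDl mul1r; lra.
rewrite -[LHS]Re_cis -mulNr -mulrNz cis_periodz cisD ts -cisD subrr.
by rewrite cis0.
Qed.

Lemma cis_inj_itv t s : 0 <= t < pi *+ 2 -> 0 <= s < pi *+ 2 -> cis t = cis s -> t = s.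
Proof.
have pi0 := @pi_gt0 R.
move=> /andP[t0 t2] /andP[s0 s2] /cis_inj[n tE].
have n0 : n = 0.
  apply/eqP; rewrite eq_le; apply/andP; split.
    by rewrite -ltzD1 -(ltr_int R) intrD; nra.
  by rewrite -ltzD1 -(ltr_int R) intrD; nra.
by rewrite tE n0 mul0r addr0.
Qed.

(** The representative of t modulo 2 pi in [0, 2 pi[; through it, measurability on one period
    extends to the line. *)
Definition angle_mod t : R := t - (Num.floor (t / (pi *+ 2)))%:~R * (pi *+ 2).

Lemma angle_mod_itv t : 0 <= angle_mod t < pi *+ 2.
Proof.
have p2 : 0 < (pi : R) *+ 2 by have := @pi_gt0 R; lra.
have /andP[n1 n2] := floor_itv (t / (pi *+ 2)).
rewrite /angle_mod; apply/andP; split; first by move: n1; rewrite ler_pdivlMr//; lra.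
by move: n2; rewrite ltr_pdivrMr// intrD mulrDl mul1r; lra.
Qed.

Lemma cis_angle_mod t : cis (angle_mod t) = cis t.
Proof. by rewrite /angle_mod -mulNr -mulrNz cis_periodz. Qed.

End ComplexCircle.

(** * Substitution in Lebesgue integrals *)

Section DensityPushforward.
Context (R : realType).
Local Notation T := (measurableTypeR R).
Local Notation lam := (@lebesgue_measure R).
Variables (psi : T -> T) (d : T -> R).
Hypotheses (mpsi : measurable_fun setT psi) (md : measurable_fun setT d).
Hypothesis d_ge0 : forall t, 0 <= d t.
Local Open Scope ereal_scope.

Let mpre (A : set T) : measurable A -> measurable (psi @^-1` A).
Proof. by move=> mA; rewrite -(setTI (_ @^-1` _)); exact: mpsi. Qed.

Let mdE (A : set T) : measurable_fun A (EFin \o d).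
Proof. by apply: measurable_funTS; exact/measurable_EFinP. Qed.

(** The image under psi of the measure d(t) dt; with d = psi' it will turn out to be Lebesgue
    measure. *)
Definition push_density (A : set T) := \int[lam]_(t in psi @^-1` A) (d t)%:E.

Let push_density0 : push_density set0 = 0.
Proof. by rewrite /push_density preimage_set0 integral_set0. Qed.

Let push_density_ge0 A : 0 <= push_density A.
Proof. by apply: integral_ge0 => t _; rewrite lee_fin. Qed.

Let push_density_sigma : semi_sigma_additive push_density.
Proof.
move=> F mF tF mUF; rewrite /push_density preimage_bigcup.
rewrite ge0_integral_bigcup.
- have h : cvgn (fun n => \sum_(0 <= i < n) push_density (F i)).
    by apply: (is_cvg_nneseries (P := xpredT)) => n _ _; exact: push_density_ge0.
  exact: h.
- by move=> k; apply: mpre; exact: (mF k).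
- exact: mdE.
- by move=> t _; rewrite lee_fin.
- apply/trivIsetP => /= i j _ _ ij; rewrite -preimage_setI.
  by move/trivIsetP : tF => /(_ _ _ _ _ ij) ->//; rewrite preimage_set0.
Qed.

HB.instance Definition _ := isMeasure.Build _ _ _
  push_density push_density0 push_density_ge0 push_density_sigma.

Definition push_density_measure : {measure set T -> \bar R} := push_density.

Import HBNNSimple.

(** Both sides pass to the limit along simple functions increasing to f, by monotone convergence;
    for a simple function the claim reduces, value by value, to the definition of [push_density] on
    a level set. *)
Lemma ge0_integral_push_density (A : set T) (f : T -> \bar R) :
  measurable A -> measurable_fun A f -> (forall y, A y -> 0 <= f y) ->
  \int[push_density]_(y in A) f y =
  \int[lam]_(t in psi @^-1` A) (f (psi t) * (d t)%:E).
Proof.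
move=> mA mf f0.
have mpA := mpre mA.
pose h := nnsfun_approx mA mf.
have mh n : measurable_fun (psi @^-1` A) (fun t => (h n (psi t) * d t)%:E).
  apply: measurable_funTS; apply/measurable_EFinP; apply: measurable_funM => //.
  by apply: measurableT_comp.
have -> : \int[push_density]_(y in A) f y =
    lim (\int[push_density]_(y in A) (EFin \o h n) y @[n --> \oo]).
  have fE x : A x -> f x = lim ((EFin \o h n) x @[n --> \oo]).
    by move=> Ex; apply/esym/cvg_lim => //; exact: cvg_nnsfun_approx.
  under eq_integral => x /[!inE] /fE -> //.
  apply: monotone_convergence => //.
  - by move=> n; apply/measurable_EFinP/measurable_funTS.
  - by move=> n x Ex //=; rewrite lee_fin.
  - by move=> x Ex a b ab; rewrite lee_fin; exact/lefP/nd_nnsfun_approx.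
have -> : \int[lam]_(t in psi @^-1` A) (f (psi t) * (d t)%:E) =
    lim (\int[lam]_(t in psi @^-1` A) (h n (psi t) * d t)%:E @[n --> \oo]).
  have fg t : A (psi t) -> f (psi t) * (d t)%:E =
      lim ((h n (psi t) * d t)%:E @[n --> \oo]).
    move=> At; apply/esym/cvg_lim => //; under eq_fun do rewrite EFinM.
    by apply: cvgeZr => //; exact: cvg_nnsfun_approx.
  under eq_integral => x /[!inE] /fg -> //.
  apply: monotone_convergence => //.
  - by move=> n t _; rewrite lee_fin mulr_ge0.
  - by move=> t At a b ab; rewrite lee_fin ler_wpM2r//; exact/lefP/nd_nnsfun_approx.
apply/congr_lim/funext => n.
transitivity (\int[push_density]_(x in A)
   (\sum_(y \in range (h n)) (y * \1_(h n @^-1` [set y]) x)%:E)).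
  by apply: eq_integral => t tE; rewrite /= fimfunE -fsumEFin.
have mi B r : measurable B ->
  measurable_fun B (fun x => (r * \1_(h n @^-1` [set r]) x)%:E).
  by move=> mB; apply: (measurable_comp measurableT) => //; exact: measurable_funM.
rewrite ge0_integral_fsum//; first last.
- by move=> m y Ey; exact: nnfun_muleindic_ge0.
- by move=> r; exact: mi.
transitivity (\int[lam]_(x in psi @^-1` A) (\sum_(y \in range (h n))
    ((y * \1_(h n @^-1` [set y]) (psi x)) * d x)%:E)); last first.
  apply: eq_integral => x xE; rewrite [in RHS]fimfunE fsumEFin//.
  by rewrite !fsbig_finite//= big_distrl.
have mind r : measurable_fun setT (\1_(h n @^-1` [set r]) : T -> R) by [].
have mip r : measurable_fun (psi @^-1` A)
    (fun x : T => (r * \1_(h n @^-1` [set r]) (psi x) * d x)%:E).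
  apply: measurable_funTS; apply/measurable_EFinP; apply: measurable_funM => //.
  apply: measurable_funM => //.
  exact: (measurableT_comp (mind r)).
have ni0 r t : (0 <= r * \1_(h n @^-1` [set r]) (psi t) * d t)%R.
  by rewrite mulr_ge0// -lee_fin nnfun_muleindic_ge0.
rewrite ge0_integral_fsum//; last by move=> r t _; rewrite lee_fin.
apply: eq_fsbigr => r rhn.
rewrite integralZl_indic_nnsfun//.
have r0 : (0 <= r)%R by move: rhn; rewrite inE => -[t _ <-].
under [RHS]eq_integral do rewrite -mulrA EFinM.
rewrite ge0_integralZl//; first last.
- by move=> t _; rewrite lee_fin mulr_ge0// indicE.
- apply: measurable_funTS; apply/measurable_EFinP; apply: measurable_funM => //.
  exact: (measurableT_comp (mind r)).
congr (_ * _); rewrite integral_indic//.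
change (push_density (h n @^-1` [set r] `&` A) = \int[lam]_(t in psi @^-1` A)
     (\1_(h n @^-1` [set r]) (psi t) * d t)%:E).
rewrite /push_density preimage_setI setIC integral_mkcondr.
apply: eq_integral => t _; rewrite patchE indicE.
have -> : (t \in psi @^-1` (h n @^-1` [set r])) = (psi t \in h n @^-1` [set r]).
  by apply/idP/idP; rewrite !inE.
by case: (_ \in _); rewrite ?mul1r ?mul0r.
Qed.

End DensityPushforward.

Section SubstitutionMeasurable.
Context (R : realType).
Local Notation lam := (@lebesgue_measure R).
Variables (psi chi d : R -> R).
Hypothesis chiK : cancel chi psi.
Hypothesis cd : continuous d.
Hypothesis d_ge0 : forall t, 0 <= d t.
Hypothesis psi_incr : {homo psi : s t / s < t}.
Hypothesis dpsi : forall t : R, is_derive t 1 psi (d t).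
Local Open Scope ereal_scope.

Let cpsi : continuous psi.
Proof.
by move=> t; apply: differentiable_continuous; apply/derivable1_diffP; apply: ex_derive.
Qed.

Lemma ge0_integral_substitution (A : set R) (f : R -> \bar R) :
  measurable A -> measurable_fun A f -> (forall y, A y -> 0 <= f y) ->
  \int[lam]_(y in A) f y = \int[lam]_(t in psi @^-1` A) (f (psi t) * (d t)%:E).
Proof.
move=> mA mf f0.
have mpsi := continuous_measurable_fun cpsi.
have md := continuous_measurable_fun cd.
rewrite -(ge0_integral_push_density mpsi md)//.
apply: eq_measure_integral => B mB _.
apply: (lebesgue_measure_unique (mu := push_density_measure mpsi md d_ge0)) => //.
move=> _ [[a b] _ <-]; rewrite -[RHS]/(push_density psi d _) /=.
rewrite lebesgue_measure_itv /= lte_fin /push_density.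
have [ab|ba] := ltP a b; last first.
  by rewrite set_itv_ge ?preimage_set0 ?integral_set0// bnd_simp -leNgt.
have chi_incr : (chi a < chi b)%R.
  rewrite ltNge; apply/negP; rewrite le_eqVlt => /orP[/eqP e|/psi_incr].
    by move: ab; rewrite -(chiK a) -(chiK b) e ltxx.
  by rewrite !chiK => /(lt_trans ab); rewrite ltxx.
have -> : psi @^-1` `]a, b]%classic = `]chi a, chi b]%classic.
  apply/seteqP; split => t /=; rewrite !in_itv /= => /andP[h1 h2]; apply/andP; split.
  - by rewrite ltNge; apply/negP; rewrite le_eqVlt => /orP[/eqP e|/psi_incr];
      [move: h1; rewrite e chiK ltxx|rewrite chiK => /(lt_trans h1); rewrite ltxx].
  - by rewrite leNgt; apply/negP => /psi_incr; rewrite chiK ltNge h2.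
  - by rewrite -(chiK a) psi_incr.
  - by move: h2; rewrite le_eqVlt => /orP[/eqP->|/psi_incr]; rewrite chiK// => /ltW.
rewrite integral_itv_obnd_cbnd; last first.
  by apply: measurable_funTS; apply/measurable_EFinP.
rewrite (@continuous_FTC2 _ d psi)// ?chiK ?EFinB//.
- by apply: continuous_subspaceT.
- split.
  + by move=> x _; apply: ex_derive.
  + exact/cvg_at_right_filter/cpsi.
  + exact/cvg_at_left_filter/cpsi.
- by move=> x _; rewrite derive1E; apply: derive_val.
Qed.

End SubstitutionMeasurable.

Section Translation.
Context (R : realType).
Local Notation lam := (@lebesgue_measure R).
Local Open Scope ereal_scope.

Lemma ge0_integral_translation (c : R) (A : set R) (f : R -> \bar R) :
  measurable A -> measurable_fun A f -> (forall y, A y -> 0 <= f y) ->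
  \int[lam]_(y in A) f y = \int[lam]_(t in (fun t => t + c)%R @^-1` A) f (t + c)%R.
Proof.
move=> mA mf f0.
have dp (t : R) : is_derive t 1%R (fun t => t + c)%R 1%R.
  rewrite -[X in is_derive _ _ _ X]addr0.
  by apply: (@is_deriveD _ _ _ id (cst c)).
rewrite (@ge0_integral_substitution _ (fun t => t + c)%R (fun t => t - c)%R (fun=> 1%R))//.
- by apply: eq_integral => t _; rewrite mule1.
- by move=> t /=; rewrite subrK.
- by move=> t; exact: cvg_cst.
- by move=> s t st /=; rewrite ltrD2r.
Qed.

End Translation.

(** * Measurability and integration on the circle *)

Section CircleMeasurability.
Variable R : realType.
Local Notation Re := complex.Re.
Local Notation Im := complex.Im.
Local Notation C := R[i].
Local Notation lam := (@lebesgue_measure R).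
Local Notation D := (@Dom R).
Implicit Types (u v : C -> R) (F G : C -> C) (P Q : C -> Prop).

Lemma measurable_Dom : measurable D.
Proof. exact: measurable_itv. Qed.
Hint Resolve measurable_Dom : core.

Lemma two_pi_gt0 : 0 < (pi : R) *+ 2.
Proof. by rewrite mulrn_wgt0// pi_gt0. Qed.

Lemma lebesgue_Dom : lam D = (pi *+ 2)%:E.
Proof. by rewrite lebesgue_measure_itv/= lte_fin two_pi_gt0 sube0. Qed.

(** Stated on the whole line rather than on [Dom], because arguments such as psi t and chi s leave
    one period; [cmeasr_Dom] recovers it from one period. *)
Definition cmeasr u := measurable_fun setT (fun t => u (cis t)).

Lemma measurable_angle_mod : measurable_fun setT (@angle_mod R).
Proof.
apply: measurable_funB => //; apply: measurable_funM => //.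
apply: nondecreasing_measurable => // s t st.
by rewrite ler_int; apply: le_floor; rewrite ler_pM2r// invr_gt0 two_pi_gt0.
Qed.

Lemma cmeasr_Dom u : measurable_fun D (fun t => u (cis t)) -> cmeasr u.
Proof.
move=> mu_; rewrite /cmeasr.
rewrite (_ : (fun t => u (cis t)) = (fun t => u (cis t)) \o @angle_mod R); last first.
  by apply/funext => t /=; rewrite cis_angle_mod.
apply: (measurable_comp measurable_Dom _ mu_ measurable_angle_mod).
move=> _ [t _ <-]; rewrite /Dom /= in_itv /=.
by have /andP[-> /ltW ->] := angle_mod_itv t.
Qed.

Lemma cmeasP F : cmeas F <-> cmeasr (fun z => Re (F z)) /\ cmeasr (fun z => Im (F z)).
Proof.
by split=> -[h1 h2]; split;
  [exact: cmeasr_Dom|exact: cmeasr_Dom|exact: measurable_funTS|exact: measurable_funTS].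
Qed.

Lemma cmeasr_cst (c : R) : cmeasr (fun=> c).
Proof. exact: measurable_cst. Qed.

Lemma cmeasrD u v : cmeasr u -> cmeasr v -> cmeasr (fun z => u z + v z).
Proof. by move=> mu_ mv; exact: measurable_funD. Qed.

Lemma cmeasrN u : cmeasr u -> cmeasr (fun z => - u z).
Proof. by move=> mu_; exact: measurable_funN. Qed.

Lemma cmeasrB u v : cmeasr u -> cmeasr v -> cmeasr (fun z => u z - v z).
Proof. by move=> mu_ mv; exact: measurable_funB. Qed.

Lemma cmeasrM u v : cmeasr u -> cmeasr v -> cmeasr (fun z => u z * v z).
Proof. by move=> mu_ mv; exact: measurable_funM. Qed.

Lemma cmeasrX u n : cmeasr u -> cmeasr (fun z => u z ^+ n).
Proof. by move=> mu_; exact: measurable_funX. Qed.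

Lemma cmeasr_comp (f : R -> R) u : measurable_fun setT f -> cmeasr u ->
  cmeasr (fun z => f (u z)).
Proof. by move=> mf mu_; exact: (measurableT_comp mf mu_). Qed.

Lemma cmeasr_ext u v : (forall t, u (cis t) = v (cis t)) -> cmeasr u -> cmeasr v.
Proof. by move=> uv; rewrite /cmeasr (_ : (fun t => u (cis t)) = (fun t => v (cis t)))//; apply/funext. Qed.

Lemma cmeas_cst (c : C) : cmeas (fun=> c).
Proof. by apply/cmeasP; split; exact: cmeasr_cst. Qed.

Lemma cmeas_id : cmeas (fun z : C => z).
Proof.
apply/cmeasP; split; apply: continuous_measurable_fun => t.
  exact: continuous_cos.
exact: continuous_sin.
Qed.

Lemma cmeas_real u : cmeasr u -> cmeas (fun z => Complex (u z) 0).
Proof. by move=> mu_; apply/cmeasP; split => //; exact: cmeasr_cst. Qed.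

Lemma cmeasD F G : cmeas F -> cmeas G -> cmeas (fun z => F z + G z).
Proof.
move=> /cmeasP[F1 F2] /cmeasP[G1 G2]; apply/cmeasP; split.
  by apply: (@cmeasr_ext (fun z => Re (F z) + Re (G z))) => [t|]; [rewrite CReD|exact: cmeasrD].
by apply: (@cmeasr_ext (fun z => Im (F z) + Im (G z))) => [t|]; [rewrite CImD|exact: cmeasrD].
Qed.

Lemma cmeasM F G : cmeas F -> cmeas G -> cmeas (fun z => F z * G z).
Proof.
move=> /cmeasP[F1 F2] /cmeasP[G1 G2]; apply/cmeasP; split.
  apply: (@cmeasr_ext (fun z => Re (F z) * Re (G z) - Im (F z) * Im (G z))) => [t|].
    by rewrite CReM.
  by apply: cmeasrB; exact: cmeasrM.
apply: (@cmeasr_ext (fun z => Re (F z) * Im (G z) + Im (F z) * Re (G z))) => [t|].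
  by rewrite CImM.
by apply: cmeasrD; exact: cmeasrM.
Qed.

Lemma cmeasZ c F : cmeas F -> cmeas (fun z => c * F z).
Proof. by apply: cmeasM; exact: cmeas_cst. Qed.

Lemma cmeas_ext F G : (forall t, F (cis t) = G (cis t)) -> cmeas F -> cmeas G.
Proof.
move=> FG /cmeasP[F1 F2]; apply/cmeasP; split.
  by apply: cmeasr_ext F1 => t; rewrite FG.
by apply: cmeasr_ext F2 => t; rewrite FG.
Qed.

Lemma cmeasN F : cmeas F -> cmeas (fun z => - F z).
Proof. by move=> /(cmeasZ (-1)); apply: cmeas_ext => t; rewrite mulN1r. Qed.

Lemma cmeasB F G : cmeas F -> cmeas G -> cmeas (fun z => F z - G z).
Proof. by move=> mF mG; apply: cmeasD => //; exact: cmeasN. Qed.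

Lemma cmeas_conj F : cmeas F -> cmeas (fun z => conjc (F z)).
Proof.
move=> /cmeasP[F1 F2]; apply/cmeasP; split.
  by apply: cmeasr_ext F1 => t; rewrite CRe_conj.
by apply: (@cmeasr_ext (fun z => - Im (F z))) => [t|]; [rewrite CIm_conj|exact: cmeasrN].
Qed.

Lemma cmeasX F n : cmeas F -> cmeas (fun z => F z ^+ n).
Proof.
move=> mF; elim: n => [|n ih].
  by apply: cmeas_ext (cmeas_cst 1) => t; rewrite expr0.
by apply: cmeas_ext (cmeasM mF ih) => t; rewrite exprS.
Qed.

Lemma cmeas_sum I (r : seq I) (f : I -> C -> C) :
  (forall i, cmeas (f i)) -> cmeas (fun z => \sum_(i <- r) f i z).
Proof.
move=> mf; elim: r => [|i r ih].
  by apply: cmeas_ext (cmeas_cst 0) => t; rewrite big_nil.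
by apply: cmeas_ext (cmeasD (mf i) ih) => t; rewrite big_cons.
Qed.

Lemma cmeas_poly (p : {poly C}) : cmeas (fun z => p.[z]).
Proof.
apply: (@cmeas_ext (fun z => \sum_(i < size p) p`_i * z ^+ i)) => [t|].
  by rewrite horner_coef.
by apply: cmeas_sum => i; apply: cmeasZ; apply: cmeasX; exact: cmeas_id.
Qed.

Lemma cmeasr_sqmod F : cmeas F -> cmeasr (sqmod F).
Proof.
move=> /cmeasP[F1 F2]; apply: (@cmeasr_ext (fun z => Re (F z) ^+ 2 + Im (F z) ^+ 2)).
  by move=> t; rewrite /sqmod sqr_cabs.
by apply: cmeasrD; exact: cmeasrX.
Qed.

Lemma measurable_sqrtr : measurable_fun setT (@Num.sqrt R).
Proof. by apply: continuous_measurable_fun; exact: sqrt_continuous. Qed.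

Lemma cmeasr_cabs F : cmeas F -> cmeasr (fun z => cabs (F z)).
Proof.
move=> /cmeasr_sqmod mF; apply: cmeasr_ext (cmeasr_comp measurable_sqrtr mF) => t.
by rewrite /sqmod sqrtr_sqr ger0_norm// cabs_ge0.
Qed.

Lemma sqmod_ge0 F z : 0 <= sqmod F z. Proof. exact: sqr_ge0. Qed.

Lemma lebesgue_aeS (A B : set R) : A `<=` B ->
  {ae lam, forall t, A t} -> {ae lam, forall t, B t}.
Proof.
move=> AB aA.
have F : Filter (almost_everywhere lam) by exact: ae_filter_ringOfSetsType.
exact: (@filterS _ _ F _ _ AB).
Qed.

Lemma lebesgue_aeI (A B : set R) :
  {ae lam, forall t, A t} -> {ae lam, forall t, B t} -> {ae lam, forall t, A t /\ B t}.
Proof.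
move=> aA aB.
have F : Filter (almost_everywhere lam) by exact: ae_filter_ringOfSetsType.
exact: (@filterI _ _ F).
Qed.

Definition aecirc P := {ae lam, forall t, D t -> P (cis t)}.

Lemma aecircW P : (forall z, cabs z = 1 -> P z) -> aecirc P.
Proof. by move=> PP; apply: aeW => t _; apply: PP; rewrite cabs_cis. Qed.

Lemma aecirc_mp P Q : aecirc P -> (forall z, cabs z = 1 -> P z -> Q z) -> aecirc Q.
Proof.
by move=> aP PQ; apply: lebesgue_aeS aP => t Pt Dt; apply: PQ; [exact: cabs_cis|exact: Pt].
Qed.

Lemma aecirc_and P Q : aecirc P -> aecirc Q -> aecirc (fun z => P z /\ Q z).
Proof. move=> aP aQ; apply: lebesgue_aeS (lebesgue_aeI aP aQ) => t [Pt Qt] Dt.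
by split; [exact: Pt|exact: Qt]. Qed.

Lemma aecirc_mp2 P1 P2 Q : aecirc P1 -> aecirc P2 ->
  (forall z, cabs z = 1 -> P1 z -> P2 z -> Q z) -> aecirc Q.
Proof.
by move=> h1 h2 h; apply: aecirc_mp (aecirc_and h1 h2) _ => z z1 [p1 p2]; exact: h.
Qed.

Lemma aeeqE F G : aeeq F G <-> aecirc (fun z => F z = G z).
Proof. by []. Qed.

Lemma aeeq_refl F : aeeq F F.
Proof. exact: (@aecircW (fun z => F z = F z)). Qed.

Lemma aeeq_on F G : (forall z, cabs z = 1 -> F z = G z) -> aeeq F G.
Proof. exact: (@aecircW (fun z => F z = G z)). Qed.

Lemma aeeq_sym F G : aeeq F G -> aeeq G F.
Proof. by move=> FG; apply: (@aecirc_mp (fun z => F z = G z) (fun z => G z = F z)) => // z _ ->. Qed.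

Lemma aeeq_trans F G H : aeeq F G -> aeeq G H -> aeeq F H.
Proof.
move=> FG GH.
apply: (@aecirc_mp2 (fun z => F z = G z) (fun z => G z = H z) (fun z => F z = H z)) => //.
by move=> z _ -> ->.
Qed.

(** Unnormalised (total mass 2 pi) and extended-real, so that integrals of nonnegative functions can
    be compared before they are known to be finite. *)
Definition circint u : \bar R := (\int[lam]_(t in D) (u (cis t))%:E)%E.

Lemma cmeasr_EFin u : cmeasr u -> measurable_fun D (fun t => (u (cis t))%:E).
Proof. by move=> mu_; apply/measurable_EFinP; exact: measurable_funTS. Qed.

Lemma circint_ge0 u : (forall z, 0 <= u z) -> (0 <= circint u)%E.
Proof. by move=> u0; apply: integral_ge0 => t _; rewrite lee_fin. Qed.

Lemma circint_ext u v : (forall z, cabs z = 1 -> u z = v z) -> circint u = circint v.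
Proof. by move=> uv; apply: eq_integral => t _; rewrite uv// cabs_cis. Qed.

Lemma circintD u v : cmeasr u -> cmeasr v -> (forall z, 0 <= u z) -> (forall z, 0 <= v z) ->
  circint (fun z => u z + v z) = (circint u + circint v)%E.
Proof.
move=> mu_ mv u0 v0; rewrite /circint; under eq_integral do rewrite EFinD.
by rewrite ge0_integralD//; [move=> t _; rewrite lee_fin|exact: cmeasr_EFin
  |move=> t _; rewrite lee_fin|exact: cmeasr_EFin].
Qed.

Lemma circintZ (c : R) u : cmeasr u -> 0 <= c -> (forall z, 0 <= u z) ->
  circint (fun z => c * u z) = (c%:E * circint u)%E.
Proof.
move=> mu_ c0 u0; rewrite /circint; under eq_integral do rewrite EFinM.
by rewrite ge0_integralZl_EFin//; [move=> t _; rewrite lee_fin|exact: cmeasr_EFin].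
Qed.

Lemma circint_cst (c : R) : circint (fun=> c) = (c * (pi *+ 2))%:E.
Proof. by rewrite /circint integral_cst// [X in (_ * X)%E]lebesgue_Dom. Qed.

Lemma ae_le_circint u v : cmeasr u -> cmeasr v -> (forall z, 0 <= u z) ->
  (forall z, 0 <= v z) -> aecirc (fun z => u z <= v z) -> (circint u <= circint v)%E.
Proof.
move=> mu_ mv u0 v0 uv; apply: ae_ge0_le_integral.
- exact: measurable_Dom.
- by move=> t _; rewrite lee_fin.
- exact: cmeasr_EFin.
- by move=> t _; rewrite lee_fin.
- exact: cmeasr_EFin.
- by apply: lebesgue_aeS uv => t h Dt; rewrite lee_fin h.
Qed.

Lemma le_circint u v : cmeasr u -> cmeasr v -> (forall z, 0 <= u z) ->
  (forall z, 0 <= v z) -> (forall z, cabs z = 1 -> u z <= v z) -> (circint u <= circint v)%E.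
Proof. by move=> mu_ mv u0 v0 uv; apply: ae_le_circint => //; exact: aecircW. Qed.

Lemma ae_eq_circint u v : cmeasr u -> cmeasr v -> aecirc (fun z => u z = v z) ->
  circint u = circint v.
Proof.
move=> mu_ mv uv; apply: ae_eq_integral => //; [exact: cmeasr_EFin|exact: cmeasr_EFin|].
by apply: lebesgue_aeS uv => t h Dt; rewrite h.
Qed.

Lemma circint_eq0 u : cmeasr u -> (forall z, 0 <= u z) -> circint u = 0%E ->
  aecirc (fun z => u z = 0).
Proof.
move=> mu_ u0 iu0.
have /(ae_eq_integral_abs lam measurable_Dom (cmeasr_EFin mu_)) h :
    (\int[lam]_(t in D) `|(u (cis t))%:E| = 0)%E.
  by rewrite -[RHS]iu0; apply: eq_integral => t _; rewrite gee0_abs// lee_fin.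
by apply: lebesgue_aeS h => t h Dt; have := h Dt; case.
Qed.

Lemma circint_lty_le u v : cmeasr u -> cmeasr v -> (forall z, 0 <= u z) ->
  (forall z, 0 <= v z) -> (forall z, cabs z = 1 -> u z <= v z) ->
  (circint v < +oo)%E -> (circint u < +oo)%E.
Proof. by move=> mu_ mv u0 v0 uv; apply: le_lt_trans; exact: le_circint. Qed.

Lemma l2normE F : l2norm F = Num.sqrt ((pi *+ 2)^-1 * fine (circint (sqmod F))).
Proof. by []. Qed.

Lemma l2norm_ge0 F : 0 <= l2norm F. Proof. exact: sqrtr_ge0. Qed.

Lemma sqr_l2norm F : l2norm F ^+ 2 = (pi *+ 2)^-1 * fine (circint (sqmod F)).
Proof.
rewrite sqr_sqrtr// mulr_ge0// ?invr_ge0 ?(ltW two_pi_gt0)// fine_ge0//.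
by apply: (@circint_ge0 (sqmod F)) => z; exact: sqmod_ge0.
Qed.

Lemma circint_sqmod F : L2 F -> circint (sqmod F) = (l2norm F ^+ 2 * (pi *+ 2))%:E.
Proof.
move=> [_ F2]; rewrite sqr_l2norm mulrAC mulVf ?gt_eqF ?two_pi_gt0// mul1r fineK//.
by rewrite ge0_fin_numE// (@circint_ge0 (sqmod F))// => z; exact: sqmod_ge0.
Qed.

Lemma ae_sqmod F G : cmeas F -> cmeas G -> aeeq F G ->
  circint (sqmod F) = circint (sqmod G).
Proof.
move=> mF mG FG; apply: ae_eq_circint; [exact: cmeasr_sqmod|exact: cmeasr_sqmod|].
by apply: aecirc_mp ((aeeqE _ _).1 FG) _ => z _ FGz; rewrite /sqmod FGz.
Qed.

Lemma L2D F G : L2 F -> L2 G -> L2 (fun z => F z + G z).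
Proof.
move=> [mF F2] [mG G2]; split; first exact: cmeasD.
apply: (@circint_lty_le (sqmod (fun z => F z + G z)) (fun z => 2 * sqmod F z + 2 * sqmod G z)).
- exact: cmeasr_sqmod (cmeasD mF mG).
- by apply: cmeasrD; apply: cmeasrM; (try exact: cmeasr_sqmod); exact: cmeasr_cst.
- by move=> z; exact: sqmod_ge0.
- by move=> z; rewrite addr_ge0// mulr_ge0// sqmod_ge0.
- by move=> z _; exact: sqr_cabsD.
- rewrite circintD.
  + rewrite !circintZ ?lte_add_pinfty ?lte_mul_pinfty//; try exact: cmeasr_sqmod;
      by move=> z; exact: sqmod_ge0.
  + by apply: cmeasrM; (try exact: cmeasr_sqmod); exact: cmeasr_cst.
  + by apply: cmeasrM; (try exact: cmeasr_sqmod); exact: cmeasr_cst.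
  + by move=> z; rewrite mulr_ge0// sqmod_ge0.
  + by move=> z; rewrite mulr_ge0// sqmod_ge0.
Qed.

Lemma L2_ae F G : cmeas G -> aeeq F G -> L2 F -> L2 G.
Proof.
move=> mG FG [mF F2]; split => //.
by change (circint (sqmod G) < +oo)%E; rewrite -(ae_sqmod mF mG FG).
Qed.

Lemma LinfP F : Linf F <-> cmeas F /\ exists2 M : R, 0 <= M & aecirc (fun z => cabs (F z) <= M).
Proof.
split=> -[mF]; last by move=> [M M0 h]; split => //; exists M.
move=> [M h]; split => //; exists `|M| => //.
have h' : aecirc (fun z => cabs (F z) <= M) by exact: h.
by apply: aecirc_mp h' _ => z _ /le_trans; apply; exact: ler_norm.
Qed.

Lemma LinfM F G : Linf F -> Linf G -> Linf (fun z => F z * G z).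
Proof.
move=> /LinfP[mF [M M0 FM]] /LinfP[mG [K K0 GK]]; apply/LinfP; split; first exact: cmeasM.
exists (M * K); first exact: mulr_ge0.
by apply: aecirc_mp2 FM GK _ => z _ h1 h2; rewrite cabsM ler_pM// cabs_ge0.
Qed.

Lemma circint_sqmodM F G (M : R) : cmeas F -> cmeas G -> 0 <= M ->
  aecirc (fun z => cabs (F z) <= M) ->
  (circint (sqmod (fun z => F z * G z)%R) <= (M ^+ 2)%:E * circint (sqmod G))%E.
Proof.
move=> mF mG M0 FM; rewrite -circintZ//; last 3 first.
- exact: cmeasr_sqmod.
- exact: sqr_ge0.
- by move=> z; exact: sqmod_ge0.
apply: ae_le_circint.
- exact: cmeasr_sqmod (cmeasM mF mG).
- by apply: cmeasrM; [exact: cmeasr_cst|exact: cmeasr_sqmod].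
- by move=> z; exact: sqmod_ge0.
- by move=> z; rewrite mulr_ge0 ?sqr_ge0// sqmod_ge0.
- apply: aecirc_mp FM _ => z _ h; rewrite /sqmod cabsM exprMn ler_wpM2r ?sqr_ge0//.
  by rewrite ler_sqr ?nnegrE// cabs_ge0.
Qed.

Lemma LinfM_L2 F G : Linf F -> L2 G -> L2 (fun z => F z * G z).
Proof.
move=> /LinfP[mF [M M0 FM]] [mG G2]; split; first exact: cmeasM.
by apply: le_lt_trans (circint_sqmodM mF mG M0 FM) _; rewrite lte_mul_pinfty// lee_fin sqr_ge0.
Qed.

Lemma Linf_cst (c : C) : Linf (fun=> c).
Proof.
apply/LinfP; split; first exact: cmeas_cst.
by exists (cabs c); [exact: cabs_ge0|apply: aecircW].
Qed.

Lemma Linf_L2 F : Linf F -> L2 F.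
Proof.
move=> FI; have L21 : L2 (fun _ : C => 1).
  split; first exact: cmeas_cst.
  by change (circint (fun=> cabs (1%R : C) ^+ 2)%R < +oo)%E; rewrite circint_cst ltry.
by apply: (L2_ae FI.1 _ (LinfM_L2 FI L21)); apply: aeeq_on => z _; rewrite mulr1.
Qed.

Lemma L2Z c F : L2 F -> L2 (fun z => c * F z).
Proof. exact/LinfM_L2/Linf_cst. Qed.

Lemma L2N F : L2 F -> L2 (fun z => - F z).
Proof.
move=> /(L2Z (-1)); rewrite (_ : (fun z => -1 * F z) = (fun z => - F z))//.
by apply/funext => z; rewrite mulN1r.
Qed.

Lemma L2B F G : L2 F -> L2 G -> L2 (fun z => F z - G z).
Proof. by move=> F2 G2; apply: L2D => //; exact: L2N. Qed.

Lemma Linf_poly (p : {poly C}) : Linf (fun z => p.[z]).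
Proof.
apply/LinfP; split; first exact: cmeas_poly.
exists (\sum_(i < size p) cabs p`_i); first by apply: sumr_ge0 => i _; exact: cabs_ge0.
apply: aecircW => z z1.
rewrite horner_coef; apply: (@le_trans _ _ (\sum_(i < size p) cabs (p`_i * z ^+ i))).
  elim/big_rec2: _ => [|i x y _ h]; first by rewrite cabs0.
  by apply: le_trans (cabs_triangle _ _) _; rewrite lerD2l.
by apply: ler_sum => i _; rewrite cabsM cabsX z1 expr1n mulr1.
Qed.

Lemma aeeq_cancel_sqmod F G : cmeas F -> cmeas G ->
  circint (sqmod (fun z => F z - G z)) = 0%E -> aeeq F G.
Proof.
move=> mF mG h0; have := circint_eq0 (cmeasr_sqmod (cmeasB mF mG)) (@sqmod_ge0 _) h0.
move=> h; apply/aeeqE; apply: aecirc_mp h _ => z _ /eqP.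
by rewrite /sqmod sqrf_eq0 cabs_eq0 subr_eq0 => /eqP.
Qed.

End CircleMeasurability.

(** * The phase of a Blaschke factor *)

Section BlaschkeFactor.
Variable R : realType.
Local Notation Re := complex.Re.
Local Notation Im := complex.Im.
Implicit Types (a : R[i]) (t : R).

Definition den_re a t := 1 - (Re a * cos t + Im a * sin t).
Definition den_im a t := Im a * cos t - Re a * sin t.
(* [phase a] is a continuous argument of (e^{it} - a) / (1 - conj(a) e^{it}): the
   denominator has positive real part, so its argument is an arctangent. *)
Definition phase a t := t - 2 * atan (den_im a t / den_re a t).
Definition poisson a t := (1 - cabs a ^+ 2) / (den_re a t ^+ 2 + den_im a t ^+ 2).

Lemma den_cis a t : 1 - conjc a * cis t = Complex (den_re a t) (den_im a t).
Proof. by apply: complexP; rewrite !ReImE /= /den_re /den_im; ring. Qed.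

Lemma den_re_gt0 a t : cabs a < 1 -> 0 < den_re a t.
Proof.
move=> a1; rewrite subr_gt0 (le_lt_trans _ a1)//.
have -> : Re a * cos t + Im a * sin t = Re (conjc a * cis t).
  by rewrite !ReImE /=; ring.
by apply: le_trans (ler_norm _) (le_trans (normRe_le_cabs _) _); rewrite cabsM cabs_conj cabs_cis mulr1.
Qed.

Lemma sqr_den a t : den_re a t ^+ 2 + den_im a t ^+ 2 = cabs (1 - conjc a * cis t) ^+ 2.
Proof. by rewrite den_cis sqr_cabs. Qed.

Lemma den_neq0 a t : cabs a < 1 -> 1 - conjc a * cis t != 0.
Proof.
by move=> /(den_re_gt0 t) a1; rewrite den_cis eq_complex /= negb_and gt_eqF.
Qed.

Lemma sqr_den_gt0 a t : cabs a < 1 -> 0 < den_re a t ^+ 2 + den_im a t ^+ 2.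
Proof. by move=> /(den_re_gt0 t) a1; rewrite ltr_pwDl ?exprn_gt0 ?sqr_ge0. Qed.

Lemma poisson_gt0 a t : cabs a < 1 -> 0 < poisson a t.
Proof.
move=> a1; rewrite divr_gt0 ?sqr_den_gt0// subr_gt0.
by rewrite expr_lt1// cabs_ge0.
Qed.

(** For w = 1 - conj(a) e^{it} this is |w|^2 = 2 Re w - 1 + |1 - w|^2, where |1 - w| = |a|. *)
Lemma sqr_denE a t : den_re a t ^+ 2 + den_im a t ^+ 2 =
  2 * den_re a t - 1 + cabs a ^+ 2.
Proof.
rewrite sqr_cabs /den_re /den_im.
by have := cos2sin2 t; set x := cos t; set y := sin t => xy; ring: xy.
Qed.

Lemma is_derive_den_re a t : is_derive (t : R) 1 (den_re a) (- den_im a t).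
Proof.
have -> : den_re a = cst 1 - ((Re a \*: cos) + (Im a \*: sin)) by [].
by apply: is_derive_eq; rewrite /den_im sub0r !scalerN /GRing.scale /=; ring.
Qed.

Lemma is_derive_den_im a t : is_derive (t : R) 1 (den_im a) (den_re a t - 1).
Proof.
have -> : den_im a = (Im a \*: cos) - (Re a \*: sin) by [].
by apply: is_derive_eq; rewrite /den_re !scalerN /GRing.scale /=; ring.
Qed.

(** Write A and B for [den_re a t] and [den_im a t]. As A' = -B and B' = A - 1, the arctangent of B
    / A has derivative 1 - A / (A^2 + B^2). Hence the phase has derivative 2 A / (A^2 + B^2) - 1,
    which [sqr_denE] turns into the Poisson kernel. *)
Lemma is_derive_phase a t : cabs a < 1 -> is_derive (t : R) 1 (phase a) (poisson a t).
Proof.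
move=> a1; have A0 := den_re_gt0 t a1; have A0' := lt0r_neq0 A0.
have S0 := lt0r_neq0 (sqr_den_gt0 t a1).
have dA := is_derive_den_re a t; have dB := is_derive_den_im a t.
have dV : is_derive (t : R) 1 (fun s => (den_re a s)^-1) _ := is_deriveV A0' dA.
have dq := is_deriveM dB dV.
have dat := is_derive1_comp (is_derive1_atan _) dq.
have dp := is_deriveD (is_derive_id t 1) (is_deriveZ (- 2) dat).
have -> : phase a = id + (- 2) \*: (atan \o (den_im a * (fun s => (den_re a s)^-1))).
  by apply/funext => s; rewrite /phase -[RHS]/(s + - 2 *: atan _) scaleNr.
apply: (is_derive_eq dp).
rewrite /poisson /GRing.scale /= !fctE.
have E := sqr_denE a t; move: E A0' S0.
set A := den_re a t; set B := den_im a t => E A0' S0.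
have -> : 1 - cabs a ^+ 2 = 2 * A - (A ^+ 2 + B ^+ 2) by rewrite E; ring.
have q0 : 1 + (B * A^-1) ^+ 2 != 0.
  by rewrite gt_eqF// ltr_pwDl// sqr_ge0.
by field; rewrite A0' S0.
Qed.

(** With w = 1 - conj(a) e^{it} one has e^{it} - a = e^{it} conj(w), so the quotient is e^{it}
    conj(w) / w, of argument t - 2 arg w. The constant k absorbs the sign and the factor |a| / a. *)
Lemma bfac_cis a : cabs a < 1 ->
  exists2 k : R[i], cabs k = 1 & forall t, bfac a (cis t) = k * cis (phase a t).
Proof.
move=> a1; have key t : (conjc a * cis t != 1) /\
    (a - cis t) / (1 - conjc a * cis t) = - cis (phase a t).
  have A0 := den_re_gt0 t a1; have d0 := den_neq0 t a1.
  split; first by rewrite eq_sym -subr_eq0.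
  apply: (mulIf d0); rewrite divfK//.
  set th := atan (den_im a t / den_re a t).
  have c0 : cos th != 0 by apply/lt0r_neq0/cos_gt0_pihalf; rewrite atan_gtNpi2 atan_ltpi2.
  have E : den_im a t / den_re a t = sin th / cos th by rewrite -[LHS]atanK.
  (* Polar form of the denominator: its modulus is its real part divided by the cosine of its
     argument. *)
  have uE : 1 - conjc a * cis t = Complex (den_re a t / cos th) 0 * cis th.
    rewrite den_cis; apply: complexP; rewrite !ReImE /=.
      by rewrite mul0r subr0 divfK.
    by rewrite mul0r addr0 mulrAC -mulrA -E mulrC divfK// gt_eqF.
  have wE : a - cis t = - cis t * conjc (1 - conjc a * cis t).
    have := cos2sin2 t => xy.
    by apply: complexP; rewrite !ReImE /=; ring: xy.
  rewrite wE uE -/th !mulNr; congr (- _).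
  rewrite /phase -/th cisD.
  have -> : cis (- (2 * th)) = cis (- th) * cis (- th) by rewrite -cisD; congr cis; ring.
  have cE : conjc (Complex (den_re a t / cos th) 0 * cis th) =
      Complex (den_re a t / cos th) 0 * cis (- th).
    by apply: complexP; rewrite !ReImE /= ?cosN ?sinN; ring.
  have e : cis (- th) * cis th = 1 by rewrite -cisD addNr cis0.
  by rewrite cE; ring: e.
rewrite /bfac; have [->|a0] := eqVneq a 0.
  exists 1; first exact: cabs1.
  move=> t; rewrite mul1r /phase /den_im /=; congr cis.
  by rewrite !mul0r subr0 mul0r atan0 mulr0 subr0.
exists (- (Complex (cabs a) 0 / a)).
  by rewrite cabsN cabsM cabsV cabs_real ger0_norm ?cabs_ge0// divff// cabs_eq0.
by move=> t; rewrite (key t).2 mulrN mulNr.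
Qed.

Lemma continuous_poisson (a : R[i]) : cabs a < 1 -> continuous (poisson a).
Proof.
move=> a1 t; apply: cvgM; first exact: cvg_cst.
have cA : {for t, continuous (den_re a)}.
  by apply: differentiable_continuous; apply/derivable1_diffP; have [] := is_derive_den_re a t.
have cB : {for t, continuous (den_im a)}.
  by apply: differentiable_continuous; apply/derivable1_diffP; have [] := is_derive_den_im a t.
apply: cvgV; first by rewrite gt_eqF// sqr_den_gt0.
by apply: cvgD; apply: cvgM.
Qed.

End BlaschkeFactor.

(** * Logarithmic derivative of b and the values of J_0 on the circle *)

Section LogDerivative.
Variable R : realType.
Local Notation C := (CC R).

(** [L i] is the logarithmic derivative of [f i]; writing f' = f L makes these add up without any
    division. *)
Lemma is_derive_prod_log I (r : seq I) (f : I -> C -> C) (L : I -> C) (z : C) :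
  (forall i, is_derive z 1 (f i) (f i z * L i)) ->
  is_derive z 1 (fun w => \prod_(i <- r) f i w) (\prod_(i <- r) f i z * \sum_(i <- r) L i).
Proof.
move=> df; elim: r => [|i r ih].
  rewrite (_ : (fun _ => _) = cst 1); last by apply/funext => w; rewrite big_nil.
  by rewrite !big_nil mulr0; exact: is_derive_cst.
have h := is_deriveM (df i) ih.
rewrite (_ : (fun w => \prod_(j <- i :: r) f j w) = f i * (fun w => \prod_(j <- r) f j w)).
  apply: (is_derive_eq h).
  by rewrite !big_cons /GRing.scale /=; ring.
by apply/funext => w; rewrite big_cons.
Qed.

(** The logarithmic derivative is -1 / (a - z) + conj(a) / (1 - conj(a) z), put over one
    denominator. The case a = 0 is separate because [bfac 0] is the identity. *)
Lemma is_derive_bfac (a : R[i]) (t : R) : cabs a < 1 ->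
  is_derive (cis t : C) (1 : C) (bfac a : C -> C)
    (bfac a (cis t) * ((Complex (cabs a ^+ 2) 0 - 1) /
                       ((a - cis t) * (1 - conjc a * cis t))) : C).
Proof.
move=> a1.
have d0 := den_neq0 t a1.
have n0 : a - cis t != 0.
  rewrite subr_eq0; apply/eqP => aE; move: a1.
  by rewrite aE cabs_cis ltxx.
have [a0|a0] := eqVneq a 0.
  have -> : (bfac a : C -> C) = id by apply/funext => z; rewrite /bfac a0 eqxx.
  have c0 : conjc (0 : R[i]) = 0 by apply: complexP; rewrite !ReImE ?oppr0.
  have e0 : Complex (cabs (0 : R[i]) ^+ 2) 0 = 0 by rewrite cabs0 expr0n.
  rewrite a0 c0 e0 mul0r subr0 mulr1 !sub0r invrN mulrNN mul1r.
  by rewrite divff ?cis_neq0//; exact: is_derive_id.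
pose z : C := cis t.
pose k : C := Complex (cabs a) 0 / a.
pose den : C -> C := cst (1 : C) - (conjc a : C) \*: id.
pose num : C -> C := cst (a : C) - id.
have dd : is_derive z 1 den (- conjc a : C).
  rewrite -[X in is_derive _ _ _ X]sub0r -[conjc a in X in is_derive _ _ _ X]mulr1.
  exact: is_deriveB.
have dn : is_derive z 1 num (- 1 : C).
  rewrite -[X in is_derive _ _ _ X]sub0r; exact: is_deriveB.
have den0 : den z != 0 by exact: d0.
have dV : is_derive z 1 (fun y => (den y)^-1) (- (den z) ^- 2 *: (- conjc a : C)).
  by apply: DeriveDef; [exact: derivableV|rewrite deriveV// derive_val].
have dq := is_deriveZ k (is_deriveM dn dV).
have -> : (bfac a : C -> C) = k \*: (num * (fun y => (den y)^-1)).
  by apply/funext => w; rewrite /bfac (negbTE a0).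
apply: (is_derive_eq dq).
rewrite -[(k \*: (num * _)) _]/(k * ((a - z) * (1 - conjc a * z)^-1)) /GRing.scale /=.
rewrite -[num z]/(a - z) -[den z]/(1 - conjc a * z) -mul_conjc.
have {}d0 : 1 - conjc a * z != 0 by [].
have {}n0 : a - z != 0 by [].
rewrite -[cis t]/z; by field; rewrite d0 n0.
Qed.

Variables (N : nat) (alpha : 'I_N -> R[i]).
Hypothesis alpha1 : forall j, cabs (alpha j) < 1.

Definition blaschke_jac (t : R) : R := N%:R^-1 * \sum_(j < N) poisson (alpha j) t.

(** For z = e^{it} and d = 1 - conj(a) z one has a - z = - z conj(d), so z times the logarithmic
    derivative of a factor becomes (1 - |a|^2) / |d|^2, its Poisson kernel. *)
Lemma J0_cis t : J0 alpha (cis t) = Complex (blaschke_jac t) 0.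
Proof.
have db := @is_derive_prod_log _ (index_enum 'I_N) (fun j => bfac (alpha j)) _ (cis t)
  (fun j => is_derive_bfac t (alpha1 j)).
rewrite /J0 derive1E -[blaschke alpha]/(fun w => \prod_(i < N) bfac (alpha i) w).
rewrite (@derive_val _ _ _ _ _ _ _ db).
set b := \prod_(i < N) _.
have b0 : b != 0.
  apply/prodf_neq0 => i _; have [k k1 ->] := bfac_cis (alpha1 i).
  by rewrite -cabs_eq0 cabsM k1 cabs_cis mulr1 oner_eq0.
rewrite invfM; set n := N%:R^-1; set S := \sum_(i < N) _.
have -> : cis t * (b * S) * (n * b^-1) = n * (cis t * S) by field.
rewrite /S mulr_sumr {}/n.
have -> : Complex (blaschke_jac t) 0 = N%:R^-1 * \sum_(j < N) Complex (poisson (alpha j) t) 0.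
  rewrite /blaschke_jac; have -> : (N%:R : R[i]) = (N%:R : R)%:C%C by rewrite rmorph_nat.
  have -> : \sum_(j < N) Complex (poisson (alpha j) t) 0 = (\sum_(j < N) poisson (alpha j) t)%:C%C.
    by rewrite rmorph_sum.
  by rewrite -fmorphV -rmorphM.
congr (_ * _); apply: eq_bigr => j _.
have d0 := den_neq0 t (alpha1 j).
set a := alpha j in d0 *; set d := 1 - conjc a * cis t in d0 *.
have z0 := cis_neq0 t.
have wE : a - cis t = - cis t * conjc d.
  have := cos2sin2 t => xy.
  by rewrite /d; apply: complexP; rewrite !ReImE /=; ring: xy.
have cd0 : conjc d != 0 by rewrite conjc_eq0.
have -> : Complex (poisson a t) 0 = (1 - Complex (cabs a ^+ 2) 0) / (d * conjc d).
  rewrite mul_conjc /poisson sqr_den -/d.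
  have -> : (1 : R[i]) - Complex (cabs a ^+ 2) 0 = (1 - cabs a ^+ 2)%:C%C.
    by apply: complexP; rewrite /= ?subr0// !ReImE /= ?subr0.
  by rewrite -[Complex (cabs d ^+ 2) 0]/((cabs d ^+ 2)%:C%C) -fmorphV -rmorphM.
rewrite wE; field.
by rewrite z0 d0 cd0.
Qed.

End LogDerivative.

(** * The transfer operator as a change of variables *)

Section BlaschkeLift.
Variable R : realType.
Local Notation Re := complex.Re.
Local Notation tpi := ((pi : R) *+ 2).
Variables (N : nat) (alpha : 'I_N -> R[i]).
Hypothesis N0 : (0 < N)%N.
Hypothesis alpha1 : forall j, cabs (alpha j) < 1.
Local Notation b := (blaschke alpha).
Local Notation jac := (blaschke_jac alpha).

Let NR0 : 0 < (N%:R : R). Proof. by rewrite ltr0n. Qed.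

Let mulSr_nat (x : R) n : n.+1%:R * x = n%:R * x + x.
Proof. by rewrite -natr1 mulrDl mul1r. Qed.

Let shift_natmul (f : R -> R) p q : (forall t, f (t + p) = f t + q) ->
  forall t n, f (t + n%:R * p) = f t + n%:R * q.
Proof.
move=> fp t; elim=> [|n ih]; first by rewrite !mul0r !addr0.
by rewrite !mulSr_nat !addrA fp ih.
Qed.

Lemma jac_gt0 t : 0 < jac t.
Proof.
rewrite mulr_gt0 ?invr_gt0//.
case: N N0 alpha alpha1 => // n _ al al1; rewrite big_ord_recl ltr_pwDl ?poisson_gt0//.
by apply: sumr_ge0 => i _; rewrite ltW// poisson_gt0.
Qed.

Lemma continuous_jac : continuous jac.
Proof.
move=> t; apply: cvgM; first exact: cvg_cst.
elim: (index_enum 'I_N) => [|j r ih].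
  by under [X in X @ _ --> _]eq_fun do rewrite big_nil; rewrite big_nil; exact: cvg_cst.
under [X in X @ _ --> _]eq_fun do rewrite big_cons.
by rewrite big_cons; apply: cvgD => //; exact: continuous_poisson.
Qed.

Definition lift0 t : R := \sum_(j < N) phase (alpha j) t.

Lemma is_derive_lift0 t : is_derive (t : R) 1 lift0 (N%:R * jac t).
Proof.
have -> : lift0 = \sum_(j < N) phase (alpha j) by apply/funext => s; rewrite fct_sumE.
have -> : N%:R * jac t = \sum_(j < N) poisson (alpha j) t.
  by rewrite /blaschke_jac mulrA mulfV ?mul1r// lt0r_neq0.
by apply: is_derive_sum => j; exact: is_derive_phase.
Qed.

Lemma phase_period (a : R[i]) t : phase a (t + tpi) = phase a t + tpi.
Proof. by rewrite /phase /den_im /den_re cosD2pi sinD2pi; ring. Qed.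

Lemma lift0_period t : lift0 (t + tpi) = lift0 t + N%:R * tpi.
Proof.
rewrite /lift0; under eq_bigr do rewrite phase_period.
by rewrite big_split /= sumr_const card_ord -[tpi *+ N]mulr_natl.
Qed.

Lemma blaschke_cis_lift0 : exists c, forall t, b (cis t) = cis (c + lift0 t).
Proof.
have /choice[k kP] : forall j, exists k : R[i], cabs k = 1 /\
    forall t, bfac (alpha j) (cis t) = k * cis (phase (alpha j) t).
  by move=> j; have [k] := bfac_cis (alpha1 j); exists k.
have /cis_surj[c _ cE] : cabs (\prod_(j < N) k j) = 1.
  by elim/big_ind: _ => [|x y x1 y1|j _]; rewrite ?cabs1 ?cabsM ?x1 ?y1 ?mulr1// (kP j).1.
exists c => t; rewrite cisD cE /blaschke.
under eq_bigr do rewrite (kP _).2.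
rewrite big_split /=; congr (_ * _).
by rewrite /lift0; elim/big_rec2: _ => [|j x y _ ->]; rewrite ?cis0 ?cisD.
Qed.

Definition circle_lift (psi chi : R -> R) := [/\ forall t, b (cis t) = cis (psi t),
  cancel psi chi, cancel chi psi, {homo psi : s t / s < t} &
  (forall t : R, is_derive t 1 psi (N%:R * jac t)) /\
  forall t, psi (t + tpi) = psi t + N%:R * tpi].

Lemma exists_circle_lift : exists psi chi, circle_lift psi chi.
Proof.
have [c cE] := blaschke_cis_lift0.
pose psi t := c + lift0 t.
have dpsi (t : R) : is_derive t 1 psi (N%:R * jac t).
  have -> : psi = cst c + lift0 by [].
  rewrite -[X in is_derive _ _ _ X]add0r.
  by apply: is_deriveD; exact: is_derive_lift0.
have ppsi t : psi (t + tpi) = psi t + N%:R * tpi by rewrite /psi lift0_period addrA.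
have cpsi : continuous psi.
  by move=> t; apply: differentiable_continuous; apply/derivable1_diffP; have [] := dpsi t.
have ipsi : {homo psi : s t / s < t}.
  move=> s t st; apply: (@gtr0_derive1_lt_cc _ psi s t _ _ _ s t _ _ st).
  - by move=> x _; have [] := dpsi x.
  - by move=> x _; rewrite derive1E (@derive_val _ _ _ _ _ _ _ (dpsi x)) mulr_gt0// jac_gt0.
  - exact: continuous_subspaceT.
  - by rewrite in_itv /= lexx ltW.
  - by rewrite in_itv /= lexx ltW.
have ppsin t n : psi (t + n%:R * tpi) = psi t + n%:R * (N%:R * tpi).
  exact: shift_natmul.
have /choice[chi chiE] : forall s, exists t, psi t = s.
  (* Over n periods [psi] moves by 2 pi N n >= n in either direction, so n > |s - psi 0| brings s
     within reach of the intermediate value theorem. *)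
  move=> s; pose n := Num.bound `|s - psi 0|.
  have nb : `|s - psi 0| < n%:R * (N%:R * tpi).
    rewrite (lt_le_trans (archi_boundP (normr_ge0 _)))// ler_peMr//.
    have := @pi_ge2 R; have : (1 : R) <= N%:R by rewrite ler1n.
    by move: (N%:R : R) => x; nra.
  have tpi0 := two_pi_gt0 R.
  have le1 : - (n%:R * tpi) <= n%:R * tpi.
    have x0 : 0 <= n%:R * tpi by rewrite mulr_ge0// ltW.
    by rewrite (le_trans _ x0)// oppr_le0.
  have [||t _ tE] := @IVT _ psi (- (n%:R * tpi)) (n%:R * tpi) s le1.
  - exact: continuous_subspaceT.
  - have e1 := ppsin 0 n; have e2 := ppsin (- (n%:R * tpi)) n.
    rewrite add0r in e1; rewrite addNr in e2.
    have : psi (- (n%:R * tpi)) <= psi (n%:R * tpi).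
      by move: le1; rewrite le_eqVlt => /predU1P[->//|/ipsi/ltW].
    rewrite minEle maxEle => le2; rewrite le2.
    by move: nb; rewrite e1 ltr_norml => /andP[]; lra.
  by exists t.
exists psi, chi; split => //.
move=> t; case: (ltgtP (chi (psi t)) t) => // /ipsi; rewrite chiE ltxx//.
Qed.

Section WithLift.
Variables psi chi : R -> R.
Hypothesis lift_psi : circle_lift psi chi.
Local Notation lam := (@lebesgue_measure R).

Let bcis t : b (cis t) = cis (psi t). Proof. by case: lift_psi. Qed.
Let psiK : cancel psi chi. Proof. by case: lift_psi. Qed.
Let chiK : cancel chi psi. Proof. by case: lift_psi. Qed.
Let psi_incr : {homo psi : s t / s < t}. Proof. by case: lift_psi. Qed.
Let dpsi (t : R) : is_derive t 1 psi (N%:R * jac t). Proof. by case: lift_psi => _ _ _ _ []. Qed.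
Let ppsi t : psi (t + tpi) = psi t + N%:R * tpi. Proof. by case: lift_psi => _ _ _ _ []. Qed.

Let ppsin t n : psi (t + n%:R * tpi) = psi t + n%:R * (N%:R * tpi).
Proof. exact: shift_natmul. Qed.

Let ppsiz t (n : int) : psi (t + n%:~R * tpi) = psi t + n%:~R * (N%:R * tpi).
Proof.
case: n => n; first exact: ppsin.
rewrite NegzE mulrNz !mulNr.
by have := ppsin (t - n.+1%:R * tpi) n.+1; rewrite subrK => ->; rewrite addrK.
Qed.

Let psi_mono : {mono psi : s t / s < t}.
Proof. exact: leW_mono (le_mono psi_incr). Qed.

Lemma chi_incr : {homo chi : s t / s <= t}.
Proof. by move=> s t st; rewrite leNgt -psi_mono !chiK -leNgt. Qed.

Lemma measurable_chi : measurable_fun setT chi.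
Proof. by apply: nondecreasing_measurable => //; exact: chi_incr. Qed.

Lemma measurable_lift : measurable_fun setT psi.
Proof. by apply: nondecreasing_measurable => // s t; rewrite le_eqVlt => /predU1P[->//|/psi_incr/ltW]. Qed.

Lemma cmeasr_blaschke (u : R[i] -> R) : cmeasr u -> cmeasr (fun z => u (b z)).
Proof.
move=> mu_; rewrite /cmeasr.
rewrite (_ : (fun t => _) = (fun t => u (cis t)) \o psi); last by apply/funext => t /=; rewrite bcis.
exact: measurableT_comp mu_ measurable_lift.
Qed.

(** The points s + 2 pi k with k < N represent the angle s once in each turn of a period 2 pi N of
    the image of psi; [chi] carries them to the preimages of e^{is} under b. *)
Definition fiber_point s (k : 'I_N) : R[i] := cis (chi (s + k%:R * tpi)).

(** Equal points have angles differing by 2 pi m; applying psi gives k = k' + m N, and 0 <= k, k' <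
    N forces m = 0. *)
Lemma fiber_point_inj s : injective (fiber_point s).
Proof.
move=> k k' /cis_inj[m] /(congr1 psi); rewrite ppsiz !chiK => E.
have tpi0 := two_pi_gt0 R.
have {}E : (k : int) = (k' : int) + m * (N : int).
  apply: (@intr_inj R); rewrite intrD intrM /=.
  by apply: (mulIf (lt0r_neq0 tpi0)); move: E; rewrite -!pmulrn; lra.
apply/val_inj => /=.
have := ltn_ord k; have := ltn_ord k'; move: (nat_of_ord k) (nat_of_ord k') E => x y E hy hx.
have m0 : m = 0 by nia.
by move: E; rewrite m0 mul0r addr0 => -[].
Qed.

(** If b(e^{it}) = e^{is}, then psi t = s + 2 pi n. Dividing n by N, and moving t back by the
    quotient number of turns, leaves psi t = s + 2 pi k with k the remainder. *)
Lemma fiber_point_image s : [set w : R[i] | cabs w = 1 /\ b w = cis s] = fiber_point s @` setT.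
Proof.
apply/seteqP; split => w /=; last first.
  move=> [k _ <-]; rewrite /fiber_point cabs_cis bcis chiK; split=> //.
  exact: cis_periodn.
move=> [/cis_surj[t _ <-]]; rewrite bcis => /cis_inj[n nE].
have Nz : (N : int) != 0 by rewrite eqz_nat -lt0n.
have m0 := modz_ge0 n Nz.
have mN : (n %% N)%Z < N by rewrite ltz_pmod// ltz_nat.
have mN' : (`|(n %% N)%Z| < N)%N by rewrite -ltz_nat gez0_abs.
exists (Ordinal mN') => //=.
rewrite /fiber_point /=.
have -> : s + (`|(n %% N)%Z|%:R : R) * tpi = psi (t + (- (n %/ N)%Z)%:~R * tpi).
  rewrite ppsiz nE -addrA; congr (_ + _); rewrite mulrA -mulrDl; congr (_ * _).
  have -> : (`|(n %% N)%Z|%:R : R) = ((n %% N)%Z)%:~R by rewrite -[in RHS](gez0_abs m0).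
  have -> : (n%:~R : R) = (n %/ N)%Z%:~R * N%:R + (n %% N)%Z%:~R.
    by rewrite {1}(divz_eq n N) intrD intrM.
  by rewrite mulrNz; ring.
by rewrite psiK cis_periodz.
Qed.

Lemma transfer_cis (v : R[i] -> R) s :
  transfer alpha v (cis s) = N%:R^-1 * \sum_(k < N) v (fiber_point s k).
Proof.
rewrite /transfer; congr (_ * _).
rewrite [X in \sum_(w \in X) _](_ : _ = [set` [seq fiber_point s k | k <- enum 'I_N]]); last first.
  rewrite fiber_point_image; apply/seteqP; split => w /=.
    by move=> [k _ <-]; apply: map_f; rewrite mem_enum.
  by move=> /mapP[k _ ->]; exists k.
rewrite -fsbig_seq; last by rewrite map_inj_uniq ?enum_uniq//; exact: fiber_point_inj.
by rewrite big_map big_enum.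
Qed.

Let itv_split (a c e : R) : a <= c -> c <= e ->
  [set` `[a, e[%R] = [set` `[a, c[%R] `|` [set` `[c, e[%R].
Proof.
move=> ac ce; apply/seteqP; split => t /=; rewrite !in_itv /=.
  by move=> /andP[at_ te]; case: (ltP t c) => tc; [left|right]; rewrite ?at_ ?te.
move=> [/andP[at_ tc]|/andP[ct te]]; first by rewrite at_ (lt_le_trans tc).
by rewrite te (le_trans ac).
Qed.

Let ge0_integral_split (a c e : R) (f : R -> \bar R) : a <= c -> c <= e ->
  measurable_fun setT f -> (forall t, 0 <= f t)%E ->
  (\int[lam]_(t in `[a, e[) f t = \int[lam]_(t in `[a, c[) f t + \int[lam]_(t in `[c, e[) f t)%E.
Proof.
move=> ac ce mf f0; rewrite (itv_split ac ce) ge0_integral_setU//.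
  exact: measurable_funTS.
rewrite disj_set2E; apply/eqP/seteqP; split => // t /=; rewrite !in_itv /=.
by move=> [/andP[_ tc] /andP[ct _]]; have := lt_le_trans tc ct; rewrite ltxx.
Qed.

Let ge0_integral_shift (a e c : R) (f : R -> \bar R) :
  measurable_fun setT f -> (forall t, 0 <= f t)%E ->
  (\int[lam]_(t in `[(a + c)%R, (e + c)%R[) f t = \int[lam]_(t in `[a, e[) f (t + c)%R)%E.
Proof.
move=> mf f0; rewrite (ge0_integral_translation c)//; last exact: measurable_funTS.
congr (integral _ _ _); apply/seteqP; split => t /=; rewrite !in_itv /=.
  by rewrite lerD2r ltrD2r.
by rewrite lerD2r ltrD2r.
Qed.

(** Periodicity reduces a to some c in [0, 2 pi[. Then [c, c + 2 pi[ splits at 2 pi, and translating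
    its upper piece to [0, c[ reassembles [0, 2 pi[. *)
Lemma circint_rotate (k : R[i] -> R) (a : R) : cmeasr k -> (forall z, 0 <= k z) ->
  (\int[lam]_(s in `[a, (a + tpi)%R[) (k (cis s))%:E = circint k)%E.
Proof.
move=> mk k0; have tpi0 := two_pi_gt0 R.
pose f s := (k (cis s))%:E.
have mf : measurable_fun setT f by exact/measurable_EFinP.
have f0 t : (0 <= f t)%E by rewrite lee_fin.
have fp t (n : int) : f (t + n%:~R * tpi) = f t by rewrite /f cis_periodz.
have /andP[a0 a1] := angle_mod_itv a.
have aE : a = angle_mod a + (Num.floor (a / tpi))%:~R * tpi by rewrite /angle_mod subrK.
change (\int[lam]_(s in `[a, (a + tpi)%R[) f s = circint k)%E.
pose n := Num.floor (a / tpi).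
have -> : [set` `[a, (a + tpi)%R[%R] =
    [set` `[(angle_mod a + n%:~R * tpi)%R, (angle_mod a + tpi + n%:~R * tpi)%R[%R].
  by rewrite -/n in aE; rewrite (addrAC (angle_mod a)) -aE.
rewrite ge0_integral_shift//.
under eq_integral do rewrite fp.
move: (angle_mod a) a0 a1 => c a0 a1.
rewrite (@ge0_integral_split c tpi (c + tpi))//; last by rewrite lerDr.
  rewrite -{2}[tpi]add0r ge0_integral_shift//.
  under [X in (_ + X)%E]eq_integral do rewrite -[tpi]mul1r (fp _ 1).
  rewrite addeC -(@ge0_integral_split 0 c tpi)//; last exact: ltW.
  change (\int[lam]_(t in `[0%R, tpi[) f t = \int[lam]_(t in `[0%R, tpi]) f t)%E.
  rewrite integral_itv_bndo_bndc//.
  by apply: measurable_funTS.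
exact: ltW.
Qed.

Let ge0_integral_periods (c : R) n (f : R -> \bar R) : measurable_fun setT f ->
  (forall t, 0 <= f t)%E ->
  (\int[lam]_(t in `[c, (c + n%:R * tpi)%R[) f t =
   \sum_(k < n) \int[lam]_(t in `[c, (c + tpi)%R[) f (t + k%:R * tpi)%R)%E.
Proof.
move=> mf f0; have tpi0 := two_pi_gt0 R.
elim: n => [|n ih].
  by rewrite mul0r addr0 big_ord0 set_itvco0 integral_set0.
rewrite (@ge0_integral_split c (c + n%:R * tpi))//.
- rewrite ih big_ord_recr /=; congr (_ + _)%E.
  by rewrite mulSr_nat addrA addrAC ge0_integral_shift.
- by rewrite lerDl mulr_ge0// ltW.
- by rewrite lerD2l ler_wpM2r ?ler_nat// ltW.
Qed.

Lemma transfer_ge0 (v : R[i] -> R) z : (forall z, 0 <= v z) -> 0 <= transfer alpha v z.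
Proof. by move=> v0; rewrite mulr_ge0 ?invr_ge0 ?(ltW NR0)// fsumr_ge0. Qed.

Lemma cmeasr_transfer (v : R[i] -> R) : cmeasr v -> cmeasr (transfer alpha v).
Proof.
move=> mv; rewrite /cmeasr; under eq_fun do rewrite transfer_cis.
apply: measurable_funM => //; apply: measurable_sum => k.
rewrite /fiber_point; apply: (measurableT_comp mv).
by apply: (measurableT_comp measurable_chi); exact: measurable_funD.
Qed.

Lemma circint_transfer (u v : R[i] -> R) : cmeasr u -> cmeasr v ->
  (forall z, 0 <= u z) -> (forall z, 0 <= v z) ->
  circint (fun z => u (b z) * v z * Re (J0 alpha z)) =
  circint (fun z => u z * transfer alpha v z).
Proof.
move=> mu_ mv u0 v0; have tpi0 := two_pi_gt0 R.
pose K s := u (cis s) * v (cis (chi s)).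
have mK : measurable_fun setT K.
  apply: measurable_funM => //; exact: measurableT_comp mv measurable_chi.
have mKE : measurable_fun setT (EFin \o K) by exact/measurable_EFinP.
have K0 t : (0 <= (EFin \o K) t)%E by rewrite lee_fin mulr_ge0.
have md : measurable_fun setT jac by apply: continuous_measurable_fun; exact: continuous_jac.
have mub := cmeasr_blaschke mu_.
have cd : continuous (fun t => N%:R * jac t).
  by move=> t; apply: cvgM; [exact: cvg_cst|exact: continuous_jac].
have d0 t : 0 <= N%:R * jac t by rewrite mulr_ge0 ?ltW// jac_gt0.
(* Starting the period at psi 0 makes its preimage under psi exactly [0, 2 pi[. The N pieces of the
   other computation are then based at psi 0, whence [circint_rotate]. *)
have L : (\int[lam]_(s in `[psi 0, (psi 0%R + N%:R * tpi)%R[) (K s)%:E =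
    N%:R%:E * circint (fun z => (u (b z) * v z * Re (J0 alpha z))%R))%E.
  rewrite (ge0_integral_substitution chiK cd d0 psi_incr dpsi)//; last 2 first.
  - exact: measurable_funTS.
  - by move=> y _; exact: K0.
  have -> : psi @^-1` [set` `[psi 0, (psi 0 + N%:R * tpi)[%R] = `[0, tpi[%classic.
    have e : psi tpi = psi 0 + N%:R * tpi by rewrite -[in LHS](add0r tpi) ppsi.
    apply/seteqP; split => t /=; rewrite !in_itv /= -e psi_mono.
      by rewrite !(leNgt _ (psi _)) leNgt psi_mono.
    by rewrite leNgt (leNgt (psi _)) psi_mono.
  rewrite integral_itv_bndo_bndc; last first.
    apply: measurable_funTS; apply: emeasurable_funM; apply/measurable_EFinP.
      exact: measurableT_comp mK measurable_lift.
    exact: measurable_funM.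
  rewrite /circint -ge0_integralZl_EFin ?ltW//; last 3 first.
  - exact: measurable_Dom.
  - by move=> t _; rewrite J0_cis//= lee_fin; apply: mulr_ge0; [exact: mulr_ge0|rewrite ltW// jac_gt0].
  - apply/measurable_EFinP; apply: measurable_funTS.
    under eq_fun do rewrite J0_cis//=.
    by apply: measurable_funM => //; exact: measurable_funM.
  apply: eq_integral => t _; rewrite J0_cis//= -!EFinM; congr _%:E.
  by rewrite /K psiK bcis; ring.
have {}L : (N%:R%:E * circint (fun z => (u (b z) * v z * Re (J0 alpha z))%R) =
    N%:R%:E * circint (fun z => u z * transfer alpha v z)%R)%E.
  rewrite -L (ge0_integral_periods _ _ mKE K0) -ge0_integral_sum//.
    rewrite -(@circint_rotate _ (psi 0)); last 2 first.
    - by apply: cmeasrM => //; exact: cmeasr_transfer.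
    - by move=> z; rewrite mulr_ge0// transfer_ge0.
    rewrite -ge0_integralZl_EFin ?ltW//; last 2 first.
    - by move=> t _; rewrite lee_fin mulr_ge0// transfer_ge0.
    - apply/measurable_EFinP; apply: measurable_funTS.
      by apply: measurable_funM => //; exact: cmeasr_transfer.
    apply: eq_integral => s _; rewrite sumEFin -EFinM; congr _%:E.
    rewrite transfer_cis mulrCA mulVKf ?gt_eqF// mulr_sumr; apply: eq_bigr => k _.
    by rewrite /K cis_periodn.
  move=> k; apply: measurable_funTS; apply: (measurableT_comp mKE).
  exact: measurable_funD.
have := congr1 (fun x => (N%:R^-1%:E * x)%E) L.
by rewrite !muleA -!EFinM mulVf ?gt_eqF// !mul1e.
Qed.

End WithLift.
End BlaschkeLift.

(** * Trigonometric approximation *)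

Section DiscreteKernel.
Variable R : realType.
Local Notation Re := complex.Re.
Local Notation C := R[i].
Implicit Types z w : C.

Definition unit_root (m : nat) : C := cis (pi *+ 2 / m%:R).

Lemma cabs_unit_root m : cabs (unit_root m) = 1. Proof. exact: cabs_cis. Qed.

Lemma unit_root_expn m : (0 < m)%N -> unit_root m ^+ m = 1.
Proof.
by move=> m0; rewrite /unit_root cisX mulrC divfK ?cis2pi// pnatr_eq0 -lt0n.
Qed.

Lemma unit_root_inj m i k : (i < m)%N -> (k < m)%N ->
  unit_root m ^+ i = unit_root m ^+ k -> i = k.
Proof.
move=> im km; have m0 : (0 < m)%N by exact: leq_ltn_trans im.
have mR0 : 0 < (m%:R : R) by rewrite ltr0n.
have tpi0 := two_pi_gt0 R.
rewrite !cisX => /cis_inj_itv E.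
have h (j : nat) : (j < m)%N -> 0 <= j%:R * ((pi : R) *+ 2 / m%:R) < (pi : R) *+ 2.
  move=> jm; apply/andP; split; first exact: (mulr_ge0 (ler0n _ _) (divr_ge0 (ltW tpi0) (ltW mR0))).
  by rewrite mulrCA gtr_pMr// ltr_pdivrMr// mul1r ltr_nat.
have := E (h _ im) (h _ km).
move=> /(mulIf _) e; apply/eqP; rewrite -(eqr_nat R); apply/eqP; apply: e.
by rewrite lt0r_neq0// divr_gt0.
Qed.

Lemma sum_expr_root (q : C) m : q ^+ m = 1 -> q != 1 -> \sum_(j < m) q ^+ j = 0.
Proof.
move=> qm q1; have := subrX1 q m; rewrite qm subrr => /esym/eqP.
by rewrite mulf_eq0 subr_eq0 (negbTE q1) => /eqP.
Qed.

(** On the circle this is |1 + z|^2, so its n-th power is z^-n (1 + z)^(2n), with constant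
    coefficient 'C(2n, n). *)
Definition cos_kernel z : R := 2 + 2 * Re z.

Lemma cos_kernelE z : cabs z = 1 -> Complex (cos_kernel z) 0 = z^-1 * (1 + z) ^+ 2.
Proof.
move=> z1; have z0 : z != 0 by rewrite -cabs_eq0 z1 oner_eq0.
have : z * conjc z = 1 by rewrite mul_conjc z1 expr1n.
rewrite invc_unit// sqrrD expr1n mul1r => zz.
have -> : conjc z * (1 + z *+ 2 + z ^+ 2) = conjc z + (z * conjc z) *+ 2 + z * (z * conjc z) by ring.
by rewrite zz mulr1; apply: complexP; rewrite !ReImE /cos_kernel /=; ring.
Qed.

Lemma cos_kernel_ge0 z : cabs z = 1 -> 0 <= cos_kernel z.
Proof.
move=> z1; have := normRe_le_cabs z; rewrite z1 ler_norml /cos_kernel => /andP[h _].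
by lra.
Qed.

Lemma cos_kernelXE0 z n : cabs z = 1 ->
  Complex (cos_kernel z ^+ n) 0 = (z^-1 * (1 + z) ^+ 2) ^+ n.
Proof.
move=> z1; rewrite -cos_kernelE//.
by rewrite -[Complex (cos_kernel z ^+ n) 0]/((cos_kernel z ^+ n)%:C%C) rmorphXn.
Qed.

Lemma cos_kernelXE z n : cabs z = 1 ->
  Complex (cos_kernel z ^+ n) 0 = z ^- n * \sum_(k < (2 * n).+1) z ^+ k *+ 'C(2 * n, k).
Proof.
move=> z1; rewrite cos_kernelXE0// exprMn -exprVn; congr (_ * _).
rewrite -exprM exprDn; apply: eq_bigr => k _.
by rewrite expr1n mul1r.
Qed.

(** The exponents in z^-n (1 + z)^(2n) are the k - n with k <= 2n. Summation over the m-th roots of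
    unity kills every exponent not divisible by m, and since k, n < m only k = n survives. *)
Lemma sum_cos_kernelX z n m : cabs z = 1 -> (2 * n < m)%N ->
  \sum_(j < m) cos_kernel (z * unit_root m ^+ j) ^+ n = (m * 'C(2 * n, n))%:R.
Proof.
move=> z1 nm; have m0 : (0 < m)%N by exact: leq_ltn_trans nm.
set q := unit_root m.
have q1 : cabs q = 1 by exact: cabs_cis.
have q0 : q != 0 by exact: cis_neq0.
have z0 : z != 0 by rewrite -cabs_eq0 z1 oner_eq0.
have w1 j : cabs (z * q ^+ j) = 1 by rewrite cabsM cabsX z1 q1 expr1n mulr1.
have E : \sum_(j < m) Complex (cos_kernel (z * q ^+ j) ^+ n) 0 = (m * 'C(2 * n, n))%:R.
  under eq_bigr do rewrite cos_kernelXE// mulr_sumr.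
  rewrite exchange_big /=.
  have nk : (n < (2 * n).+1)%N by rewrite ltnS mul2n -addnn leq_addl.
  rewrite (bigD1 (Ordinal nk))//= [X in _ + X]big1 ?addr0.
    under eq_bigr do rewrite mulrnAr mulVf ?expf_neq0 ?mulf_neq0 ?expf_neq0//.
    by rewrite sumr_const card_ord -mulrnA mulnC.
  move=> k /eqP kn.
  have -> : \sum_(j < m) (z * q ^+ j) ^- n * ((z * q ^+ j) ^+ k *+ 'C(2 * n, k)) =
    (z ^- n * z ^+ k *+ 'C(2 * n, k)) * \sum_(j < m) (q ^- n * q ^+ k) ^+ j.
    rewrite mulr_sumr; apply: eq_bigr => j _.
    have e i : (q ^+ j) ^+ i = (q ^+ i) ^+ j by rewrite -!exprM mulnC.
    rewrite !mulrnAr !mulrnAl; congr (_ *+ _).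
    by rewrite !exprMn invfM !e exprVn; ring.
  rewrite sum_expr_root ?mulr0//.
    have e i : (q ^+ i) ^+ m = 1 by rewrite -exprM mulnC exprM unit_root_expn ?expr1n.
    by rewrite exprMn exprVn !e invr1 mulr1.
  apply/eqP => /(congr1 (fun x => q ^+ n * x)); rewrite mulr1 mulVKf ?expf_neq0//.
  move=> /unit_root_inj e; apply: kn; apply/val_inj => /=; apply: e.
    exact: leq_trans (ltn_ord k) nm.
  exact: leq_trans nk nm.
have := congr1 (@complex.Re R) E; rewrite CRe_sum /= => ->.
have -> : ((m * 'C(2 * n, n))%:R : C) = (m * 'C(2 * n, n))%:R%:C%C by rewrite rmorph_nat.
by [].
Qed.

Lemma central_binS n : (n.+1 * 'C(2 * n.+1, n.+1) = 2 * ((2 * n).+1 * 'C(2 * n, n)))%N.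
Proof.
have -> : (2 * n.+1 = (2 * n).+2)%N by rewrite mulnS.
have e1 := mul_bin_diag (2 * n).+2 n; have e2 := mul_bin_diag (2 * n).+1 n.
have e3 : 'C((2 * n).+1, n) = 'C((2 * n).+1, n.+1).
  by rewrite -bin_sub; [congr ('C(_, _)); lia|lia].
move: e1 e2; rewrite /= e3 => e1 e2; rewrite -e1 e2.
by lia.
Qed.

(** Since 1 - Re w = 2 - [cos_kernel w] / 2, the moment is a difference of two masses, of orders n
    and n + 1; the recurrence for central binomials then shows that the kernel gives 1 - cos the
    mean 1 / (n + 1). The sharper condition on m serves the order n + 1. *)
Lemma sum_cos_kernel_moment z n m : cabs z = 1 -> (2 * n.+1 < m)%N ->
  n.+1%:R * (\sum_(j < m) cos_kernel (z * unit_root m ^+ j) ^+ n * (1 - Re (z * unit_root m ^+ j))) =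
  (m * 'C(2 * n, n))%:R.
Proof.
move=> z1 nm; have nm' : (2 * n < m)%N by lia.
have -> : \sum_(j < m) cos_kernel (z * unit_root m ^+ j) ^+ n * (1 - Re (z * unit_root m ^+ j)) =
    2 * (m * 'C(2 * n, n))%:R - (m * 'C(2 * n.+1, n.+1))%:R / 2.
  rewrite -(sum_cos_kernelX z1 nm) -(sum_cos_kernelX z1 nm') mulr_sumr mulr_suml -sumrB.
  by apply: eq_bigr => j _; rewrite exprS /cos_kernel; field.
have e : n.+1%:R * 'C(2 * n.+1, n.+1)%:R = 2 * ((2 * n).+1%:R * 'C(2 * n, n)%:R) :> R.
  by rewrite -!natrM central_binS !natrM.
have e1 : (2 * n).+1%:R = 2 * n%:R + 1 :> R by rewrite -natr1 natrM.
have e2 : n.+1%:R = n%:R + 1 :> R by rewrite natr1.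
rewrite !natrM; move: e; rewrite e1 e2.
move: (n%:R : R) (m%:R : R) ('C(2 * n, n)%:R : R) ('C(2 * n.+1, n.+1)%:R : R) => k l A B e.
have -> : (k + 1) * (2 * (l * A) - l * B / 2) = 2 * (k + 1) * (l * A) - l * ((k + 1) * B) / 2.
  by field.
by rewrite e; field.
Qed.

(* A discrete convolution with powers of the kernel 2 + 2 cos, whose mass
   concentrates at 0; sampling at m > 2 n roots of unity makes the constant and
   first moments exact, so that no integral of h is needed. *)
Definition trig_approx (h : C -> R) (n m : nat) (z : C) : R :=
  (m * 'C(2 * n, n))%:R^-1 *
  \sum_(j < m) h (conjc (unit_root m ^+ j)) * cos_kernel (z * unit_root m ^+ j) ^+ n.

Lemma trig_approx_le (h : C -> R) M n m z : cabs z = 1 -> (2 * n < m)%N ->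
  (forall w, cabs w = 1 -> `|h w| <= M) -> `|trig_approx h n m z| <= M.
Proof.
move=> z1 nm hM; have c0 : 0 < ((m * 'C(2 * n, n))%:R : R).
  by rewrite ltr0n muln_gt0 bin_gt0; lia.
rewrite normrM gtr0_norm ?invr_gt0// mulrC ler_pdivrMr// -(sum_cos_kernelX z1 nm) mulr_sumr.
apply: le_trans (ler_norm_sum _ _ _) _; apply: ler_sum => j _.
have w1 : cabs (z * unit_root m ^+ j) = 1 by rewrite cabsM cabsX z1 cabs_unit_root expr1n mulr1.
rewrite normrM [X in _ * X]ger0_norm ?exprn_ge0 ?cos_kernel_ge0//.
by rewrite ler_wpM2r ?exprn_ge0 ?cos_kernel_ge0// hM// cabs_conj cabsX cabs_unit_root expr1n.
Qed.

(** The modulus of continuity is expressed through 1 - Re precisely so that it can be averaged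
    against the kernel, where 1 - Re has mean 1 / (n + 1). *)
Lemma trig_approx_close (h : C -> R) e K n m z : cabs z = 1 -> (2 * n.+1 < m)%N ->
  (forall w w', cabs w = 1 -> cabs w' = 1 -> `|h w - h w'| <= e + K * (1 - Re (w' * conjc w))) ->
  `|trig_approx h n m z - h z| <= e + K / n.+1%:R.
Proof.
move=> z1 nm hh; have nm' : (2 * n < m)%N by lia.
have c0 : 0 < ((m * 'C(2 * n, n))%:R : R).
  by rewrite ltr0n muln_gt0 bin_gt0; lia.
have w1 j : cabs (z * unit_root m ^+ j) = 1 by rewrite cabsM cabsX z1 cabs_unit_root expr1n mulr1.
have -> : trig_approx h n m z - h z = (m * 'C(2 * n, n))%:R^-1 *
    \sum_(j < m) (h (conjc (unit_root m ^+ j)) - h z) * cos_kernel (z * unit_root m ^+ j) ^+ n.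
  under [in RHS]eq_bigr do rewrite mulrBl.
  rewrite sumrB mulrBr -mulr_sumr (sum_cos_kernelX z1 nm') mulrCA mulVf ?mulr1//.
  exact: lt0r_neq0.
rewrite normrM gtr0_norm ?invr_gt0// mulrC ler_pdivrMr//.
have -> : (e + K / n.+1%:R) * (m * 'C(2 * n, n))%:R =
    \sum_(j < m) (e + K * (1 - Re (z * unit_root m ^+ j))) * cos_kernel (z * unit_root m ^+ j) ^+ n.
  under eq_bigr do rewrite mulrDl -mulrA [X in _ + _ * X]mulrC.
  rewrite big_split /= -!mulr_sumr (sum_cos_kernelX z1 nm') mulrDl; congr (_ + _).
  by rewrite -(sum_cos_kernel_moment z1 nm) -mulrA mulKf.
apply: le_trans (ler_norm_sum _ _ _) _; apply: ler_sum => j _.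
rewrite normrM [X in _ * X]ger0_norm ?exprn_ge0 ?cos_kernel_ge0//.
rewrite ler_wpM2r ?exprn_ge0 ?cos_kernel_ge0//.
have := hh (conjc (unit_root m ^+ j)) z; rewrite conjcK; apply => //.
by rewrite cabs_conj cabsX cabs_unit_root expr1n.
Qed.

(** Laurent polynomials, written so that the analytic polynomial P has the same modulus as f on the
    circle. *)
Definition trig_poly (f : C -> C) := exists (n : nat) (P : {poly C}),
  forall z, cabs z = 1 -> f z = z ^- n * P.[z].

Lemma trig_approx_poly (h : C -> R) n m : trig_poly (fun z => Complex (trig_approx h n m z) 0).
Proof.
pose P : {poly C} := ((m * 'C(2 * n, n))%:R^-1 : R)%:C%C%:P *
  \sum_(j < m) ((h (conjc (unit_root m ^+ j)))%:C%C / (unit_root m ^+ j) ^+ n)%:P *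
    (1 + (unit_root m ^+ j)%:P * 'X) ^+ (2 * n).
exists n, P => z z1; rewrite /P hornerM hornerC horner_sum mulrCA.
rewrite -[LHS]/((trig_approx h n m z)%:C%C) /trig_approx rmorphM; congr (_ * _).
rewrite rmorph_sum mulr_sumr; apply: eq_bigr => j _.
have w1 : cabs (z * unit_root m ^+ j) = 1 by rewrite cabsM cabsX z1 cabs_unit_root expr1n mulr1.
transitivity ((h (conjc (unit_root m ^+ j)))%:C%C * Complex (cos_kernel (z * unit_root m ^+ j) ^+ n) 0).
  by apply: complexP => /=; rewrite ?mulr0 ?mul0r ?subr0 ?addr0.
rewrite cos_kernelXE0// hornerM hornerC horner_exp hornerD hornerM !hornerC hornerX.
move: (unit_root m ^+ j) => w.
by rewrite (exprMn _ (z * w)^-1) -exprM exprVn (exprMn _ z) invfM [z * w]mulrC; ring.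
Qed.

End DiscreteKernel.

(** * Modulus of continuity of a periodic function *)

Section PeriodicModulus.
Variable R : realType.
Local Notation tpi := ((pi : R) *+ 2).

Lemma cos_eq1_itv (x : R) : - tpi <= x <= tpi -> cos x = 1 -> x = 0 \/ x = tpi \/ x = - tpi.
Proof.
move=> /andP[x1 x2] c1.
have [x0|x0] := leP 0 x.
  have [->|xn] := eqVneq x tpi; first by right; left.
  left; apply: cos1_eq0 => //; rewrite x0 /= lt_neqAle xn x2//.
have [->|xn] := eqVneq x (- tpi); first by right; right.
left; apply: oppr_inj; rewrite oppr0; apply: cos1_eq0; last by rewrite cosN.
by rewrite oppr_ge0 ltW//= ltrNl lt_neqAle eq_sym xn x1.
Qed.

(** 1 - cos (t - s) vanishes only if s and t give the same point of the circle. If every K = k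
    failed at some pair (s_k, t_k), a subsequence of pairs would converge; boundedness of G forces
    cos (t - s) = 1 in the limit, hence equal values of G there, although the gap stays at least
    e. *)
Lemma periodic_modulus (G : R -> R) (M e : R) : continuous G -> G 0 = G tpi ->
  (forall t, `|G t| <= M) -> 0 < e ->
  exists2 K : R, 0 <= K & forall s t, 0 <= s <= tpi -> 0 <= t <= tpi ->
    `|G s - G t| <= e + K * (1 - cos (t - s)).
Proof.
move=> cG G0 GM e0; apply: contrapT => noK.
have /choice[st stP] : forall k : nat, exists st : R * R,
    [/\ 0 <= st.1 <= tpi, 0 <= st.2 <= tpi &
        e + k%:R * (1 - cos (st.2 - st.1)) < `|G st.1 - G st.2|].
  move=> k; apply: contrapT => no; apply: noK; exists k%:R => // s t sI tI.
  by rewrite leNgt; apply/negP => lt; apply: no; exists (s, t).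
have bnd (u : nat -> R) : (forall k, 0 <= u k <= tpi) -> bounded_fun u.
  move=> uI; exists tpi; split; first exact: num_real.
  move=> x tx k _ /=; have /andP[u0 u1] := uI k.
  by rewrite ger0_norm// (le_trans u1)// ltW.
have [f fi cf] : exists2 f : nat -> nat, increasing_seq f & cvgn ((fun k => (st k).1) \o f).
  by apply: bolzano_weierstrass; apply: bnd => k; have [] := stP k.
have [g gi cg] : exists2 g : nat -> nat, increasing_seq g & cvgn ((fun k => (st (f k)).2) \o g).
  by apply: bolzano_weierstrass; apply: bnd => k; have [] := stP (f k).
pose s k := (st (f (g k))).1; pose t k := (st (f (g k))).2.
have incr_ge (h : nat -> nat) : increasing_seq h -> forall k, (k <= h k)%N.
  move=> hi; elim=> // k ih; apply: leq_ltn_trans ih _.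
  by have := leqW_mono hi k k.+1; rewrite ltnSn.
have fgk k : (k <= f (g k))%N := leq_trans (incr_ge _ gi k) (incr_ge _ fi _).
have /cvg_ex[/= sl sL] : cvgn s.
  apply/cvg_ex; move/cvg_ex: cf => [l fl]; exists l.
  apply: (cvg_comp g _ _ fl); apply/cvgnyPge => n.
  by near=> k; apply: leq_trans (incr_ge _ gi k); near: k; exact: nbhs_infty_ge.
have /cvg_ex[/= tl tL] : cvgn t by [].
have inI (u : nat -> R) (l : R) : u @ \oo --> l -> (forall k, 0 <= u k <= tpi) -> 0 <= l <= tpi.
  move=> ul uI; apply/andP; split.
    by apply: (cvgr_to_ge ul); near=> k; have /andP[] := uI k.
  by apply: (cvgr_to_le ul); near=> k; have /andP[] := uI k.
have sI : 0 <= sl <= tpi by apply: (inI _ _ sL) => k; have [] := stP (f (g k)).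
have tI : 0 <= tl <= tpi by apply: (inI _ _ tL) => k; have [] := stP (f (g k)).
have dL : (t k - s k) @[k --> \oo] --> tl - sl by exact: cvgB.
have cL : cos (t k - s k) @[k --> \oo] --> cos (tl - sl).
  by apply: (cvg_comp _ _ dL); exact: continuous_cos.
have GL : `|G (s k) - G (t k)| @[k --> \oo] --> `|G sl - G tl|.
  by apply: cvg_norm; apply: cvgB; [apply: (cvg_comp _ _ sL)|apply: (cvg_comp _ _ tL)]; exact: cG.
have G2M x y : `|G x - G y| <= 2 * M.
  by apply: le_trans (ler_normB _ _) _; have := GM x; have := GM y; lra.
have c1 : cos (tl - sl) = 1.
  apply/eqP; rewrite eq_le cos_le1 /= leNgt; apply/negP => c1.
  have [n nP] : exists n : nat, 2 * M < n%:R * (1 - cos (tl - sl)).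
    exists (Num.bound (2 * M / (1 - cos (tl - sl)))).
    rewrite -ltr_pdivrMr ?subr_gt0//; apply: archi_boundP.
    have M0 : 0 <= 2 * M := le_trans (normr_ge0 _) (G2M 0 0).
    by rewrite divr_ge0// subr_ge0 ltW.
  move: nP; apply/negP; rewrite -leNgt.
  have nL : n%:R * (1 - cos (t k - s k)) @[k --> \oo] --> n%:R * (1 - cos (tl - sl)).
    by apply: cvgM; [exact: cvg_cst|apply: cvgB; [exact: cvg_cst|]].
  apply: (cvgr_to_le nL); near=> k.
  have [_ _ lt] := stP (f (g k)).
  apply: le_trans (G2M (s k) (t k)); apply: le_trans (ltW lt).
  apply: (@le_trans _ _ ((f (g k))%:R * (1 - cos (t k - s k)))).
    rewrite ler_wpM2r ?subr_ge0 ?cos_le1// ler_nat; apply: leq_trans (fgk k).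
    by near: k; exact: nbhs_infty_ge.
  by rewrite -/(s k) -/(t k) lerDr ltW.
have GE : G sl = G tl.
  have dI : - tpi <= tl - sl <= tpi by move: sI tI => /andP[? ?] /andP[? ?]; lra.
  have [d|[d|d]] := cos_eq1_itv dI c1.
  - by congr G; lra.
  - have [-> ->] : sl = 0 /\ tl = tpi by move: sI tI => /andP[? ?] /andP[? ?]; split; lra.
    by [].
  - have [-> ->] : sl = tpi /\ tl = 0 by move: sI tI => /andP[? ?] /andP[? ?]; split; lra.
    by [].
have : e <= `|G sl - G tl|.
  apply: (cvgr_to_ge GL); near=> k.
  have [_ _ lt] := stP (f (g k)).
  by apply: le_trans (ltW lt); rewrite lerDl mulr_ge0// subr_ge0 cos_le1.
by rewrite GE subrr normr0 leNgt e0.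
Unshelve. all: end_near.
Qed.

End PeriodicModulus.

(** * L^1 approximation by bounded trigonometric polynomials *)

Section TrigonometricDensity.
Variable R : realType.
Local Notation Re := complex.Re.
Local Notation C := R[i].
Local Notation lam := (@lebesgue_measure R).
Local Notation D := (@Dom R).
Local Notation tpi := ((pi : R) *+ 2).
Implicit Types (F G : C -> C).

Lemma trig_polyZ c F : trig_poly F -> trig_poly (fun z => c * F z).
Proof.
by move=> [n [P FP]]; exists n, (c *: P) => z z1; rewrite FP// hornerZ mulrCA.
Qed.

Lemma trig_polyD F G : trig_poly F -> trig_poly G -> trig_poly (fun z => F z + G z).
Proof.
move=> [n [P FP]] [m [Q GQ]]; exists (n + m)%N, ('X^m * P + 'X^n * Q) => z z1.
have z0 : z != 0 by rewrite -cabs_eq0 z1 oner_eq0.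
rewrite FP// GQ// hornerD !hornerM !hornerXn exprD.
by field; rewrite ?expf_neq0.
Qed.

Lemma cmeas_trig_poly F : trig_poly F -> cmeas F.
Proof.
move=> [n [P FP]]; apply: (@cmeas_ext _ (fun z => conjc z ^+ n * P.[z])) => [t|].
  by rewrite FP ?cabs_cis// -exprVn invc_unit// cabs_cis.
by apply: cmeasM; [apply/cmeasX/cmeas_conj/cmeas_id|exact: cmeas_poly].
Qed.

Lemma Linf_trig_poly F : trig_poly F -> Linf F.
Proof.
move=> FT; have mF := cmeas_trig_poly FT; move: FT => [n [P FP]].
have /LinfP[_ [M M0 PM]] := Linf_poly P.
apply/LinfP; split => //; exists M => //; apply: aecirc_mp PM _ => z z1.
by rewrite FP// cabsM cabsV cabsX z1 expr1n invr1 mul1r.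
Qed.

Definition argc (z : C) : R := xget 0 [set t | 0 <= t < tpi /\ cis t = z].

Lemma argcP z : cabs z = 1 -> 0 <= argc z < tpi /\ cis (argc z) = z.
Proof.
move=> /cis_surj[t tI tE]; rewrite /argc; case: xgetP => [y -> //|/(_ t)].
by case; split.
Qed.

Lemma argc_cis t : 0 <= t < tpi -> argc (cis t) = t.
Proof.
by move=> tI; have [sI sE] := argcP (cabs_cis t); exact: cis_inj_itv.
Qed.

Lemma integral_bump (d : R) : 0 < d ->
  (\int[lam]_(t in D) (Num.max 0 (1 - t / d))%:E <= d%:E)%E.
Proof.
move=> d0.
have mD := @measurable_Dom R.
apply: (@le_trans _ _ (\int[lam]_(t in D) (\1_(`[0, d]%classic : set R) t)%:E)%E).
  apply: ge0_le_integral => //.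
  - by move=> t _; rewrite lee_fin le_max lexx.
  - apply/measurable_EFinP; apply: measurable_funTS.
    apply: measurable_maxr => //; apply: measurable_funB => //.
    exact: measurable_funM.
  - by apply/measurable_EFinP; apply: measurable_funTS; exact: measurable_indic.
  - move=> t; rewrite /Dom /= in_itv /= => /andP[t0 _]; rewrite lee_fin indicE.
    have [td|td] := leP t d.
      rewrite mem_set /=; last by rewrite in_itv /= t0.
      by rewrite ge_max ler01 gerBl divr_ge0// ltW.
    rewrite (_ : Num.max _ _ = 0) ?ler0n//; apply/max_idPl.
    by rewrite subr_le0 ler_pdivlMr// mul1r ltW.
rewrite integral_indic//; apply: le_trans (measureIl _ _ _) _ => //.
  by rewrite /= [X in (X <= _)%E]lebesgue_measure_itv /= lte_fin d0 sube0.
Qed.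

Lemma exists_trig_approx (f : C -> R) (M e : R) : cmeasr f ->
  (forall z, cabs z = 1 -> `|f z| <= M) -> 0 < e ->
  exists p : C -> R, [/\ trig_poly (fun z => Complex (p z) 0),
    forall z, cabs z = 1 -> `|p z| <= M &
    (circint (fun z => `|f z - p z|)%R <= e%:E)%E].
Proof.
move=> mf fM e0.
have mD := @measurable_Dom R.
have M0 : 0 <= M by apply: le_trans (fM 1 _); rewrite ?cabs1.
have Dfin : (lam D < +oo)%E by rewrite [X in (X < _)%E]lebesgue_Dom ltry.
have intf : lam.-integrable D (EFin \o (fun t => f (cis t))).
  apply: measurable_bounded_integrable => //.
  - exact: measurable_funTS.
  - exists M; split; first exact: num_real.
    by move=> x Mx t _ /=; rewrite (le_trans (fM _ (cabs_cis _)))// ltW.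
have [g_ [cg_ ig_ g_0]] := approximation_continuous_integrable mD Dfin intf.
(* The error e is spent as a on a continuous g, a on making it periodic, and 2 a on the uniform
   trigonometric approximation. *)
pose a := e / 4; have a0 : 0 < a by rewrite divr_gt0.
have [g [cg ga]] : exists g : R -> R, continuous g /\
    (\int[lam]_(t in D) `|(f (cis t) - g t)%:E| <= a%:E)%E.
  have aP : (0 < a%:E)%E by rewrite lte_fin.
  move/fine_cvgP: g_0 => [fin0 g_0].
  have aI : \forall n \near \oo, fine (\int[lam]_(t in D) `|(f (cis t) - g_ n t)%:E|)%E < a.
    exact: (cvgr_lt _ g_0 a a0).
  have [n [h1 h2]] : exists n, (\int[lam]_(t in D) `|(f (cis t) - g_ n t)%:E|)%E \is a fin_num /\
      fine (\int[lam]_(t in D) `|(f (cis t) - g_ n t)%:E|)%E < a.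
    by have [n _ h] := filterI fin0 aI; exists n; exact: (h n (leqnn n)).
  by exists (g_ n); split; [exact: cg_|rewrite -(fineK h1) lee_fin ltW].
(* g need not take equal values at 0 and 2 pi. Adding c times a bump that falls from 1 at 0 to 0 at
   d repairs this at an L^1 cost of at most |c| d <= a. Clamping to [-M, M] restores the bound and
   brings no value further from f, since |f| <= M. *)
pose c := g tpi - g 0.
pose d := Num.min (a / (`|c| + 1)) 1; have c1 : 0 < `|c| + 1 by rewrite ltr_wpDl.
have d0 : 0 < d by rewrite lt_min divr_gt0//=.
have dc : `|c| * d <= a.
  have : d <= a / (`|c| + 1) by rewrite ge_min lexx.
  rewrite ler_pdivlMr// => h; apply: le_trans h; rewrite mulrC.
  by rewrite ler_wpM2l ?lerDl// ltW.
pose bump (t : R) : R := Num.max 0 (1 - t / d).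
pose clamp (x : R) := Num.max (- M) (Num.min M x).
pose G t := clamp (g t + bump t * c).
have cmax (u v : R -> R) : continuous u -> continuous v -> continuous (fun t => Num.max (u t) (v t)).
  by move=> cu cv t; apply: (@continuous_max R R u v t); [exact: cu|exact: cv].
have cmin (u v : R -> R) : continuous u -> continuous v -> continuous (fun t => Num.min (u t) (v t)).
  by move=> cu cv t; apply: (@continuous_min R R u v t); [exact: cu|exact: cv].
have ccst (x : R) : continuous (fun _ : R => x) by move=> t; exact: cvg_cst.
have cbump : continuous bump.
  apply: cmax => // t.
  by apply: cvgB; [exact: cvg_cst|apply: cvgM => //; exact: cvg_cst].
have cG : continuous G.
  apply: cmax => //; apply: cmin => // t.
  by apply: cvgD; [exact: cg|apply: cvgM; [exact: cbump|exact: cvg_cst]].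
have clampM x : `|clamp x| <= M.
  by rewrite ler_norml /clamp le_max lexx /= ge_max ge_min lexx /= andbT; lra.
have clampL x y : `|x| <= M -> `|x - clamp y| <= `|x - y|.
  rewrite ler_norml /clamp => /andP[x1 x2].
  have [My|My] := leP M y.
    rewrite (max_idPr _); last by lra.
    by rewrite !ler0_norm; lra.
  have [yM|yM] := leP (- M) y => //.
  by rewrite !ger0_norm; lra.
have tpi0 := two_pi_gt0 R.
have dtpi : d <= tpi.
  have : d <= 1 by rewrite ge_min lexx orbT.
  by have := @pi_ge2 R; lra.
have bump0 : bump 0 = 1 by rewrite /bump mul0r subr0; apply/max_idPr.
have bumptpi : bump tpi = 0.
  by apply/max_idPl; rewrite subr_le0 ler_pdivlMr// mul1r.
have bump_ge0 t : 0 <= bump t by rewrite le_max lexx.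
have GE : G 0 = G tpi by rewrite /G bump0 bumptpi; congr clamp; rewrite /c; ring.
pose e1 := a / tpi; have e10 : 0 < e1 by rewrite divr_gt0.
have [K K0 modK] := periodic_modulus cG GE (fun t => clampM _) e10.
pose h z := G (argc z).
have hM w : cabs w = 1 -> `|h w| <= M by move=> _; exact: clampM.
have hmod w w' : cabs w = 1 -> cabs w' = 1 ->
    `|h w - h w'| <= e1 + K * (1 - Re (w' * conjc w)).
  move=> /argcP[/andP[s0 s1] sE] /argcP[/andP[t0 t1] tE].
  rewrite -{2}tE -{2}sE -cisN -cisD /=; apply: modK; first by rewrite s0 ltW.
  by rewrite t0 ltW.
have [n nP] : exists n : nat, K / n.+1%:R <= e1.
  exists (Num.bound (K / e1)); rewrite ler_pdivrMr// mulrC -ler_pdivrMr//.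
  have := archi_boundP (divr_ge0 K0 (ltW e10)) => /ltW /le_trans; apply.
  by rewrite ler_nat.
(* The least number of sample points for which the first moment of the kernel is exact. *)
pose m := (2 * n.+1).+1.
exists (trig_approx h n m); split.
- exact: trig_approx_poly.
- by move=> z z1; apply: trig_approx_le => //; rewrite /m ltnS leq_mul2l leqnSn orbT.
set p := trig_approx h n m.
have close z : cabs z = 1 -> `|p z - h z| <= 2 * e1.
  move=> z1; apply: le_trans (trig_approx_close z1 _ hmod) _; first by rewrite /m.
  by rewrite mulr_natl mulr2n lerD2l.
have mp : cmeasr p.
  by have /cmeasP[] := cmeas_trig_poly (trig_approx_poly h n m).
have hG t : 0 <= t <= tpi -> h (cis t) = G t.
  move=> /andP[t0]; rewrite le_eqVlt => /predU1P[->|t1]; last first.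
    by rewrite /h argc_cis// t0.
  by rewrite -GE cis2pi -cis0 /h argc_cis// lexx.
have mg := continuous_measurable_fun cg.
have mb := continuous_measurable_fun cbump.
apply: (@le_trans _ _ (\int[lam]_(t in D) (`|(f (cis t) - g t)%:E| +
    (`|c|%:E * (bump t)%:E + (2 * e1)%:E)))%E).
  apply: ge0_le_integral => //.
  - apply: (@cmeasr_EFin _ (fun z => `|f z - p z|)); apply: (cmeasr_comp (f := @Num.norm _ R)) => //.
    exact: cmeasrB.
  - apply: emeasurable_funD.
      apply/measurableT_comp => //; apply/measurable_EFinP; apply: measurable_funB.
        exact: measurable_funTS.
      exact: measurable_funTS.
    under eq_fun do rewrite -EFinM -EFinD.
    apply/measurable_EFinP; apply: measurable_funD => //; apply: measurable_funM => //.
    exact: measurable_funTS.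
  - move=> t; rewrite /Dom /= in_itv /= => tI.
    rewrite -EFinM -!EFinD lee_fin.
    have -> : f (cis t) - p (cis t) = (f (cis t) - G t) + (G t - p (cis t)) by ring.
    apply: le_trans (ler_normD _ _) _; rewrite addrA lerD//; last first.
      by rewrite distrC -hG// close// cabs_cis.
    apply: le_trans (clampL _ _ (fM _ (cabs_cis t))) _.
    have -> : f (cis t) - (g t + bump t * c) = (f (cis t) - g t) - bump t * c by ring.
    apply: le_trans (ler_normB _ _) _.
    by rewrite lerD2l normrM mulrC [X in _ * X]ger0_norm.
have m1 : measurable_fun D (fun t => `|(f (cis t) - g t)%:E|)%E.
  apply/measurableT_comp => //; apply/measurable_EFinP; apply: measurable_funB.
    exact: measurable_funTS.
  exact: measurable_funTS.
have m2 : measurable_fun D (fun t => (`|c|%:E * (bump t)%:E)%E).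
  under eq_fun do rewrite -EFinM.
  by apply/measurable_EFinP; apply: measurable_funM => //; exact: measurable_funTS.
have m3 : measurable_fun D (fun t => (`|c|%:E * (bump t)%:E + (2 * e1)%:E)%E).
  exact: emeasurable_funD.
have p2 t : (0 <= `|c|%:E * (bump t)%:E)%E by rewrite -EFinM lee_fin mulr_ge0.
have p4 : 0 <= 2 * e1 by rewrite mulr_ge0// ltW.
have p3 t : (0 <= `|c|%:E * (bump t)%:E + (2 * e1)%:E)%E.
  by rewrite adde_ge0// lee_fin.
rewrite ge0_integralD// ge0_integralD//.
rewrite ge0_integralZl_EFin//; last 2 first.
- by move=> t _; rewrite lee_fin.
- by apply/measurable_EFinP; exact: measurable_funTS.
rewrite integral_cst//.
apply: (@le_trans _ _ (a%:E + ((a)%:E + (2 * a)%:E))%E).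
  apply: leeD => //; apply: leeD.
    apply: (@le_trans _ _ (`|c|%:E * d%:E)%E); last by rewrite -EFinM lee_fin.
    by apply: lee_wpmul2l; [rewrite lee_fin|exact: integral_bump].
  rewrite [X in (_ * X <= _)%E]lebesgue_Dom -EFinM lee_fin -mulrA divfK//.
  exact: lt0r_neq0.
by rewrite -!EFinD lee_fin /a; lra.
Qed.

End TrigonometricDensity.

(** * Polynomial weights and density *)

Section Density.
Variable R : realType.
Local Notation Re := complex.Re.
Local Notation Im := complex.Im.
Local Notation C := R[i].
Local Notation lam := (@lebesgue_measure R).
Local Notation D := (@Dom R).
Implicit Types (F G : C -> C).

Lemma cmeasr_if (u v w : C -> R) (c : R) : cmeasr u -> cmeasr v -> cmeasr w ->
  cmeasr (fun z => if c < u z then v z else w z).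
Proof.
move=> mu_ mv mw.
have mA : measurable [set t : R | c < u (cis t)].
  have := mu_ measurableT `]c, +oo[%classic (measurable_itv _).
  rewrite setTI; congr measurable; apply/seteqP; split => t /=; rewrite in_itv /= andbT//.
pose i t : R := \1_[set t : R | c < u (cis t)] t.
have mi : measurable_fun setT i by exact: measurable_indic.
rewrite /cmeasr (_ : (fun t => _) = (fun t => i t * v (cis t) + (1 - i t) * w (cis t))).
  apply: measurable_funD; first exact: measurable_funM.
  by apply: measurable_funM => //; exact: measurable_funB.
apply/funext => t; rewrite /i indicE; case: ifPn => h.
  by rewrite mem_set//= mul1r subrr mul0r addr0.
by rewrite memNset//= ?mul0r ?subr0 ?mul1r ?add0r//; exact/negP.
Qed.

Lemma cmeasr_min (u : C -> R) (c : R) : cmeasr u -> cmeasr (fun z => Num.min (u z) c).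
Proof. by move=> mu_; apply: measurable_minr => //; exact: measurable_cst. Qed.

(* Test on trigonometric polynomials close to the indicator f of [g > c]; capping
   g at c + 1 keeps the error terms integrable. *)
Lemma ae_le_poly_weight (g : C -> R) (c : R) : cmeasr g -> (forall z, 0 <= g z) -> 0 <= c ->
  (forall P : {poly C}, circint (fun z => sqmod (fun w => P.[w]) z * g z)%R <=
     c%:E * circint (sqmod (fun w => P.[w])))%E ->
  aecirc (fun z => g z <= c).
Proof.
move=> mg g0 c0 gP.
pose f z : R := if c < g z then 1 else 0.
pose g' z := Num.min (g z) (c + 1).
have mf : cmeasr f by apply: cmeasr_if => //; exact: cmeasr_cst.
have mg' : cmeasr g' by exact: cmeasr_min.
have f0 z : 0 <= f z by rewrite /f; case: ifP.
have f1 z : f z <= 1 by rewrite /f; case: ifP.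
have ff z : f z ^+ 2 = f z by rewrite /f; case: ifP; rewrite ?expr1n ?expr0n.
have g'0 z : 0 <= g' z by rewrite le_min g0 addr_ge0.
have g'c z : g' z <= c + 1 by rewrite ge_min lexx orbT.
have g'g z : g' z <= g z by rewrite ge_min lexx.
(* With p within e of f in L^1 and f, |p| at most 1, p^2 is within 2 e of f^2 = f. The cap c + 1
   turns this into 2 (c + 1) e on the left, and the factor c into 2 c e on the right: together (4 c
   + 2) e. *)
have key e : 0 < e -> (circint (fun z => f z * g' z)%R <=
    c%:E * circint f + ((4 * c + 2) * e)%:E)%E.
  move=> e0.
  have [|p [pT p1 pe]] := @exists_trig_approx _ f 1 e mf _ e0.
    by move=> z _; rewrite ger0_norm.
  have mp : cmeasr p by have /cmeasP[] := cmeas_trig_poly pT.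
  have mfp : cmeasr (fun z => `|f z - p z|).
    by apply: (cmeasr_comp (f := @Num.norm _ R)) => //; exact: cmeasrB.
  have p2 z : cabs z = 1 -> `|f z - p z ^+ 2| <= 2 * `|f z - p z|.
    move=> z1; rewrite -{1}ff subr_sqr normrM mulrC ler_wpM2r//.
    by apply: le_trans (ler_normD _ _) _; have := p1 _ z1; rewrite (ger0_norm (f0 z)); have := f1 z; lra.
  have mp2 : cmeasr (fun z => p z ^+ 2) by exact: cmeasrX.
  have s1 : (circint (fun z => f z * g' z)%R <= circint (fun z => p z ^+ 2 * g' z)%R +
      (2 * (c + 1))%:E * circint (fun z => `|f z - p z|)%R)%E.
    rewrite -circintZ//; last by rewrite mulr_ge0// addr_ge0.
    rewrite -circintD; last 4 first.
    - exact: cmeasrM.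
    - by apply: cmeasrM => //; exact: cmeasr_cst.
    - by move=> z; rewrite mulr_ge0// sqr_ge0.
    - by move=> z; rewrite mulr_ge0// mulr_ge0// addr_ge0.
    apply: le_circint; [exact: cmeasrM| | | |].
    - apply: cmeasrD; first exact: cmeasrM.
      by apply: cmeasrM => //; exact: cmeasr_cst.
    - by move=> z; rewrite mulr_ge0.
    - by move=> z; rewrite addr_ge0// mulr_ge0// ?sqr_ge0// mulr_ge0// addr_ge0.
    move=> z z1; rewrite -lerBlDl -mulrBl.
    apply: le_trans (ler_norm _) _; rewrite normrM [X in _ * X]ger0_norm//.
    rewrite mulrAC; apply: ler_pM => //; exact: p2.
  have s2 : (circint (fun z => p z ^+ 2 * g' z)%R <= c%:E * circint (fun z => p z ^+ 2)%R)%E.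
    have [n [P PE]] := pT.
    have pP z : cabs z = 1 -> sqmod (fun w => P.[w]) z = p z ^+ 2.
      move=> z1; rewrite /sqmod.
      have := congr1 (fun x => cabs x ^+ 2) (PE z z1).
      rewrite cabs_real cabsM cabsV cabsX z1 expr1n invr1 mul1r => <-.
      by rewrite real_normK// num_real.
    apply: (@le_trans _ _ (circint (fun z => p z ^+ 2 * g z)%R)).
      apply: le_circint; [exact: cmeasrM|exact: cmeasrM| | |].
      - by move=> z; rewrite mulr_ge0// sqr_ge0.
      - by move=> z; rewrite mulr_ge0// sqr_ge0.
      - by move=> z _; rewrite ler_wpM2l// sqr_ge0.
    have := gP P; congr (_ <= _ * _)%E; apply: circint_ext => z z1; rewrite pP//.
  have s3 : (circint (fun z => p z ^+ 2)%R <= circint f + 2%:E * circint (fun z => `|f z - p z|)%R)%E.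
    rewrite -circintZ// -circintD//; last by apply: cmeasrM => //; exact: cmeasr_cst.
    apply: le_circint => //.
    - by apply: cmeasrD => //; apply: cmeasrM => //; exact: cmeasr_cst.
    - by move=> z; exact: sqr_ge0.
    - by move=> z; rewrite addr_ge0// mulr_ge0.
    - by move=> z z1; have := p2 z z1; rewrite ler_norml => /andP[]; lra.
  apply: le_trans s1 _.
  apply: (@le_trans _ _ (c%:E * (circint f + 2%:E * e%:E) + (2 * (c + 1))%:E * e%:E)%E).
    apply: leeD; last by apply: lee_wpmul2l => //; rewrite lee_fin mulr_ge0// addr_ge0.
    apply: le_trans s2 _; apply: lee_wpmul2l; first by rewrite lee_fin.
    by apply: le_trans s3 _; apply: leeD => //; apply: lee_wpmul2l.
  rewrite ge0_muleDr; [|exact: circint_ge0|by rewrite -EFinM lee_fin mulr_ge0// ltW].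
  rewrite -addeA; apply: leeD => //.
  by rewrite -!EFinM -EFinD lee_fin; lra.
have fin_f : circint f \is a fin_num.
  rewrite ge0_fin_numE; last exact: circint_ge0.
  apply: (@le_lt_trans _ _ (circint (fun=> 1%R))); last by rewrite circint_cst ltry.
  by apply: le_circint => //; exact: cmeasr_cst.
have le1 : (circint (fun z => f z * g' z)%R <= c%:E * circint f)%E.
  apply/lee_addgt0Pr => e e0.
  have k0 : 0 < 4 * c + 2 by lra.
  have := key (e / (4 * c + 2)) (divr_gt0 e0 k0).
  by rewrite mulrCA divff ?mulr1// lt0r_neq0.
(* Subtracting the finite c int f leaves int h <= 0 for a nonnegative h. Where g > c, the capped
   weight still exceeds c, so h is positive there. *)
pose h z := f z * (g' z - c).
have h0 z : 0 <= h z.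
  rewrite /h /f; case: ifP => [cg|_]; last by rewrite mul0r.
  by rewrite mul1r subr_ge0 le_min ltW//= lerDl.
have mh : cmeasr h by apply: cmeasrM => //; apply: cmeasrB => //; exact: cmeasr_cst.
have E : circint (fun z => f z * g' z)%R = (c%:E * circint f + circint h)%E.
  rewrite -circintZ// -circintD//; last 2 first.
  - by apply: cmeasrM => //; exact: cmeasr_cst.
  - by move=> z; exact: mulr_ge0.
  by apply: circint_ext => z _; rewrite /h; ring.
have h_0 : circint h = 0%E.
  apply/eqP; rewrite eq_le circint_ge0// andbT.
  move: le1; rewrite E -[X in (_ <= X)%E]adde0 leeD2lE//.
  by rewrite fin_numM.
have := circint_eq0 mh h0 h_0.
move=> hae; apply: aecirc_mp hae _ => z _ hz; rewrite leNgt; apply/negP => cg.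
move: hz; rewrite /h /f /g' cg mul1r => /eqP; rewrite subr_eq0 => /eqP ce.
have : c < Num.min (g z) (c + 1) by rewrite lt_min cg /= ltrDl ltr01.
by rewrite ce ltxx.
Qed.

(** F is replaced by 0 where |F| > k; the error |F|^2 on that set tends to 0 pointwise and is
    dominated by |F|^2. *)
Lemma L2_truncation F (e : R) : L2 F -> 0 < e ->
  exists G (M : R), [/\ cmeas G, forall z, cabs (G z) <= M &
    (circint (sqmod (fun z => F z - G z)%R) <= e%:E)%E].
Proof.
move=> [mF F2] e0.
pose u k z := if k%:R < cabs (F z) then sqmod F z else 0.
have mu_ k : cmeasr (u k).
  apply: cmeasr_if; [exact: cmeasr_cabs|exact: cmeasr_sqmod|exact: cmeasr_cst].
have u0 k z : 0 <= u k z by rewrite /u; case: ifP => // _; exact: sqmod_ge0.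
have uF k z : u k z <= sqmod F z by rewrite /u; case: ifP => // _; exact: sqmod_ge0.
have mD := @measurable_Dom R.
have mFE : measurable_fun D (fun t => (sqmod F (cis t))%:E).
  by apply: cmeasr_EFin; exact: cmeasr_sqmod.
have cvgu : (circint (u k) @[k --> \oo] --> 0)%E.
  have -> : 0%E = (\int[lam]_(t in D) (cst 0 t))%E by rewrite integral0.
  have [] := @dominated_convergence _ _ _ lam D mD (fun k t => (u k (cis t))%:E) (cst 0%E)
     (fun t => (sqmod F (cis t))%:E) => //.
  - by move=> k; exact: cmeasr_EFin.
  - apply: aeW => t Dt; apply: cvg_near_cst.
    exists (Num.bound (cabs (F (cis t)))) => // k /= bk.
    rewrite /u ltNge (_ : cabs _ <= _) //.
    by apply: le_trans (ltW (archi_boundP (cabs_ge0 _))) _; rewrite ler_nat.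
  - apply/integrableP; split => //.
    by under eq_integral do rewrite gee0_abs ?lee_fin ?sqmod_ge0//.
  - by apply: aeW => t k Dt; rewrite gee0_abs ?lee_fin.
move/fine_cvgP: cvgu => [fin0 u_0].
have uI : \forall k \near \oo, fine (circint (u k)) < e by exact: (cvgr_lt _ u_0 _ e0).
have [k [h1 h2]] : exists k, circint (u k) \is a fin_num /\ fine (circint (u k)) < e.
  by have [k _ h] := filterI fin0 uI; exists k; exact: (h k (leqnn k)).
exists (fun z => if k%:R < cabs (F z) then 0 else F z), k%:R; split.
- have /cmeasP[m1 m2] := mF; apply/cmeasP; split.
    apply: (@cmeasr_ext _ (fun z => if k%:R < cabs (F z) then 0 else Re (F z))).
      by move=> t; case: ifP.
    by apply: cmeasr_if => //; [exact: cmeasr_cabs|exact: cmeasr_cst].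
  apply: (@cmeasr_ext _ (fun z => if k%:R < cabs (F z) then 0 else Im (F z))).
    by move=> t; case: ifP.
  by apply: cmeasr_if => //; [exact: cmeasr_cabs|exact: cmeasr_cst].
- by move=> z; case: ltP => //; rewrite cabs0.
- set v := sqmod _.
  have -> : circint v = circint (u k).
    apply: circint_ext => z _; rewrite /v /sqmod /u; case: ifP => _.
      by rewrite subr0.
    by rewrite subrr cabs0 expr0n.
  by move: h2; rewrite -{2}(fineK h1) lee_fin => /ltW.
Qed.

Lemma circint_sqmodD_le F G (a b : R) : cmeas F -> cmeas G ->
  (circint (sqmod F) <= a%:E)%E -> (circint (sqmod G) <= b%:E)%E ->
  (circint (sqmod (fun z => F z + G z)%R) <= (2 * a + 2 * b)%:E)%E.
Proof.
move=> mF mG Fa Gb.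
have sF := cmeasr_sqmod mF; have sG := cmeasr_sqmod mG.
have m2 u : cmeasr u -> cmeasr (fun z : C => 2 * u z).
  by move=> ?; apply: cmeasrM => //; exact: cmeasr_cst.
apply: (@le_trans _ _ (circint (fun z => 2 * sqmod F z + 2 * sqmod G z)%R)).
  apply: le_circint.
  - exact: cmeasr_sqmod (cmeasD mF mG).
  - by apply: cmeasrD; exact: m2.
  - by move=> z; exact: sqmod_ge0.
  - by move=> z; rewrite addr_ge0// mulr_ge0// sqmod_ge0.
  - by move=> z _; exact: sqr_cabsD.
rewrite circintD; [|exact: m2|exact: m2| |]; last 2 first.
- by move=> z; rewrite mulr_ge0// sqmod_ge0.
- by move=> z; rewrite mulr_ge0// sqmod_ge0.
rewrite !circintZ//; try by move=> z; exact: sqmod_ge0.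
by rewrite (EFinD (2 * a)%R) (EFinM 2 a) (EFinM 2 b); apply: leeD; apply: lee_wpmul2l.
Qed.

(** After truncation, L^1 approximation of the real and imaginary parts is enough: |x - y|^2 <= 2 M
    |x - y| when x and y are bounded by M. *)
Lemma exists_trig_poly_L2 F (e : R) : L2 F -> 0 < e ->
  exists2 T, trig_poly T & (circint (sqmod (fun z => F z - T z)%R) <= e%:E)%E.
Proof.
move=> F2 e0; have mF := F2.1.
have e4 : 0 < e / 4 by rewrite divr_gt0.
have [G [M [mG GM FG]]] := L2_truncation F2 e4.
have M0 : 0 <= M by exact: le_trans (cabs_ge0 _) (GM 0).
have /cmeasP[mr mi] := mG.
(* The two parts contribute at most 4 M d <= e / 4, the added 1 covering M = 0. With the truncation
   error e / 4, the inequality |x + y|^2 <= 2 |x|^2 + 2 |y|^2 gives e. *)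
pose d := e / 4 / (4 * M + 1).
have d0 : 0 < d by rewrite divr_gt0// ltr_wpDl// mulr_ge0.
have [|p [pT pM pd]] := @exists_trig_approx _ (fun z => Re (G z)) M d mr _ d0.
  by move=> z _; apply: le_trans (normRe_le_cabs _) (GM z).
have [|q [qT qM qd]] := @exists_trig_approx _ (fun z => Im (G z)) M d mi _ d0.
  by move=> z _; apply: le_trans (normIm_le_cabs _) (GM z).
pose T z : C := Complex (p z) 0 + Complex 0 1 * Complex (q z) 0.
have TT : trig_poly T by apply: trig_polyD => //; exact: trig_polyZ.
have mT := cmeas_trig_poly TT.
have mp : cmeasr p by have /cmeasP[] := cmeas_trig_poly pT.
have mq : cmeasr q by have /cmeasP[] := cmeas_trig_poly qT.
have mn u v : cmeasr u -> cmeasr v -> cmeasr (fun z => 2 * M * `|u z - v z|).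
  move=> mu_ mv; apply: cmeasrM; first exact: cmeasr_cst.
  by apply: (cmeasr_comp (f := @Num.norm _ R)) => //; exact: cmeasrB.
have mn' u v : cmeasr u -> cmeasr v -> cmeasr (fun z : C => `|u z - v z|).
  by move=> mu_ mv; apply: (cmeasr_comp (f := @Num.norm _ R)) => //; exact: cmeasrB.
have GT : (circint (sqmod (fun z => G z - T z)%R) <= (e / 4)%:E)%E.
  apply: (@le_trans _ _ (circint (fun z => 2 * M * `|Re (G z) - p z| + 2 * M * `|Im (G z) - q z|)%R)).
    apply: le_circint.
    - exact: cmeasr_sqmod (cmeasB mG mT).
    - by apply: cmeasrD; exact: mn.
    - by move=> z; exact: sqmod_ge0.
    - by move=> z; rewrite addr_ge0// !mulr_ge0.
    - move=> z z1; rewrite /sqmod sqr_cabs.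
      have -> : Re (G z - T z) = Re (G z) - p z by rewrite /T !ReImE /=; ring.
      have -> : Im (G z - T z) = Im (G z) - q z by rewrite /T !ReImE /=; ring.
      have sq (x y : R) : `|x| <= M -> `|y| <= M -> (x - y) ^+ 2 <= 2 * M * `|x - y|.
        move=> xM yM; rewrite -real_normK ?num_real// expr2 ler_wpM2r//.
        by apply: le_trans (ler_normB _ _) _; lra.
      apply: lerD; apply: sq; try exact: pM; try exact: qM.
      - by apply: le_trans (normRe_le_cabs _) (GM z).
      - by apply: le_trans (normIm_le_cabs _) (GM z).
  rewrite circintD; [|exact: mn|exact: mn| |]; last 2 first.
  - by move=> z; rewrite !mulr_ge0.
  - by move=> z; rewrite !mulr_ge0.
  rewrite !circintZ//; try exact: mn'; try exact: mulr_ge0.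
  apply: (@le_trans _ _ ((2 * M)%:E * d%:E + (2 * M)%:E * d%:E)%E).
    by apply: leeD; apply: lee_wpmul2l; rewrite ?lee_fin ?mulr_ge0.
  rewrite -!EFinM -!EFinD lee_fin -mulrDl /d mulrCA ger_pMr//.
  by rewrite ler_pdivrMr ?ltr_wpDl ?mulr_ge0//; lra.
exists T => //.
have := circint_sqmodD_le (cmeasB mF mG) (cmeasB mG mT) FG GT.
rewrite (_ : 2 * (e / 4) + 2 * (e / 4) = e); last by field.
rewrite (_ : sqmod (fun z => F z - G z + (G z - T z)) = sqmod (fun z => F z - T z))//.
by apply/funext => z; rewrite /sqmod addrA subrK.
Qed.

End Density.

(** * Fourier coefficients and Hardy space *)

Section ComplexIntegral.
Variable R : realType.
Local Notation Re := complex.Re.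
Local Notation Im := complex.Im.
Local Notation C := R[i].
Local Notation lam := (@lebesgue_measure R).
Local Notation D := (@Dom R).
Local Notation tpi := ((pi : R) *+ 2).
Implicit Types (F G H : C -> C) (u v : C -> R).

Definition L1r u := cmeasr u /\ (circint (fun z => `|u z|)%R < +oo)%E.

Lemma cmeasr_norm u : cmeasr u -> cmeasr (fun z => `|u z|).
Proof. exact: (cmeasr_comp (f := @Num.norm _ R)). Qed.

Lemma L1r_integrable u : L1r u -> lam.-integrable D (EFin \o (fun t => u (cis t))).
Proof. by move=> [mu_ u1]; apply/integrableP; split; [exact: cmeasr_EFin|]. Qed.

Definition rint u : R := Rintegral lam D (fun t => u (cis t)).

Lemma rintD u v : L1r u -> L1r v -> rint (fun z => u z + v z) = rint u + rint v.
Proof.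
move=> u1 v1; rewrite /rint RintegralD//; first exact: measurable_Dom.
  exact: L1r_integrable.
exact: L1r_integrable.
Qed.

Lemma rintZ (c : R) u : L1r u -> rint (fun z => c * u z) = c * rint u.
Proof.
move=> u1; rewrite /rint RintegralZl//; first exact: measurable_Dom.
exact: L1r_integrable.
Qed.

Lemma le_norm_rint u : L1r u -> `|rint u| <= fine (circint (fun z => `|u z|)).
Proof.
move=> u1; apply: le_normr_Rintegral; first exact: measurable_Dom.
exact: L1r_integrable.
Qed.

Lemma rint_ext u v : (forall z, cabs z = 1 -> u z = v z) -> rint u = rint v.
Proof. by move=> uv; apply: eq_Rintegral => t _; rewrite uv// cabs_cis. Qed.

Lemma rint_ae u v : cmeasr u -> cmeasr v -> aecirc (fun z => u z = v z) -> rint u = rint v.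
Proof. by move=> mu_ mv uv; congr fine; exact: ae_eq_circint. Qed.

Definition L1 F := cmeas F /\ (circint (fun z => cabs (F z)) < +oo)%E.

Definition cinte F : C := cint (fun t => F (cis t)).

Lemma cinteE F : cinte F = Complex (tpi^-1 * rint (fun z => Re (F z))) (tpi^-1 * rint (fun z => Im (F z))).
Proof. by []. Qed.

Lemma L1_Re F : L1 F -> L1r (fun z => Re (F z)).
Proof.
move=> [mF F1]; have /cmeasP[m1 m2] := mF; split => //.
apply: (@circint_lty_le _ (fun z => `|Re (F z)|) (fun z => cabs (F z))) => //.
- exact: cmeasr_norm.
- exact: cmeasr_cabs.
- by move=> z; exact: cabs_ge0.
- by move=> z _; exact: normRe_le_cabs.
Qed.

Lemma L1_Im F : L1 F -> L1r (fun z => Im (F z)).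
Proof.
move=> [mF F1]; have /cmeasP[m1 m2] := mF; split => //.
apply: (@circint_lty_le _ (fun z => `|Im (F z)|) (fun z => cabs (F z))) => //.
- exact: cmeasr_norm.
- exact: cmeasr_cabs.
- by move=> z; exact: cabs_ge0.
- by move=> z _; exact: normIm_le_cabs.
Qed.

Lemma L1_LinfM F G : Linf F -> L1 G -> L1 (fun z => F z * G z).
Proof.
move=> /LinfP[mF [M M0 FM]] [mG G1]; split; first exact: cmeasM.
have cG := cmeasr_cabs mG.
apply: (@le_lt_trans _ _ (circint (fun z => M * cabs (G z)))).
  apply: ae_le_circint.
  - exact: cmeasr_cabs (cmeasM mF mG).
  - by apply: cmeasrM => //; exact: cmeasr_cst.
  - by move=> z; exact: cabs_ge0.
  - by move=> z; rewrite mulr_ge0// cabs_ge0.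
  - by apply: aecirc_mp FM _ => z _ h; rewrite cabsM ler_wpM2r// cabs_ge0.
rewrite circintZ//; first exact: lte_mul_pinfty.
by move=> z; exact: cabs_ge0.
Qed.

Lemma L1Z c F : L1 F -> L1 (fun z => c * F z).
Proof. exact/L1_LinfM/Linf_cst. Qed.

(** Pointwise x <= d + x^2 / d. With d left free, this takes the place of the Cauchy-Schwarz
    inequality. *)
Lemma circint_cabs_le F (d : R) : cmeas F -> 0 < d ->
  (circint (fun z => cabs (F z)) <= (d * tpi)%:E + (d^-1)%:E * circint (sqmod F))%E.
Proof.
move=> mF d0; have sF := cmeasr_sqmod mF.
have d'0 : 0 <= d^-1 by rewrite invr_ge0 ltW.
rewrite -circint_cst -circintZ//; last by move=> z; exact: sqmod_ge0.
have m2 : cmeasr (fun z => d^-1 * sqmod F z) by apply: cmeasrM => //; exact: cmeasr_cst.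
rewrite -circintD//; last first.
- by move=> z; rewrite mulr_ge0// sqmod_ge0.
- by move=> _; exact: ltW.
- exact: cmeasr_cst.
apply: le_circint.
- exact: cmeasr_cabs.
- by apply: cmeasrD => //; exact: cmeasr_cst.
- by move=> z; exact: cabs_ge0.
- by move=> z; apply: addr_ge0; [exact: ltW|apply: mulr_ge0 => //; exact: sqmod_ge0].
- move=> z _; rewrite /sqmod; have x0 := cabs_ge0 (F z); move: (cabs (F z)) x0 => x x0.
  have : d * x <= d * (d + d^-1 * x ^+ 2).
    by rewrite mulrDr mulrA divff ?lt0r_neq0// mul1r; nra.
  by rewrite ler_pM2l.
Qed.

Lemma L2_L1 F : L2 F -> L1 F.
Proof.
move=> [mF F2]; split => //.
apply: le_lt_trans (circint_cabs_le mF ltr01) _.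
by rewrite invr1 mul1e; apply: lte_add_pinfty => //; rewrite ltry.
Qed.

Lemma cinteD F G : L1 F -> L1 G -> cinte (fun z => F z + G z) = cinte F + cinte G.
Proof.
move=> F1 G1; rewrite !cinteE; apply: complexP; rewrite !ReImE /= -mulrDr; congr (_ * _).
  rewrite -rintD; [|exact: L1_Re|exact: L1_Re].
  by apply: rint_ext => z _; rewrite CReD.
rewrite -rintD; [|exact: L1_Im|exact: L1_Im].
by apply: rint_ext => z _; rewrite CImD.
Qed.

Lemma L1rZ (c : R) u : L1r u -> L1r (fun z => c * u z).
Proof.
move=> [mu_ u1]; split; first by apply: cmeasrM => //; exact: cmeasr_cst.
have -> : circint (fun z => `|c * u z|) = circint (fun z => `|c| * `|u z|).
  by apply: circint_ext => z _; rewrite normrM.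
rewrite circintZ//; first exact: lte_mul_pinfty.
exact: cmeasr_norm.
Qed.

Lemma cinteZ c F : L1 F -> cinte (fun z => c * F z) = c * cinte F.
Proof.
move=> F1; have r1 := L1_Re F1; have i1 := L1_Im F1.
rewrite !cinteE; apply: complexP; rewrite !ReImE /=.
  transitivity (tpi^-1 * (Re c * rint (fun z => Re (F z)) + - Im c * rint (fun z => Im (F z)))).
    congr (_ * _); rewrite -!rintZ// -rintD; [|exact: L1rZ|exact: L1rZ].
    by apply: rint_ext => z _; rewrite CReM mulNr.
  by ring.
transitivity (tpi^-1 * (Re c * rint (fun z => Im (F z)) + Im c * rint (fun z => Re (F z)))).
  congr (_ * _); rewrite -!rintZ// -rintD; [|exact: L1rZ|exact: L1rZ].
  by apply: rint_ext => z _; rewrite CImM.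
by ring.
Qed.

Lemma cinte_ext F G : (forall z, cabs z = 1 -> F z = G z) -> cinte F = cinte G.
Proof.
by move=> FG; rewrite !cinteE; congr Complex; congr (_ * _);
  apply: rint_ext => z z1; rewrite FG.
Qed.

Lemma cinte_ae F G : cmeas F -> cmeas G -> aeeq F G -> cinte F = cinte G.
Proof.
move=> /cmeasP[m1 m2] /cmeasP[m3 m4] /aeeqE FG.
by rewrite !cinteE; congr Complex; congr (_ * _); apply: rint_ae => //;
  apply: aecirc_mp FG _ => z _ ->.
Qed.

Lemma cabs_cinte_le F (d : R) : L1 F -> (circint (fun z => cabs (F z)) <= d%:E)%E ->
  cabs (cinte F) <= tpi^-1 * (2 * d).
Proof.
move=> F1 Fd; rewrite cinteE; apply: le_trans (cabs_le_ReIm _) _ => /=.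
have tpi0 := two_pi_gt0 R.
have mF := F1.1.
have h u : L1r u -> (forall z, `|u z| <= cabs (F z)) -> `|rint u| <= d.
  move=> u1 uF; apply: le_trans (le_norm_rint u1) _.
  rewrite -lee_fin fineK; last first.
    by rewrite ge0_fin_numE ?u1.2//; apply: (@circint_ge0 _ (fun z => `|u z|)).
  apply: le_trans _ Fd; apply: le_circint => //.
  - exact: cmeasr_norm u1.1.
  - exact: cmeasr_cabs.
  - by move=> z; exact: cabs_ge0.
have i0 : 0 < tpi^-1 by rewrite invr_gt0.
rewrite !normrM (ger0_norm (ltW i0)) -mulrDr ler_pM2l//.
rewrite mulr_natl mulr2n lerD//; apply: h.
- exact: L1_Re.
- by move=> z; exact: normRe_le_cabs.
- exact: L1_Im.
- by move=> z; exact: normIm_le_cabs.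
Qed.

End ComplexIntegral.

Section Hardy.
Variable R : realType.
Local Notation C := R[i].
Local Notation lam := (@lebesgue_measure R).
Local Notation D := (@Dom R).
Local Notation tpi := ((pi : R) *+ 2).
Implicit Types (F G H : C -> C) (u v : C -> R) (n k : int).

Lemma cisXz (t : R) n : cis t ^ n = cis (n%:~R * t).
Proof.
case: n => n; first by rewrite -exprnP cisX.
by rewrite NegzE -exprnN cisX mulrNz mulNr cisV.
Qed.

Lemma cmeas_exprz n : cmeas (fun z : C => z ^ n).
Proof.
case: n => n; first exact/cmeasX/cmeas_id.
apply: (@cmeas_ext _ (fun z => conjc z ^+ n.+1)) => [t|].
  by rewrite NegzE -exprnN -exprVn invc_unit// cabs_cis.
exact/cmeasX/cmeas_conj/cmeas_id.
Qed.

Lemma cabs_exprz (z : C) n : cabs z = 1 -> cabs (z ^ n) = 1.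
Proof.
move=> z1; case: n => n; first by rewrite -exprnP cabsX z1 expr1n.
by rewrite NegzE -exprnN cabsV cabsX z1 expr1n invr1.
Qed.

Lemma Linf_exprz n : Linf (fun z : C => z ^ n).
Proof.
apply/LinfP; split; first exact: cmeas_exprz.
by exists 1 => //; apply: aecircW => z z1; rewrite cabs_exprz.
Qed.

Lemma unit_neq0 (z : C) : cabs z = 1 -> z != 0.
Proof. by move=> z1; rewrite -cabs_eq0 z1 oner_eq0. Qed.

Lemma integral_derive_periodic (f F : R -> R) : continuous f ->
  (forall t : R, is_derive t 1 F (f t)) -> F 0 = F tpi ->
  Rintegral lam D f = 0.
Proof.
move=> cf dF F0.
have cF : continuous F.
  by move=> t; apply: differentiable_continuous; apply/derivable1_diffP; have [] := dF t.
rewrite /Rintegral /Dom (@continuous_FTC2 _ f F) ?F0 ?subee//.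
- exact: two_pi_gt0.
- exact: continuous_subspaceT.
- split.
  + by move=> x _; have [] := dF x.
  + exact/cvg_at_right_filter/cF.
  + exact/cvg_at_left_filter/cF.
- by move=> x _; rewrite derive1E (@derive_val _ _ _ _ _ _ _ (dF x)).
Qed.

(** The parts cos (n t) and sin (n t) have the 2 pi-periodic primitives sin (n t) / n and - cos (n
    t) / n. *)
Lemma cinte_exprz n : n != 0 -> cinte (fun z : C => z ^ n) = 0.
Proof.
move=> n0; have r0 : (n%:~R : R) != 0 by rewrite intr_eq0.
move: (n%:~R : R) (cisXz ^~ n) (cisXz tpi n) r0 => r E; rewrite cis2pi exp1rz => E2 r0.
have c2 : cos (r * tpi) = 1 by have /(congr1 (@complex.Re R)) := E2.
have s2 : sin (r * tpi) = 0 by have /(congr1 (@complex.Im R)) := E2.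
have dl (t : R) : is_derive t 1 (fun s => r * s) r.
  have := is_deriveZ r (is_derive_id t 1); rewrite /GRing.scale /= mulr1.
  by [].
rewrite cinteE; apply: complexP => /=.
  rewrite (_ : rint _ = 0) ?mulr0//.
  rewrite /rint (_ : (fun t => _) = (fun t => cos (r * t))); last first.
    by apply/funext => t; rewrite E.
  apply: (@integral_derive_periodic _ (fun t => r^-1 * sin (r * t))).
  - by move=> t; apply: (@continuous_comp _ _ _ (fun s => r * s) cos);
      [apply: cvgM => //; exact: cvg_cst|exact: continuous_cos].
  - move=> t; have := is_deriveZ r^-1 (is_derive1_comp (is_derive_sin (r * t)) (dl t)).
    by rewrite /GRing.scale /= mulrCA mulVf// mulr1.
  - by rewrite s2 mulr0 sin0.
rewrite (_ : rint _ = 0) ?mulr0//.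
rewrite /rint (_ : (fun t => _) = (fun t => sin (r * t))); last first.
  by apply/funext => t; rewrite E.
apply: (@integral_derive_periodic _ (fun t => - r^-1 * cos (r * t))).
- by move=> t; apply: (@continuous_comp _ _ _ (fun s => r * s) sin);
    [apply: cvgM => //; exact: cvg_cst|exact: continuous_sin].
- move=> t; have := is_deriveZ (- r^-1) (is_derive1_comp (is_derive_cos (r * t)) (dl t)).
  rewrite /GRing.scale /= (_ : - r^-1 * (- sin (r * t) * r) = sin (r * t))//.
  by field.
- by rewrite c2 mulr0 cos0.
Qed.

Lemma fcoefE F n : fcoef F n = cinte (fun z => F z * z ^ (- n)).
Proof.
rewrite /fcoef /cinte; congr cint; apply/funext => t.
by rewrite cisXz mulrNz mulNr.
Qed.

Lemma L1_exprz F n : L1 F -> L1 (fun z => F z * z ^ n).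
Proof.
move=> F1; have := L1_LinfM (Linf_exprz n) F1.
by rewrite (_ : (fun z => z ^ n * F z) = (fun z => F z * z ^ n))//; apply/funext => z; rewrite mulrC.
Qed.

Lemma fcoefD F G n : L1 F -> L1 G -> fcoef (fun z => F z + G z) n = fcoef F n + fcoef G n.
Proof.
move=> F1 G1; rewrite !fcoefE -cinteD; [|exact: L1_exprz|exact: L1_exprz].
by apply: cinte_ext => z _; rewrite mulrDl.
Qed.

Lemma fcoefZ c F n : L1 F -> fcoef (fun z => c * F z) n = c * fcoef F n.
Proof.
move=> F1; rewrite !fcoefE -cinteZ; last exact: L1_exprz.
by apply: cinte_ext => z _; rewrite mulrA.
Qed.

Lemma fcoef_ext F G n : (forall z, cabs z = 1 -> F z = G z) -> fcoef F n = fcoef G n.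
Proof. by move=> FG; rewrite !fcoefE; apply: cinte_ext => z z1; rewrite FG. Qed.

Lemma fcoef_ae F G n : cmeas F -> cmeas G -> aeeq F G -> fcoef F n = fcoef G n.
Proof.
move=> mF mG /aeeqE FG; rewrite !fcoefE; apply: cinte_ae.
- by apply: cmeasM => //; exact: cmeas_exprz.
- by apply: cmeasM => //; exact: cmeas_exprz.
- by apply/aeeqE; apply: aecirc_mp FG _ => z _ ->.
Qed.

Lemma fcoef_shift F n k : fcoef (fun z => z ^ k * F z) n = fcoef F (n - k).
Proof.
rewrite !fcoefE; apply: cinte_ext => z /unit_neq0 z0.
by rewrite opprB addrC expfzDr//; ring.
Qed.

Lemma fcoef_exprz k n : n != k -> fcoef (fun z : C => z ^ k) n = 0.
Proof.
move=> nk; rewrite fcoefE (@cinte_ext _ _ (fun z => z ^ (k - n))); last first.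
  by move=> z /unit_neq0 z0; rewrite expfzDr.
by rewrite cinte_exprz// subr_eq0 eq_sym.
Qed.

Lemma cabs_fcoef_le F n (d e : R) : L2 F -> 0 < d -> (circint (sqmod F) <= e%:E)%E ->
  cabs (fcoef F n) <= tpi^-1 * (2 * (d * tpi + d^-1 * e)).
Proof.
move=> F2 d0 Fe; rewrite fcoefE; apply: cabs_cinte_le; first by apply: (@L1_exprz F); exact: L2_L1.
have -> : circint (fun z => cabs (F z * z ^ (- n))) = circint (fun z => cabs (F z)).
  by apply: circint_ext => z z1; rewrite cabsM (cabs_exprz _ z1) mulr1.
apply: le_trans (circint_cabs_le F2.1 d0) _; rewrite EFinD; apply: leeD => //.
by rewrite EFinM; apply: lee_wpmul2l => //; rewrite lee_fin invr_ge0 ltW.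
Qed.

Lemma H2_L2 F : H2 F -> L2 F. Proof. by case. Qed.

Lemma H2D F G : H2 F -> H2 G -> H2 (fun z => F z + G z).
Proof.
move=> [F2 F0] [G2 G0]; split; first exact: L2D.
by move=> n n0; rewrite fcoefD ?F0 ?G0 ?addr0//; exact: L2_L1.
Qed.

Lemma H2Z c F : H2 F -> H2 (fun z => c * F z).
Proof.
move=> [F2 F0]; split; first exact: L2Z.
by move=> n n0; rewrite fcoefZ ?F0 ?mulr0//; exact: L2_L1.
Qed.

Lemma H2_ae F G : cmeas G -> aeeq F G -> H2 F -> H2 G.
Proof.
move=> mG FG [F2 F0]; split; first exact: L2_ae FG F2.
by move=> n n0; rewrite -(fcoef_ae n F2.1 mG FG) F0.
Qed.

Lemma H2B F G : H2 F -> H2 G -> H2 (fun z => F z - G z).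
Proof.
move=> hF hG; have := H2D hF (H2Z (-1) hG).
by rewrite (_ : (fun z => _) = (fun z => F z - G z))//; apply/funext => z; rewrite mulN1r.
Qed.

Lemma Hinf_H2 F : Hinf F -> H2 F.
Proof. by move=> [FI F0]; split => //; exact: Linf_L2. Qed.

(** A negative coefficient of F is that of F - G, hence controlled by the L^2 size of F - G. *)
Lemma H2_limit F : L2 F -> (forall e : R, 0 < e -> exists2 G, H2 G &
  (circint (sqmod (fun z => F z - G z)%R) <= e%:E)%E) -> H2 F.
Proof.
move=> F2 FG; split => // n n0; apply/eqP; rewrite -cabs_eq0 eq_le cabs_ge0 andbT.
apply/ler_addgt0Pr => e e0; rewrite add0r.
have tpi0 := two_pi_gt0 R.
(* For the squared error 2 pi d^2, the bound of [cabs_fcoef_le] is 4 d = e. *)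
pose d := e / 4; have d0 : 0 < d by rewrite divr_gt0.
have [G [G2 G0] Ge] := FG (d ^+ 2 * tpi) (mulr_gt0 (exprn_gt0 2 d0) tpi0).
have FG2 := L2B F2 G2.
have -> : fcoef F n = fcoef (fun z => F z - G z) n.
  have -> : fcoef F n = fcoef (fun z => F z - G z) n + fcoef G n.
    rewrite -fcoefD; [|exact: L2_L1|exact: L2_L1].
    by apply: fcoef_ext => z _; rewrite subrK.
  by rewrite G0// addr0.
apply: le_trans (cabs_fcoef_le n FG2 d0 Ge) _.
have fld (p x : R) : p != 0 -> x != 0 -> p^-1 * (2 * (x * p + x^-1 * (x ^+ 2 * p))) = 4 * x.
  by move=> p0 x0; field; rewrite p0 x0.
rewrite (fld _ _ (lt0r_neq0 tpi0) (lt0r_neq0 d0)).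
by rewrite /d mulrC divfK.
Qed.

Lemma H2_mulX F (i : nat) : H2 F -> H2 (fun z => z ^ (i : int) * F z).
Proof.
move=> [F2 F0]; split; first exact: LinfM_L2 (Linf_exprz i) F2.
by move=> n n0; rewrite fcoef_shift F0//; lia.
Qed.

Lemma H2_zero : H2 (fun=> 0 : C).
Proof.
split; first exact/Linf_L2/Linf_cst.
move=> n _; rewrite fcoefE cinteE; apply: complexP => /=; rewrite /rint /Rintegral.
  by under eq_integral do rewrite mul0r; rewrite integral0 mulr0.
by under eq_integral do rewrite mul0r; rewrite integral0 mulr0.
Qed.

Lemma H2_poly_mul F (P : {poly C}) : H2 F -> H2 (fun z => P.[z] * F z).
Proof.
move=> hF; elim/poly_ind: P => [|P c ih].
  rewrite (_ : (fun z => _) = (fun=> 0)); first exact: H2_zero.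
  by apply/funext => z; rewrite horner0 mul0r.
rewrite (_ : (fun z => _) = (fun z => z ^ (1 : int) * (P.[z] * F z) + c * F z)).
  by apply: H2D; [exact: (@H2_mulX _ 1)|exact: H2Z].
by apply/funext => z; rewrite hornerMXaddC expr1z; ring.
Qed.

Lemma H2_one : H2 (fun=> 1 : C).
Proof.
split; first exact/Linf_L2/Linf_cst.
by move=> n n0; rewrite -[X in fcoef X]/(fun z : C => z ^ (0 : int)) fcoef_exprz// lt_eqF.
Qed.

Lemma H2_poly (P : {poly C}) : H2 (fun z => P.[z]).
Proof.
have := H2_poly_mul P H2_one.
by rewrite (_ : (fun z => _) = (fun z => P.[z]))//; apply/funext => z; rewrite mulr1.
Qed.

Lemma Hinf_poly (P : {poly C}) : Hinf (fun z => P.[z]).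
Proof. by split; [exact: Linf_poly|have [] := H2_poly P]. Qed.

End Hardy.

(** * Density of polynomials in H^2, analytic products, Toeplitz operators *)

Section HardyDensity.
Variable R : realType.
Local Notation Re := complex.Re.
Local Notation C := R[i].
Local Notation tpi := ((pi : R) *+ 2).
Implicit Types (F G H : C -> C) (u v : C -> R).

Lemma circint_rint u : cmeasr u -> (forall z, 0 <= u z) -> (circint u < +oo)%E ->
  circint u = (rint u)%:E.
Proof. by move=> mu_ u0 ui; rewrite /rint /Rintegral fineK// ge0_fin_numE// circint_ge0. Qed.

Lemma L1r_ge0 u : cmeasr u -> (forall z, 0 <= u z) -> (circint u < +oo)%E -> L1r u.
Proof.
move=> mu_ u0 ui; split => //.
by rewrite (_ : circint _ = circint u)//; apply: circint_ext => z _; rewrite ger0_norm.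
Qed.

(** z^-n times the part of P of degree below n carries the frequencies -n to -1, so its conjugate
    carries 1 to n and is z times a polynomial. *)
Lemma conjc_sum_pow n (P : {poly C}) (z : C) : cabs z = 1 ->
  conjc (z ^- n * (take_poly n P).[z]) =
  z * (\sum_(k < n) (conjc P`_k)%:P * 'X^(n.-1 - k)).[z].
Proof.
move=> z1; have z0 := unit_neq0 z1.
rewrite /take_poly horner_poly horner_sum !rmorphM rmorph_sum /= !mulr_sumr.
apply: eq_bigr => k _; rewrite hornerM hornerC hornerXn rmorphM /= mulrCA [RHS]mulrCA.
congr (_ * _).
have -> : conjc (z ^- n) = z ^+ n.
  by rewrite -exprVn rmorphXn /= invc_unit// conjcK.
rewrite rmorphXn /= -invc_unit//.
apply: (mulIf (expf_neq0 k z0)); rewrite -mulrA exprVn mulVf ?expf_neq0// mulr1.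
by rewrite -exprS -exprD; congr (_ ^+ _); have := ltn_ord k; lia.
Qed.

Lemma H2_cinte_mulX G : H2 G -> cinte (fun z => z * G z) = 0.
Proof.
move=> [_ G0]; rewrite -(G0 (-1))// fcoefE; apply: cinte_ext => z _.
by rewrite opprK expr1z mulrC.
Qed.

(** Split a trigonometric approximant T of F into its analytic part Q and its negative part N. Then
    F - T = (F - Q) - N with F - Q in H^2 orthogonal to N, so by Pythagoras Q approximates F at
    least as well as T does. *)
Lemma H2_dense F (e : R) : H2 F -> 0 < e ->
  exists P : {poly C}, (circint (sqmod (fun z => F z - P.[z])%R) <= e%:E)%E.
Proof.
move=> hF e0; have F2 := H2_L2 hF.
have [T TT Te] := exists_trig_poly_L2 F2 e0.
have T2 := Linf_L2 (Linf_trig_poly TT).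
have [n [P TE]] := TT.
pose Q := drop_poly n P; exists Q; apply: le_trans Te.
pose E z := F z - Q.[z].
pose N z := z ^- n * (take_poly n P).[z].
have NT : trig_poly N by exists n, (take_poly n P).
have NI := Linf_trig_poly NT; have N2 := Linf_L2 NI.
have hE : H2 E by exact: H2B (H2_poly Q).
have E2 := H2_L2 hE.
have EN z : cabs z = 1 -> F z - T z = E z - N z.
  move=> z1; have z0 := unit_neq0 z1.
  rewrite TE// -{1}(poly_take_drop n P) hornerD hornerM hornerXn /E /N /Q.
  by field; rewrite expf_neq0.
have EN1 : L1 (fun z => E z * conjc (N z)).
  have cI : Linf (fun z => conjc (N z)).
    have /LinfP[mN [M M0 NM]] := NI; apply/LinfP; split; first exact: cmeas_conj.
    by exists M => //; apply: aecirc_mp NM _ => z _; rewrite cabs_conj.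
  have := L1_LinfM cI (L2_L1 E2).
  rewrite (_ : (fun z => conjc (N z) * E z) = (fun z => E z * conjc (N z)))//.
  by apply/funext => z; rewrite mulrC.
have cross : rint (fun z => Re (E z * conjc (N z))) = 0.
  have : cinte (fun z => E z * conjc (N z)) = 0.
    rewrite (@cinte_ext _ _ (fun z => z * ((\sum_(k < n) (conjc P`_k)%:P * 'X^(n.-1 - k)).[z] * E z))).
      by apply: H2_cinte_mulX; exact: H2_poly_mul.
    by move=> z z1; rewrite conjc_sum_pow//; ring.
  rewrite cinteE => /(congr1 (@complex.Re R)) /= /eqP; rewrite mulf_eq0 invr_eq0.
  by rewrite (negbTE (lt0r_neq0 (two_pi_gt0 R))) => /eqP.
have s0 G : forall z, 0 <= sqmod G z by move=> z; exact: sqmod_ge0.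
have D2 := L2B E2 N2.
have L2r G : L2 G -> L1r (sqmod G).
  by move=> [mG G2]; apply: L1r_ge0 => //; exact: cmeasr_sqmod.
have -> : circint (sqmod (fun z => F z - T z)) = circint (sqmod (fun z => E z - N z)).
  by apply: circint_ext => z z1; rewrite /sqmod EN.
have cE G : L2 G -> circint (sqmod G) = (rint (sqmod G))%:E.
  by move=> [mG G2]; apply: circint_rint => //; exact: cmeasr_sqmod.
rewrite -/(sqmod E) !cE// lee_fin.
have : rint (fun z => sqmod (fun z => E z - N z) z + 2 * Re (E z * conjc (N z))) =
       rint (fun z => sqmod E z + sqmod N z).
  by apply: rint_ext => z _; rewrite /sqmod !sqr_cabs !ReImE; ring.
have Rr := L1_Re EN1.
rewrite rintD; [|exact: L2r|exact: L1rZ]; rewrite rintZ// cross mulr0 addr0.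
rewrite rintD; [|exact: L2r|exact: L2r] => ->.
by rewrite lerDl -lee_fin -cE// circint_ge0.
Qed.

(** Multiplying by z shifts coefficients, so P F is in H^2 for every polynomial P. Let P tend to G
    in L^2; boundedness of F carries the limit to F G. *)
Lemma Hinf_mul_H2 F G : Hinf F -> H2 G -> H2 (fun z => F z * G z).
Proof.
move=> hF hG; have [FI _] := hF; have /LinfP[mF [M M0 FM]] := FI.
have G2 := H2_L2 hG.
apply: H2_limit; first exact: LinfM_L2.
move=> e e0; have k0 : 0 < M ^+ 2 + 1 by rewrite ltr_wpDl// sqr_ge0.
have [P Pe] := H2_dense hG (divr_gt0 e0 k0).
exists (fun z => P.[z] * F z); first exact/H2_poly_mul/Hinf_H2.
have mGP : cmeas (fun z => G z - P.[z]) by apply: cmeasB; [exact: G2.1|exact: cmeas_poly].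
have -> : sqmod (fun z => F z * G z - P.[z] * F z) = sqmod (fun z => F z * (G z - P.[z])).
  by apply/funext => z; rewrite /sqmod; congr (cabs _ ^+ 2); ring.
apply: le_trans (circint_sqmodM mF mGP M0 FM) _.
apply: (@le_trans _ _ ((M ^+ 2)%:E * (e / (M ^+ 2 + 1))%:E)%E).
  by apply: lee_wpmul2l => //; rewrite lee_fin sqr_ge0.
by rewrite -EFinM lee_fin mulrCA ger_pMr// ler_pdivrMr// mul1r lerDl.
Qed.

Lemma Hinf_mul F G : Hinf F -> Hinf G -> Hinf (fun z => F z * G z).
Proof.
move=> hF hG; split; first by apply: LinfM; [case: hF|case: hG].
by have [_] := Hinf_mul_H2 hF (Hinf_H2 hG).
Qed.

Lemma Hinf_prod I (r : seq I) (f : I -> C -> C) : (forall i, Hinf (f i)) ->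
  Hinf (fun z => \prod_(i <- r) f i z).
Proof.
move=> hf; elim: r => [|i r ih].
  rewrite (_ : (fun z => _) = (fun z => (1 : {poly C}).[z])); first exact: Hinf_poly.
  by apply/funext => z; rewrite big_nil hornerC.
rewrite (_ : (fun z => _) = (fun z => f i z * \prod_(j <- r) f j z)).
  exact: Hinf_mul.
by apply/funext => z; rewrite big_cons.
Qed.

Lemma le0_geometric (x B q : R) : 0 <= q < 1 -> (forall k, x <= q ^+ k * B) -> x <= 0.
Proof.
move=> /andP[q0 q1] h.
have c : (fun k => q ^+ k * B) @ \oo --> 0 * B.
  by apply: cvgM; [apply: cvg_expr; rewrite ger0_norm|exact: cvg_cst].
rewrite -(mul0r B); apply: (@ler_cvg_to _ _ _ _ (fun=> x) _ _ _ _ c); first exact: cvg_cst.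
by near=> k; exact: h.
Unshelve. all: end_near.
Qed.

Lemma Hinf_geometric (a : C) : cabs a < 1 -> Hinf (fun z => (1 - conjc a * z)^-1).
Proof.
move=> a1; pose f z := (1 - conjc a * z)^-1.
(* Up to the factor 1 - |a|^2, w is the Poisson kernel on the circle, hence continuous in the angle;
   f = conj(1 - conj(a) z) w there, so f is measurable. *)
pose w z := (cabs (1 - conjc a * z) ^+ 2)^-1.
have mw : cmeasr w.
  have c0 : 1 - cabs a ^+ 2 != 0.
    by rewrite subr_eq0 eq_sym lt_eqF// expr_lt1// cabs_ge0.
  rewrite /cmeasr (_ : (fun t => _) = (fun t => (1 - cabs a ^+ 2)^-1 * poisson a t)).
    apply: measurable_funM => //; apply: continuous_measurable_fun.
    exact: continuous_poisson.
  by apply/funext => t; rewrite /w /poisson sqr_den mulKf.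
have d0 z : cabs z = 1 -> 1 - conjc a * z != 0.
  by move=> /cis_surj[t _ <-]; exact: den_neq0.
have mf : cmeas f.
  apply: (@cmeas_ext _ (fun z => conjc (1 - conjc a * z) * Complex (w z) 0)).
    move=> t; have dt := d0 _ (cabs_cis t).
    apply: (mulfI dt); rewrite mulrA mul_conjc /f divff//.
    have n0 : cabs (1 - conjc a * cis t) ^+ 2 != 0 by rewrite expf_neq0// cabs_eq0.
    by apply: complexP; rewrite /= ?mul0r ?mulr0 ?subr0 ?addr0// /w divff.
  apply: cmeasM; last exact: cmeas_real.
  apply: cmeas_conj; apply: cmeasB; first exact: cmeas_cst.
  by apply: cmeasZ; exact: cmeas_id.
have a1' : 0 < 1 - cabs a by rewrite subr_gt0.
have fI : Linf f.
  apply/LinfP; split => //; exists (1 - cabs a)^-1; first by rewrite invr_ge0 ltW.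
  apply: aecircW => z z1; rewrite /f cabsV lef_pV2 ?posrE//; last first.
    by rewrite lt0r cabs_eq0 d0// cabs_ge0.
  have := cabs_triangle (1 - conjc a * z) (conjc a * z).
  by rewrite subrK cabs1 cabsM cabs_conj z1 mulr1; lra.
have f2 := Linf_L2 fI; have f1 := L2_L1 f2.
split => // n n0; rewrite -/f.
(* f = 1 + conj(a) z f gives a geometric recursion on the negative coefficients
   of f, which are bounded and hence vanish. *)
have rec m : m < 0 -> fcoef f m = conjc a * fcoef f (m - 1).
  move=> m0; rewrite -fcoef_shift -fcoefZ; last first.
    exact: L1_LinfM (Linf_exprz _ 1) f1.
  have one0 : fcoef (fun=> 1 : C) m = 0 by have [_ ->] := H2_one R.
  rewrite -[RHS]add0r -one0 -fcoefD; last 2 first.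
  - exact/L2_L1/Linf_L2/Linf_cst.
  - apply: L1Z; exact: L1_LinfM (Linf_exprz _ 1) f1.
  by apply: fcoef_ext => z z1; rewrite /f expr1z; field; exact: d0.
have iter k : fcoef f n = conjc a ^+ k * fcoef f (n - k%:Z).
  elim: k => [|k ih]; first by rewrite expr0 mul1r subr0.
  by rewrite ih rec ?exprSr -?mulrA; [congr (_ * (_ * fcoef _ _))|]; lia.
apply/eqP; rewrite -cabs_eq0 eq_le cabs_ge0 andbT.
have fe : (circint (sqmod f) <= (fine (circint (sqmod f)))%:E)%E.
  by rewrite fineK// ge0_fin_numE ?f2.2// (@circint_ge0 _ (sqmod f))// => z; exact: sqmod_ge0.
have q01 : 0 <= cabs a < 1 by rewrite cabs_ge0.
apply: (@le0_geometric _ (tpi^-1 * (2 * (1 * tpi + 1^-1 * fine (circint (sqmod f))))) _ q01) => k.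
rewrite (iter k) cabsM cabsX cabs_conj ler_wpM2l ?exprn_ge0 ?cabs_ge0//.
exact: cabs_fcoef_le.
Qed.

Lemma Hinf_bfac (a : C) : cabs a < 1 -> Hinf (bfac a).
Proof.
move=> a1; rewrite /bfac; case: eqVneq => a0.
  have := Hinf_poly ('X : {poly C}).
  by rewrite (_ : (fun z => _) = (fun z => z))//; apply/funext => z; rewrite hornerX.
pose k : C := Complex (cabs a) 0 / a.
have := Hinf_mul (Hinf_poly (k *: (a%:P - 'X))) (Hinf_geometric a1).
rewrite (_ : (fun z => (k *: (a%:P - 'X)).[z] * _) = (fun z => k * ((a - z) / (1 - conjc a * z))))//.
by apply/funext => z; rewrite hornerZ hornerD hornerN hornerC hornerX mulrA.
Qed.

Lemma Hinf_blaschke n (alpha : 'I_n -> C) : (forall j, cabs (alpha j) < 1) ->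
  Hinf (blaschke alpha).
Proof. by move=> al1; apply: Hinf_prod => j; exact: Hinf_bfac. Qed.

Lemma ip_self_eq0 F : L2 F -> ip F F = 0 -> circint (sqmod F) = 0%E.
Proof.
move=> [mF F2]; rewrite -[ip F F]/(cinte (fun z => F z * conjc (F z))) cinteE.
move=> /(congr1 (@complex.Re R)) /= /eqP; rewrite mulf_eq0 invr_eq0.
rewrite (negbTE (lt0r_neq0 (two_pi_gt0 R))) => /eqP h.
rewrite circint_rint//; [|exact: cmeasr_sqmod|by move=> z; exact: sqmod_ge0].
by rewrite (_ : rint (sqmod F) = 0)// -[RHS]h; apply: rint_ext => z _; rewrite mul_conjc.
Qed.

(** The projection is a choice, usable once a candidate exists: phi F itself. The difference between
    phi F and the chosen element is in H^2 and orthogonal to H^2, hence to itself. *)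
Lemma toepP phi F : H2 (fun z => phi z * F z) ->
  H2 (toep phi F) /\ aeeq (toep phi F) (fun z => phi z * F z).
Proof.
move=> hF; set G0 := fun z => phi z * F z.
have [hG ortho] : H2 (toep phi F) /\
    forall H, H2 H -> ip (fun z => G0 z - toep phi F z) H = 0.
  apply: (@epsilon_spec _ (inhabits (fun _ => 0))
    (fun G => H2 G /\ forall H, H2 H -> ip (fun z => G0 z - G z) H = 0)).
  exists G0; split => // H _.
  rewrite -[ip _ _]/(cinte (fun z => (G0 z - G0 z) * conjc (H z))) cinteE.
  by apply: complexP => /=; rewrite /rint /Rintegral;
    under eq_integral do rewrite subrr mul0r; rewrite integral0 mulr0.
split => //; apply: aeeq_sym.
have hD := H2B hF hG.
apply: aeeq_cancel_sqmod; [exact: (H2_L2 hF).1|exact: (H2_L2 hG).1|].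
by apply: ip_self_eq0; [exact: H2_L2|exact: ortho].
Qed.

End HardyDensity.

(** * Norms of weighted composition operators *)

Section WeightedNorm.
Variable R : realType.
Local Notation C := R[i].
Local Notation tpi := ((pi : R) *+ 2).
Implicit Types (F G : C -> C).

Lemma sqmod_poly_ge0 (P : {poly C}) : forall z, 0 <= sqmod (fun w => P.[w]) z.
Proof. by move=> z; exact: sqmod_ge0. Qed.

Lemma le_circint_weight F (g : C -> R) (M : R) : cmeas F -> cmeasr g -> (forall z, 0 <= g z) ->
  0 <= M -> aecirc (fun z => g z <= M) ->
  (circint (fun z => sqmod F z * g z)%R <= M%:E * circint (sqmod F))%E.
Proof.
move=> mF mg g0 M0 gM; have sF := cmeasr_sqmod mF.
rewrite -circintZ//; last by move=> z; exact: sqmod_ge0.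
apply: ae_le_circint.
- exact: cmeasrM.
- by apply: cmeasrM => //; exact: cmeasr_cst.
- by move=> z; rewrite mulr_ge0// sqmod_ge0.
- by move=> z; rewrite mulr_ge0// sqmod_ge0.
- by apply: aecirc_mp gM _ => z _ h; rewrite mulrC ler_wpM2r// sqmod_ge0.
Qed.

Lemma sqr_l2norm_le F G (K : R) : L2 F -> L2 G ->
  l2norm F <= K * l2norm G -> (circint (sqmod F) <= (K ^+ 2)%:E * circint (sqmod G))%E.
Proof.
move=> F2 G2 FG; rewrite !circint_sqmod// -EFinM lee_fin mulrA.
rewrite ler_pM2r ?two_pi_gt0// -exprMn ler_sqr// nnegrE ?l2norm_ge0//.
by apply: le_trans FG; exact: l2norm_ge0.
Qed.

Variables (S : (C -> C) -> Prop) (T : (C -> C) -> C -> C) (g : C -> R).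
Hypothesis S_L2 : forall F, S F -> L2 F.
Hypothesis S_poly : forall P : {poly C}, S (fun z => P.[z]).
Hypothesis mg : cmeasr g.
Hypothesis g0 : forall z, 0 <= g z.
Hypothesis gM : exists2 M : R, 0 <= M & aecirc (fun z => g z <= M).
Hypothesis TE : forall F, S F -> L2 (T F) /\
  circint (sqmod (T F)) = circint (fun z => sqmod F z * g z).

Let tpi0 : 0 < tpi. Proof. exact: two_pi_gt0. Qed.

Let sq F : S F -> circint (fun z => sqmod F z * g z) = (l2norm (T F) ^+ 2 * tpi)%:E.
Proof. by move=> /TE[TF2 <-]; exact: circint_sqmod. Qed.

Let l2norm_weight_le F M : S F -> 0 <= M -> aecirc (fun z => g z <= M) ->
  l2norm (T F) ^+ 2 <= M * l2norm F ^+ 2.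
Proof.
move=> SF M1 h; have F2 := S_L2 SF.
have := le_circint_weight F2.1 mg g0 M1 h.
by rewrite (sq SF) (circint_sqmod F2) -EFinM lee_fin mulrA ler_pM2r.
Qed.

(** Each essential bound M of g gives ||T F||^2 <= M ||F||^2, hence one inequality. Conversely, the
    supremum k bounds T on polynomials, so the polynomial test yields g <= k^2 a.e. *)
Lemma opnorm_weight : opnorm S T = Num.sqrt (essnorm g).
Proof.
have [M0 M00 gM0] := gM.
pose A := [set M : R | 0 <= M /\ {ae @mu R, forall t, Dom t -> `|g (cis t)| <= M}].
have AE M : A M <-> 0 <= M /\ aecirc (fun z => g z <= M).
  split=> -[M1 h]; split => //.
    have h' : aecirc (fun z => `|g z| <= M) by exact: h.
    by apply: aecirc_mp h' _ => z _; rewrite ger0_norm.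
  suff : aecirc (fun z => `|g z| <= M) by [].
  by apply: aecirc_mp h _ => z _; rewrite ger0_norm.
have A0 : A !=set0 by exists M0; apply/AE.
have Alb : has_lbound A by exists 0 => M [].
have essE : essnorm g = inf A by [].
have ess0 : 0 <= essnorm g by rewrite essE; apply: lb_le_inf => // M [].
pose B := [set l2norm (T F) | F in [set F | S F /\ l2norm F <= 1]].
have ub x : B x -> x <= Num.sqrt (essnorm g).
  move=> [F [SF F1] <-]; rewrite -(ger0_norm (l2norm_ge0 _)) -sqrtr_sqr ler_sqrt//.
  rewrite essE; apply: lb_le_inf => // M /AE[M1 h].
  apply: le_trans (l2norm_weight_le SF M1 h) _; rewrite ler_piMr//.
  by rewrite expr_le1// l2norm_ge0.
have hB : has_ubound B by exists (Num.sqrt (essnorm g)) => x; exact: ub.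
have S0 := S_poly 0.
have B0 : B (l2norm (T (fun z => (0 : {poly C}).[z]))).
  exists (fun z => (0 : {poly C}).[z]) => //; split => //.
  rewrite l2normE (@circint_ext _ _ (fun=> 0)); first by rewrite circint_cst mul0r mulr0 sqrtr0.
  by move=> z _; rewrite /sqmod horner0 cabs0 expr0n.
have k0 : 0 <= sup B by apply: le_trans (ub_le_sup hB B0); exact: l2norm_ge0.
rewrite -[opnorm S T]/(sup B); apply/eqP; rewrite eq_le; apply/andP; split.
  by apply: ge_sup => //; eexists; exact: B0.
have poly_le (P : {poly C}) : l2norm (T (fun z => P.[z])) <= sup B * l2norm (fun z => P.[z]).
  set n := l2norm (fun z => P.[z]).
  have n0 : 0 <= n by exact: l2norm_ge0.
  (* P is normalised by n + d rather than by its norm n, which may be zero. As T is known only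
     through [TE], its homogeneity on polynomials is read off the integral formula. *)
  suff main d : 0 < d -> l2norm (T (fun z => P.[z])) <= sup B * (n + d).
    have [k00|kn] := eqVneq (sup B) 0.
      by have := main _ ltr01; rewrite k00 !mul0r.
    apply/ler_addgt0Pr => e e0.
    have kp : 0 < sup B by rewrite lt_neqAle eq_sym kn.
    have := main (e / sup B) (divr_gt0 e0 kp).
    by rewrite mulrDr mulrCA mulfV// mulr1.
  move=> d0; have nd : 0 < n + d by rewrite ltr_wpDl.
  have nd' : n + d != 0 by rewrite gt_eqF.
  pose Q := (Complex (n + d)^-1 0 : C) *: P.
  have QE z : sqmod (fun w => Q.[w]) z = (n + d) ^- 2 * sqmod (fun w => P.[w]) z.
    rewrite /sqmod hornerZ cabsM exprMn; congr (_ * _).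
    by rewrite sqr_cabs /= expr0n addr0 exprVn.
  have mP := cmeasr_sqmod (cmeas_poly P).
  have nd2 : 0 <= (n + d) ^- 2 by rewrite invr_ge0 sqr_ge0.
  have nQ : l2norm (fun z => Q.[z]) <= 1.
    have : l2norm (fun z => Q.[z]) ^+ 2 <= 1.
      have := circint_sqmod (S_L2 (S_poly Q)).
      rewrite (@circint_ext _ _ (fun z => (n + d) ^- 2 * sqmod (fun w => P.[w]) z)); last by move=> z _.
      rewrite circintZ//; last exact: sqmod_poly_ge0.
      rewrite (circint_sqmod (S_L2 (S_poly P))) -/n -EFinM => -[].
      rewrite mulrA => /(mulIf (lt0r_neq0 tpi0)) <-.
      rewrite -exprVn -exprMn expr_le1//; last by rewrite mulr_ge0// invr_ge0 ltW.
      by rewrite mulrC ler_pdivrMr// mul1r lerDl ltW.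
    by rewrite expr_le1// l2norm_ge0.
  have TQ : l2norm (T (fun z => Q.[z])) <= sup B.
    by apply: ub_le_sup => //; exists (fun z => Q.[z]).
  have E : l2norm (T (fun z => P.[z])) ^+ 2 = ((n + d) * l2norm (T (fun z => Q.[z]))) ^+ 2.
    have := sq (S_poly Q).
    rewrite (@circint_ext _ _ (fun z => (n + d) ^- 2 * (sqmod (fun w => P.[w]) z * g z))); last first.
      by move=> z _; rewrite QE -mulrA.
    rewrite circintZ//; last 2 first.
    - exact: cmeasrM.
    - by move=> z; rewrite mulr_ge0// sqmod_poly_ge0.
    rewrite (sq (S_poly P)) -EFinM => -[].
    rewrite mulrA => /(mulIf (lt0r_neq0 tpi0)) E.
    by rewrite exprMn -E mulrA mulfV ?mul1r// expf_neq0.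
  have -> : l2norm (T (fun z => P.[z])) = (n + d) * l2norm (T (fun z => Q.[z])).
    apply/eqP; rewrite -(@eqrXn2 _ 2)//; first by rewrite E.
    - exact: l2norm_ge0.
    - by rewrite mulr_ge0 ?l2norm_ge0 ?(ltW nd).
  by rewrite mulrC ler_wpM2r// ltW.
have gk : aecirc (fun z => g z <= sup B ^+ 2).
  apply: ae_le_poly_weight => //; first exact: sqr_ge0.
  move=> P; rewrite (sq (S_poly P)) (circint_sqmod (S_L2 (S_poly P))) -EFinM lee_fin mulrA.
  rewrite ler_pM2r// -exprMn ler_sqr ?poly_le// nnegrE ?l2norm_ge0//.
  by rewrite mulr_ge0// l2norm_ge0.
rewrite -(ger0_norm k0) -sqrtr_sqr ler_sqrt ?sqr_ge0// essE.
by apply: ge_inf => //; apply/AE; split => //; exact: sqr_ge0.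
Qed.

(** For an isometry the polynomial test with c = 1 gives g <= 1 a.e., and P = 1 gives int g = 2 pi.
    So 1 - g is nonnegative a.e. with integral 0. *)
Lemma isometry_weight : isometry_on S T <-> aecirc (fun z => g z = 1).
Proof.
split=> [iso|g1 F SF]; last first.
  apply/eqP; rewrite -(@eqrXn2 _ 2) ?l2norm_ge0//; apply/eqP.
  have := circint_sqmod (S_L2 SF); rewrite (_ : circint _ = circint (fun z => sqmod F z * g z)).
    by rewrite (sq SF) => -[/(mulIf (lt0r_neq0 tpi0))].
  have mF := cmeasr_sqmod (S_L2 SF).1.
  apply: ae_eq_circint => //; first exact: cmeasrM.
  by apply: aecirc_mp g1 _ => z _ ->; rewrite mulr1.
have gle : aecirc (fun z => g z <= 1).
  apply: ae_le_poly_weight => // P.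
  by rewrite (sq (S_poly P)) (circint_sqmod (S_L2 (S_poly P))) iso// mul1e.
have S1 := S_poly 1.
have E : circint g = tpi%:E.
  have := sq S1; rewrite iso// -(circint_sqmod (S_L2 S1)).
  rewrite (@circint_ext _ _ g) => [->|z _]; last by rewrite /sqmod hornerC cabs1 expr1n mul1r.
  by rewrite (@circint_ext _ _ (fun=> 1)) ?circint_cst ?mul1r// => z _; rewrite /sqmod hornerC cabs1 expr1n.
pose h z := `|1 - g z|.
have mh : cmeasr h by apply: cmeasr_norm; apply: cmeasrB => //; exact: cmeasr_cst.
have h0 : circint h = 0%E.
  have : circint (fun z => g z + h z) = circint (fun=> 1).
    apply: ae_eq_circint; [exact: cmeasrD|exact: cmeasr_cst|].
    by apply: aecirc_mp gle _ => z _ z1; rewrite /h ger0_norm ?subr_ge0// addrC subrK.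
  rewrite circintD// ?E ?circint_cst ?mul1r; last by move=> z; exact: normr_ge0.
  by case: (circint h) => [r| |]// -[/(canRL (addKr tpi)) ->]; rewrite addNr.
apply: aecirc_mp (circint_eq0 mh _ h0) _ => [z|z _]; first exact: normr_ge0.
by move=> /normr0_eq0/subr0_eq.
Qed.
End WeightedNorm.

(** * Composition with a Blaschke product *)

Section CompositionBlaschke.
Variable R : realType.
Local Notation Re := complex.Re.
Local Notation C := R[i].
Local Notation tpi := ((pi : R) *+ 2).
Implicit Types (F G m phi : C -> C).
Variables (N : nat) (alpha : 'I_N -> C).
Hypothesis N0 : (0 < N)%N.
Hypothesis alpha1 : forall j, cabs (alpha j) < 1.
Local Notation b := (blaschke alpha).
Local Notation L := (transfer alpha).

Lemma cabs_blaschke z : cabs z = 1 -> cabs (b z) = 1.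
Proof.
move=> /cis_surj[t _ <-]; have [psi [chi [bE _ _ _ _]]] := exists_circle_lift N0 alpha1.
by rewrite bE cabs_cis.
Qed.

Lemma cmeasr_J0 : cmeasr (fun z => Re (J0 alpha z)).
Proof.
apply: (@measurableT_comp _ _ _ _ _ _ (fun x : R => x)) => //.
rewrite (_ : (fun t => _) = blaschke_jac alpha); last first.
  by apply/funext => t; rewrite (J0_cis alpha1).
by apply: continuous_measurable_fun; exact: continuous_jac.
Qed.

Lemma J0_gt0 z : cabs z = 1 -> 0 < Re (J0 alpha z).
Proof. by move=> /cis_surj[t _ <-]; rewrite (J0_cis alpha1); exact: jac_gt0. Qed.

Lemma cmeas_comp_blaschke F : cmeas F -> cmeas (fun z => F (b z)).
Proof.
have [psi [chi lft]] := exists_circle_lift N0 alpha1.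
move=> /cmeasP[F1 F2]; apply/cmeasP; split.
  exact: (cmeasr_blaschke lft F1).
exact: (cmeasr_blaschke lft F2).
Qed.

Lemma measurable_transfer v : cmeasr v -> cmeasr (L v).
Proof.
by have [psi [chi lft]] := exists_circle_lift N0 alpha1; exact: (cmeasr_transfer N0 lft).
Qed.

Lemma circint_transferE (u v : C -> R) : cmeasr u -> cmeasr v ->
  (forall z, 0 <= u z) -> (forall z, 0 <= v z) ->
  circint (fun z => u (b z) * v z * Re (J0 alpha z)) = circint (fun z => u z * L v z).
Proof.
have [psi [chi lft]] := exists_circle_lift N0 alpha1.
exact: (circint_transfer N0 alpha1 lft).
Qed.

(* z itself is one of the N points of the fibre over b z. *)
Lemma le_transfer_blaschke (v : C -> R) z : (forall w, 0 <= v w) -> cabs z = 1 ->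
  v z <= N%:R * L v (b z).
Proof.
have [psi [chi lft]] := exists_circle_lift N0 alpha1.
move=> v0 z1; have NR0 : (N%:R : R) != 0 by rewrite pnatr_eq0 -lt0n.
have [s _ sE] := cis_surj (cabs_blaschke z1).
rewrite -sE (transfer_cis N0 lft) mulrA mulfV// mul1r.
have : [set w : C | cabs w = 1 /\ b w = cis s] z by split.
rewrite (fiber_point_image N0 lft) => -[k _ <-]; rewrite (bigD1 k)//= lerDl.
by apply: sumr_ge0.
Qed.

(* Substituting the indicator of a null set: b pulls null sets back to null sets
   because J_0 > 0. *)
Lemma aecirc_blaschke (P : C -> Prop) : aecirc P -> aecirc (fun z => P (b z)).
Proof.
move=> [A [mA A0 PA]].
pose u (z : C) : R := \1_A (argc z).
have u0 z : 0 <= u z by rewrite /u indicE.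
have argcE t : argc (cis t) = angle_mod t.
  by rewrite -cis_angle_mod argc_cis// angle_mod_itv.
have mu_ : cmeasr u.
  rewrite /cmeasr /u; under eq_fun do rewrite argcE.
  by apply: measurableT_comp => //; exact: measurable_angle_mod.
have uP z : cabs z = 1 -> u z = 0 -> P z.
  move=> z1; have [/andP[h1 h2] hz] := argcP z1.
  rewrite /u indicE; case: (pselect (A (argc z))) => Az.
    by rewrite mem_set// => /eqP; rewrite oner_eq0.
  move=> _; apply: contrapT => nP; apply: Az; apply: PA => /= h; apply: nP.
  by rewrite -hz; apply: h; rewrite /Dom /= in_itv/= h1 ltW.
have ae0 : aecirc (fun z => u z = 0).
  (* At the endpoint t = 2 pi the angle [argc (cis t)] is 0, not t, so this point is added to the
     null set. *)
  apply: (@negligibleS _ _ _ _ (A `|` [set tpi])); last first.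
    apply: negligibleU; first by exists A; split => //.
    by exists [set tpi]; split => //; exact: lebesgue_measure_set1.
  move=> t /= h; apply: contrapT => nA; apply: h; rewrite /Dom /= in_itv/= => /andP[t0].
  rewrite le_eqVlt => /predU1P[tE|t1]; first by case: nA; right.
  by rewrite /u argc_cis ?t0// indicE memNset// => At; apply: nA; left.
have v0 (z : C) : 0 <= (fun=> 1 : R) z by [].
have E := circint_transferE mu_ (cmeasr_cst 1) u0 v0.
have mL := measurable_transfer (cmeasr_cst (1 : R)).
(* The absolute value makes the integrand nonnegative off the circle too, as [circint_eq0] asks. *)
have h0 : circint (fun z => u (b z) * `|Re (J0 alpha z)|) = 0%E.
  rewrite (@circint_ext _ _ (fun z => u (b z) * 1 * Re (J0 alpha z))); last first.
    by move=> z /J0_gt0 h; rewrite mulr1 gtr0_norm.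
  rewrite E (@ae_eq_circint _ _ (fun=> 0)); first by rewrite circint_cst mul0r.
  - exact: cmeasrM.
  - exact: cmeasr_cst.
  - by apply: aecirc_mp ae0 _ => z _ ->; rewrite mul0r.
have [psi [chi lft]] := exists_circle_lift N0 alpha1.
have mprod : cmeasr (fun z => u (b z) * `|Re (J0 alpha z)|).
  apply: cmeasrM; first exact: (cmeasr_blaschke lft mu_).
  by apply: cmeasr_norm; exact: cmeasr_J0.
apply: aecirc_mp (circint_eq0 mprod _ h0) _ => [z|z z1].
  by rewrite mulr_ge0.
move=> /eqP; rewrite mulf_eq0 normr_eq0 (gt_eqF (J0_gt0 z1)) orbF => /eqP.
by apply: uP; exact: cabs_blaschke.
Qed.

Lemma Linf_comp_blaschke phi : Linf phi -> Linf (fun z => phi (b z)).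
Proof.
move=> /LinfP[mp [M M0 h]]; apply/LinfP; split; first exact: cmeas_comp_blaschke.
by exists M => //; exact: (aecirc_blaschke h).
Qed.

Variable Jh : C -> C.
Hypothesis hJ : is_sqrtJ alpha Jh.

Lemma sqrtJ_Hinf : Hinf Jh. Proof. by case: hJ. Qed.
Lemma sqrtJV_Hinf : Hinf (fun z => (Jh z)^-1). Proof. by case: hJ. Qed.

Lemma ae_sqmod_sqrtJ : aecirc (fun z => sqmod Jh z = Re (J0 alpha z)).
Proof.
have [_ _ h _] := hJ.
have h' : aecirc (fun z => Jh z * conjc (Jh z) = J0 alpha z) by exact: h.
by apply: aecirc_mp h' _ => z _ <-; rewrite mul_conjc.
Qed.

Lemma ae_sqrtJ_neq0 : aecirc (fun z => Jh z != 0).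
Proof.
apply: aecirc_mp ae_sqmod_sqrtJ _ => z /J0_gt0 h; apply: contraPneq => J0.
by move: h => /[swap]; rewrite /sqmod J0 cabs0 expr0n => <-; rewrite ltxx.
Qed.

(** pi(m) C_b F, convertible with the [mulop m (Cb F)] of the theorem. *)
Definition weighted_comp m F : C -> C := fun z => m z * (Jh z * F (b z)).

Lemma cmeas_wcomp m F : cmeas m -> cmeas F -> cmeas (weighted_comp m F).
Proof.
move=> mm mF; apply: cmeasM => //; apply: cmeasM; last exact: cmeas_comp_blaschke.
by have [[]] := sqrtJ_Hinf.
Qed.

Lemma circint_wcomp m F : cmeas m -> cmeas F ->
  circint (sqmod (weighted_comp m F)) = circint (fun z => sqmod F z * L (sqmod m) z).
Proof.
move=> mm mF; have sm := cmeasr_sqmod mm; have sF := cmeasr_sqmod mF.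
rewrite -circint_transferE//; [|exact: sqmod_ge0|exact: sqmod_ge0].
apply: ae_eq_circint.
- by apply: cmeasr_sqmod; exact: cmeas_wcomp.
- apply: cmeasrM; last exact: cmeasr_J0.
  by apply: cmeasrM => //; exact: cmeasr_sqmod (cmeas_comp_blaschke mF).
apply: aecirc_mp ae_sqmod_sqrtJ _ => z _ <-.
by rewrite /sqmod /weighted_comp !cabsM !exprMn; ring.
Qed.

Lemma transfer_sqmod_ge0 m z : 0 <= L (sqmod m) z.
Proof. by apply: transfer_ge0 => // w; exact: sqmod_ge0. Qed.

Lemma transfer_one z : cabs z = 1 -> L (fun=> 1) z = 1.
Proof.
move=> /cis_surj[s _ <-]; have [psi [chi lft]] := exists_circle_lift N0 alpha1.
rewrite (transfer_cis N0 lft) sumr_const card_ord -(mulr_natl 1 N) mulr1.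
by rewrite mulVf// pnatr_eq0 -lt0n.
Qed.

(** C_b is isometric: the case m = 1 of [circint_wcomp], where L(1) = 1. *)
Lemma circint_sqrtJ_comp F : cmeas F ->
  circint (sqmod (fun z => Jh z * F (b z))) = circint (sqmod F).
Proof.
move=> mF; have := circint_wcomp (cmeas_cst 1) mF.
rewrite (_ : weighted_comp (fun=> 1) F = fun z => Jh z * F (b z)); last first.
  by apply/funext => z; rewrite /weighted_comp mul1r.
move=> ->; apply: circint_ext => z z1.
rewrite (_ : sqmod (fun=> 1) = (fun=> 1)) ?transfer_one ?mulr1//.
by apply/funext => w; rewrite /sqmod cabs1 expr1n.
Qed.

Lemma sqrtJ_comp_L2 F : L2 F -> L2 (fun z => Jh z * F (b z)).
Proof.
move=> [mF F2]; split.
  by apply: cmeasM; [have [[]] := sqrtJ_Hinf|exact: cmeas_comp_blaschke].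
change (circint (sqmod (fun z => Jh z * F (b z))%R) < +oo)%E.
by rewrite circint_sqrtJ_comp.
Qed.

Lemma wcomp_L2 m F : Linf m -> L2 F -> L2 (weighted_comp m F).
Proof. by move=> mI F2; apply: LinfM_L2 => //; exact: sqrtJ_comp_L2. Qed.

Lemma ae_transfer_le_poly m (M : R) : cmeas m -> 0 <= M ->
  (forall P : {poly C}, circint (sqmod (weighted_comp m (fun z => P.[z]))) <=
     M%:E * circint (sqmod (fun z => P.[z])))%E ->
  aecirc (fun z => L (sqmod m) z <= M).
Proof.
move=> mm M0 h; apply: ae_le_poly_weight => //.
- exact: measurable_transfer (cmeasr_sqmod mm).
- exact: transfer_sqmod_ge0.
by move=> P; rewrite -circint_wcomp//; exact: cmeas_poly.
Qed.

(** A bound on m that holds only a.e. does not bound the fibre sums pointwise. Instead ||m C_b P||^2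
    <= M^2 ||P||^2, as C_b is isometric, and the polynomial test returns a bound on L(|m|^2). *)
Lemma ae_transfer_bounded m : Linf m ->
  exists2 M : R, 0 <= M & aecirc (fun z => L (sqmod m) z <= M).
Proof.
move=> /LinfP[mm [M M0 hM]]; exists (M ^+ 2); first exact: sqr_ge0.
apply: ae_transfer_le_poly => // [|P]; first exact: sqr_ge0.
have mP := cmeas_poly P.
have [mJP _] := sqrtJ_comp_L2 (Linf_L2 (Linf_poly P)).
by rewrite -(circint_sqrtJ_comp mP); exact: circint_sqmodM.
Qed.

Lemma Linf_wcomp_bound m (K : R) : cmeas m -> 0 <= K ->
  (forall P : {poly C}, circint (sqmod (weighted_comp m (fun z => P.[z]))) <=
     K%:E * circint (sqmod (fun z => P.[z])))%E -> Linf m.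
Proof.
move=> mm K0 /(ae_transfer_le_poly mm K0)/aecirc_blaschke h.
apply/LinfP; split => //; exists (Num.sqrt (N%:R * K)); first exact: sqrtr_ge0.
apply: aecirc_mp h _ => z z1 h.
rewrite -(ger0_norm (cabs_ge0 _)) -sqrtr_sqr ler_sqrt ?mulr_ge0//.
apply: le_trans (le_transfer_blaschke (@sqmod_ge0 _ m) z1) _.
by rewrite ler_wpM2l.
Qed.

End CompositionBlaschke.

(** * Intertwining operators *)

Section Intertwiners.
Variable R : realType.
Local Notation C := R[i].
Implicit Types (F G m phi : C -> C).
Variables (N : nat) (alpha : 'I_N -> C) (Jh : C -> C).
Hypothesis N0 : (0 < N)%N.
Hypothesis alpha1 : forall j, cabs (alpha j) < 1.
Hypothesis hJ : is_sqrtJ alpha Jh.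
Local Notation b := (blaschke alpha).
Local Notation L := (transfer alpha).
Local Notation wcomp := (weighted_comp alpha Jh).

Lemma circint_wcomp_le m : Linf m -> exists2 M : R, 0 <= M & forall F, cmeas F ->
  (circint (sqmod (wcomp m F)) <= M%:E * circint (sqmod F))%E.
Proof.
move=> /LinfP[mm [M M0 hM]]; exists (M ^+ 2) => [|F mF]; first exact: sqr_ge0.
have [[mJ _] _] := sqrtJ_Hinf hJ.
rewrite -(circint_sqrtJ_comp N0 alpha1 hJ mF); apply: circint_sqmodM => //.
by apply: cmeasM => //; exact: (cmeas_comp_blaschke N0 alpha1).
Qed.

Lemma H2_poly_blaschke (P : {poly C}) : H2 (fun z => P.[b z]).
Proof.
elim/poly_ind: P => [|P c ih].
  rewrite (_ : (fun z => _) = (fun z => (0 : {poly C}).[z])); first exact: H2_poly.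
  by apply/funext => z; rewrite !horner0.
have := H2D (Hinf_mul_H2 (Hinf_blaschke alpha1) ih) (H2_poly c%:P).
rewrite (_ : (fun z => _ + _) = (fun z => (P * 'X + c%:P).[b z]))//.
by apply/funext => z; rewrite hornerMXaddC hornerC mulrC.
Qed.

(** C_b is isometric and sends polynomials into H^2, so density and closedness of H^2 suffice. *)
Lemma sqrtJ_comp_H2 F : H2 F -> H2 (fun z => Jh z * F (b z)).
Proof.
move=> hF; have F2 := H2_L2 hF.
apply: H2_limit => [|e e0]; first exact: (sqrtJ_comp_L2 N0 alpha1 hJ F2).
have [P hP] := H2_dense hF e0.
exists (fun z => Jh z * P.[b z]); first exact: Hinf_mul_H2 (sqrtJ_Hinf hJ) (H2_poly_blaschke P).
have mFP : cmeas (fun z => F z - P.[z]) by apply: cmeasB; [case: F2|exact: cmeas_poly].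
rewrite -(circint_sqrtJ_comp N0 alpha1 hJ mFP) in hP.
by rewrite (@circint_ext _ _ (sqmod (fun z => Jh z * (F (b z) - P.[b z]))))// => z _; rewrite /sqmod mulrBr.
Qed.

Lemma wcomp_H2 m F : Hinf m -> H2 F -> H2 (wcomp m F).
Proof. by move=> hm hF; apply: Hinf_mul_H2 => //; exact: sqrtJ_comp_H2. Qed.

(* phi o b = J^{-1/2} (C_b phi), a product of two analytic factors. *)
Lemma Hinf_comp_blaschke phi : Hinf phi -> Hinf (fun z => phi (b z)).
Proof.
move=> hphi; have [phiI _] := hphi.
have phibI := Linf_comp_blaschke N0 alpha1 phiI.
split => //; suff [] : H2 (fun z => phi (b z)) by [].
apply: H2_ae (Hinf_mul_H2 (sqrtJV_Hinf hJ) (sqrtJ_comp_H2 (Hinf_H2 hphi))); first by case: phibI.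
apply/aeeqE; apply: aecirc_mp (ae_sqrtJ_neq0 N0 alpha1 hJ) _ => z _ J0.
by rewrite mulrA mulVf// mul1r.
Qed.

Lemma toep_wcomp m F : Hinf m -> H2 F ->
  H2 (toep m (fun z => Jh z * F (b z))) /\
  aeeq (toep m (fun z => Jh z * F (b z))) (wcomp m F).
Proof. by move=> hm hF; apply: toepP; exact: wcomp_H2. Qed.

Lemma wcomp_quotient G F : aeeq (wcomp (fun z => (Jh z)^-1 * G z) F) (fun z => F (b z) * G z).
Proof.
apply/aeeqE; apply: aecirc_mp (ae_sqrtJ_neq0 N0 alpha1 hJ) _ => z _ J0.
by rewrite /weighted_comp mulrACA mulVf// mul1r mulrC.
Qed.

Lemma Linf_symbol (S : (C -> C) -> Prop) (T : (C -> C) -> C -> C) m :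
  bdd_op S T -> (forall F, S F -> L2 F) -> (forall P : {poly C}, S (fun z => P.[z])) ->
  cmeas m -> (forall P : {poly C}, aeeq (T (fun z => P.[z])) (wcomp m (fun z => P.[z]))) ->
  Linf m.
Proof.
move=> [TS _ _ _ [K TK]] S2 SP mm TP.
apply: (Linf_wcomp_bound N0 alpha1 hJ mm (sqr_ge0 K)) => P.
have TP2 := S2 _ (TS _ (SP P)).
rewrite -(ae_sqmod TP2.1 _ (TP P)).
  by apply: sqr_l2norm_le (TK _ (SP P)) => //; exact: S2.
exact: (cmeas_wcomp N0 alpha1 hJ mm (cmeas_poly P)).
Qed.

Lemma L2_intertwiner T : bdd_op (@L2 R) T ->
  (forall phi, Linf phi -> op_eq (@L2 R) (fun F => T (mulop phi F)) (fun F => mulop (phi \o b) (T F))) ->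
  exists m, Linf m /\ op_eq (@L2 R) T (wcomp m).
Proof.
move=> Tb TI; have [TL _ _ _ _] := Tb.
have L21 := Linf_L2 (Linf_cst (1 : C)).
pose T1 := T (fun=> 1); have mT1 := (TL _ L21).1.
pose m z := (Jh z)^-1 * T1 z.
have [[mJV _] _] := sqrtJV_Hinf hJ.
have mm : cmeas m by exact: cmeasM.
have Tphi phi : Linf phi -> aeeq (T phi) (fun z => phi (b z) * T1 z).
  move=> phiI; have := TI phi phiI _ L21.
  by rewrite (_ : mulop phi (fun=> 1) = phi)//; apply/funext => z; rewrite /mulop mulr1.
exists m; split.
  apply: (Linf_symbol Tb) => // [P|P]; first exact/Linf_L2/Linf_poly.
  exact: aeeq_trans (Tphi _ (Linf_poly P)) (aeeq_sym (wcomp_quotient _ _)).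
move=> F F2; apply: aeeq_trans (aeeq_sym (wcomp_quotient _ _)).
(* This symbol and its product with F are bounded, and it never vanishes, so it
   can be cancelled from (phi o b) (T F) = T (phi F) = (phi F o b) T1. *)
pose phi z : C := Complex (expR (- cabs (F z))) 0.
have mphi : cmeas phi.
  apply: cmeas_real; apply: (cmeasr_comp (f := @expR R)); first exact: measurable_expR.
  by apply: cmeasrN; apply: cmeasr_cabs; case: F2.
have phiE z : cabs (phi z) = expR (- cabs (F z)) by rewrite cabs_real ger0_norm ?expR_ge0.
have phiI : Linf phi.
  apply/LinfP; split => //; exists 1 => //; apply: aecircW => z _.
  by rewrite phiE -[leRHS]expR0 ler_expR oppr_le0 cabs_ge0.
have phiFI : Linf (fun z => phi z * F z).
  apply/LinfP; split; first by apply: cmeasM => //; case: F2.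
  exists 1 => //; apply: aecircW => z _.
  rewrite cabsM phiE expRN mulrC ler_pdivrMr ?expR_gt0// mul1r.
  by apply: le_trans (expR_ge1Dx _); rewrite lerDr.
have h1 := (aeeqE _ _).1 (Tphi _ phiFI).
have h2 := (aeeqE _ _).1 (TI _ phiI _ F2).
apply/aeeqE; apply: aecirc_mp2 h1 h2 _ => z _ e1 e2.
apply: (@mulfI _ (phi (b z))); first by rewrite -cabs_eq0 phiE gt_eqF ?expR_gt0.
by rewrite mulrA -e1 -[LHS]e2.
Qed.

Lemma wcomp_intertwines T m phi F : Linf m -> op_eq (@L2 R) T (wcomp m) -> Linf phi -> L2 F ->
  aeeq (T (mulop phi F)) (mulop (phi \o b) (T F)).
Proof.
move=> mI Tm phiI F2; have h1 := (aeeqE _ _).1 (Tm _ (LinfM_L2 phiI F2)).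
have h2 := (aeeqE _ _).1 (Tm _ F2).
apply/aeeqE; apply: aecirc_mp2 h1 h2 _ => z _ e1 e2.
by rewrite [LHS]e1 /mulop e2 /weighted_comp /=; ring.
Qed.

(** The symbol e^{-|F|} of the L^2 case is not analytic, so equality is extended from polynomials by
    continuity of both operators. The symbol m first lies in H^2, as T1 times the H^infinity
    function 1 / J^{1/2}; boundedness of T then makes it bounded. *)
Lemma H2_intertwiner T : bdd_op (@H2 R) T ->
  (forall phi, Hinf phi -> op_eq (@H2 R) (fun F => T (toep phi F)) (fun F => toep (phi \o b) (T F))) ->
  exists m, Hinf m /\ op_eq (@H2 R) T (wcomp m).
Proof.
move=> Tb TI; have [TH Tae TD _ [K TK]] := Tb.
have h1 := H2_one R.
pose T1 := T (fun=> 1); have hT1 : H2 T1 by exact: TH.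
pose m z := (Jh z)^-1 * T1 z.
have hm : H2 m by exact: Hinf_mul_H2 (sqrtJV_Hinf hJ) hT1.
have TP (P : {poly C}) : aeeq (T (fun z => P.[z])) (wcomp m (fun z => P.[z])).
  have hP := Hinf_poly P.
  have P1 : H2 (fun z => P.[z] * 1) by exact: Hinf_mul_H2.
  have [hP1 eP1] := toepP P1.
  have hPT1 := Hinf_mul_H2 (Hinf_comp_blaschke hP) hT1.
  apply: aeeq_trans (aeeq_sym (wcomp_quotient _ _)).
  apply: aeeq_trans (toepP hPT1).2.
  apply: aeeq_trans (TI _ hP _ h1).
  apply: Tae => //; first exact: H2_poly.
  apply: aeeq_trans (aeeq_sym eP1).
  by apply: aeeq_on => z _; rewrite mulr1.
have mI : Linf m.
  apply: (Linf_symbol Tb) => // [F|P|]; [exact: H2_L2|exact: H2_poly|by have [[]] := hm].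
exists m; split; first by split => //; have [] := hm.
move=> F hF; have [M M0 wM] := circint_wcomp_le mI.
have mF := (H2_L2 hF).1; have mTF := (H2_L2 (TH _ hF)).1; have mw := cmeas_wcomp N0 alpha1 hJ mI.1 mF.
apply: aeeq_cancel_sqmod => //; apply/eqP; rewrite eq_le; apply/andP; split; last first.
  by apply: circint_ge0 => z; exact: sqmod_ge0.
apply/lee_addgt0Pr => e e0; rewrite add0e.
(* T and m C_b agree on P, so T F - m C_b F equals the same difference at G = F - P, whose squared
   size is at most 2 K^2 + 2 M times that of G. The added 1 keeps c positive. *)
pose c := 2 * K ^+ 2 + 2 * M + 1.
have c0 : 0 < c by rewrite /c ltr_wpDl// addr_ge0// mulr_ge0// sqr_ge0.
have [P hP] := H2_dense hF (divr_gt0 e0 c0).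
pose G z := F z - P.[z].
have hG : H2 G by exact: H2B hF (H2_poly P).
have mG := (H2_L2 hG).1; have mTG := (H2_L2 (TH _ hG)).1.
have mwG := cmeas_wcomp N0 alpha1 hJ mI.1 mG.
have E : aeeq (fun z => T F z - wcomp m F z) (fun z => T G z + - wcomp m G z).
  have e1 := TD _ _ hG (H2_poly P).
  rewrite (_ : (fun z => G z + _) = F) in e1; last by apply/funext => z; rewrite subrK.
  have := (aeeqE _ _).1 e1; have := (aeeqE _ _).1 (TP P).
  move=> e2 e3; apply/aeeqE; apply: aecirc_mp2 e2 e3 _ => z _ e2 e3.
  by rewrite e3 e2 /weighted_comp /G; ring.
rewrite (ae_sqmod _ _ E); [|exact: cmeasB|by apply: cmeasD => //; exact: cmeasN].
have hTG : (circint (sqmod (T G)) <= (K ^+ 2 * (e / c))%:E)%E.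
  apply: le_trans (sqr_l2norm_le (H2_L2 (TH _ hG)) (H2_L2 hG) (TK _ hG)) _.
  by rewrite (EFinM (K ^+ 2)); apply: lee_wpmul2l => //; rewrite lee_fin sqr_ge0.
have hwG : (circint (sqmod (fun z => - wcomp m G z)%R) <= (M * (e / c))%:E)%E.
  rewrite (@circint_ext _ _ (sqmod (wcomp m G))); last by move=> z _; rewrite /sqmod cabsN.
  by apply: le_trans (wM _ mG) _; rewrite (EFinM M) lee_wpmul2l// lee_fin.
apply: le_trans (circint_sqmodD_le mTG (cmeasN mwG) hTG hwG) _; rewrite lee_fin.
have -> : 2 * (K ^+ 2 * (e / c)) + 2 * (M * (e / c)) = (2 * K ^+ 2 + 2 * M) * e / c.
  by move: (K ^+ 2) c^-1 => x y; ring.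
by rewrite ler_pdivrMr// mulrC ler_pM2l// lerDl.
Qed.

(** [toep phi F] equals phi F only almost everywhere, so T being compatible with a.e. equality is
    what allows replacing one by the other under T. *)
Lemma toep_wcomp_intertwines T m phi F : bdd_op (@H2 R) T -> Hinf m ->
  op_eq (@H2 R) T (wcomp m) -> Hinf phi -> H2 F ->
  aeeq (T (toep phi F)) (toep (phi \o b) (T F)).
Proof.
move=> [TH Tae _ _ _] hm Tm hphi hF.
have hphiF := Hinf_mul_H2 hphi hF.
have [ht et] := toepP hphiF.
have hb := Hinf_mul_H2 (Hinf_comp_blaschke hphi) (TH _ hF).
apply: aeeq_trans (aeeq_sym (toepP hb).2).
apply: aeeq_trans (Tae _ _ ht hphiF et) _.
have h1 := (aeeqE _ _).1 (Tm _ hphiF); have h2 := (aeeqE _ _).1 (Tm _ hF).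
apply/aeeqE; apply: aecirc_mp2 h1 h2 _ => z _ -> ->.
by rewrite /weighted_comp; ring.
Qed.

Lemma norm_wcomp (S : (C -> C) -> Prop) (T : (C -> C) -> C -> C) m :
  (forall F, S F -> L2 F) -> (forall P : {poly C}, S (fun z => P.[z])) -> Linf m ->
  (forall F, S F -> cmeas (T F) /\ aeeq (T F) (wcomp m F)) ->
  opnorm S T = Num.sqrt (essnorm (L (sqmod m))) /\
  (isometry_on S T <-> {ae @mu R, forall t, @Dom R t -> L (sqmod m) (cis t) = 1}).
Proof.
move=> S2 SP mI TE.
have mg := measurable_transfer N0 alpha1 (cmeasr_sqmod mI.1).
have g0 := @transfer_sqmod_ge0 _ _ alpha N0 m.
have TE' F : S F -> L2 (T F) /\
    circint (sqmod (T F)) = circint (fun z => sqmod F z * L (sqmod m) z).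
  move=> SF; have F2 := S2 _ SF; have [mT eT] := TE _ SF.
  have w2 := wcomp_L2 N0 alpha1 hJ mI F2.
  split; first exact: L2_ae (aeeq_sym eT) w2.
  by rewrite (ae_sqmod mT w2.1 eT) (circint_wcomp N0 alpha1 hJ mI.1 F2.1).
split; last exact: isometry_weight.
apply: opnorm_weight => //.
exact: (ae_transfer_bounded N0 alpha1 hJ mI).
Qed.
End Intertwiners.

Theorem theorem4p7 (R : realType) (N : nat) (alpha : 'I_N -> R[i]) (Jh : cfun R) :
  (0 < N)%N -> (forall j, cabs (alpha j) < 1) -> is_sqrtJ alpha Jh ->
  let b := blaschke alpha in
  let Cb := fun F => mulop Jh (Gam b F) in
  (* (1) *)
  (forall T, bdd_op (@L2 R) T ->
     ((forall phi, Linf phi -> op_eq (@L2 R) (fun F => T (mulop phi F))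
                                            (fun F => mulop (phi \o b) (T F)))
      <-> exists m, Linf m /\ op_eq (@L2 R) T (fun F => mulop m (Cb F)))) /\
  (* (2) *)
  (forall T, bdd_op (@H2 R) T ->
     ((forall phi, Hinf phi -> op_eq (@H2 R) (fun F => T (toep phi F))
                                            (fun F => toep (phi \o b) (T F)))
      <-> exists m, Hinf m /\ op_eq (@H2 R) T (fun F => toep m (Cb F)))) /\
  (* norm and isometry, case (1) *)
  (forall m, Linf m ->
     opnorm (@L2 R) (fun F => mulop m (Cb F)) = Num.sqrt (essnorm (transfer alpha (sqmod m))) /\
     (isometry_on (@L2 R) (fun F => mulop m (Cb F)) <->
        {ae @mu R, forall t, @Dom R t -> transfer alpha (sqmod m) (cis t) = 1})) /\
  (* norm and isometry, case (2) *)
  (forall m, Hinf m ->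
     opnorm (@H2 R) (fun F => toep m (Cb F)) = Num.sqrt (essnorm (transfer alpha (sqmod m))) /\
     (isometry_on (@H2 R) (fun F => toep m (Cb F)) <->
        {ae @mu R, forall t, @Dom R t -> transfer alpha (sqmod m) (cis t) = 1})).
Proof.
move=> N0 alpha1 hJ b Cb.
have toepE m F : Hinf m -> H2 F ->
    H2 (toep m (Cb F)) /\ aeeq (toep m (Cb F)) (weighted_comp alpha Jh m F).
  by move=> hm hF; exact: (toep_wcomp N0 alpha1 hJ hm hF).
split; [|split; [|split]].
- move=> T Tb; split; first exact: (L2_intertwiner N0 alpha1 hJ Tb).
  by move=> [m [mI Tm]] phi phiI F F2; exact: (wcomp_intertwines mI Tm phiI F2).
- move=> T Tb; split.
    move=> /(H2_intertwiner N0 alpha1 hJ Tb)[m [hm Tm]]; exists m; split => // F hF.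
    exact: aeeq_trans (Tm _ hF) (aeeq_sym (toepE _ _ hm hF).2).
  move=> [m [hm Tm]] phi hphi F hF.
  apply: (toep_wcomp_intertwines N0 alpha1 hJ Tb hm) => // G hG.
  exact: aeeq_trans (Tm _ hG) (toepE _ _ hm hG).2.
- move=> m mI; apply: (norm_wcomp N0 alpha1 hJ) => // [P|F F2].
    exact/Linf_L2/Linf_poly.
  split; last exact: aeeq_refl.
  by have [] := wcomp_L2 N0 alpha1 hJ mI F2.
- move=> m hm; apply: (norm_wcomp N0 alpha1 hJ) => // [F|P||F hF].
  + exact: H2_L2.
  + exact: H2_poly.
  + by case: hm.
  + by have [hT eT] := toepE _ _ hm hF; split => //; have [[]] := hT.
Qed.
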